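(* Let $K$ be a number field, let $d\geq 2$ be an integer, and let $s_1,\dots,s_{d-1},t$ be independent transcendentals over $K$. Put $K_{s,t}:=K(s_1,\dots,s_{d-1},t)$ and $f(x)=x^d+s_1x^{d-1}+\dots+s_{d-1}x+t\in K_{s,t}[x]$. Then for every integer $n\geq 0$, \[\operatorname{Gal}\left(K_{s,t}\left(\left(f'\circ f^n\right)^{-1}(0)\right)/K_{s,t}\right)\cong S_{d-1}[[S_d]^n].\]
   Context: $f^n$ denotes the $n$-th iterate of $f$ under composition ($f^0(x)=x$), and $K_{s,t}((f'\circ f^n)^{-1}(0))$ is the field generated over $K_{s,t}$ by all roots of $f'(f^n(x))$ in an algebraic closure. $[S_d]^n$ denotes the $n$-th iterated wreath product of the symmetric group $S_d$ with itself, i.e. the automorphism group of the complete rooted $d$-ary tree of depth $n$ ($[S_d]^0$ is trivial). $S_{d-1}[[S_d]^n]$ denotes the wreath product of $[S_d]^n$ by $S_{d-1}$, i.e. the automorphism group of the rooted tree of depth $n+1$ in which the root has $d-1$ children and every other non-leaf vertex has $d$ children. *)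

(* Defs.v *)
From HB Require Import structures.
From mathcomp Require Import all_boot all_order all_algebra all_fingroup.
From mathcomp Require Import all_solvable all_field.
From mathcomp Require Import mpoly.

Set Implicit Arguments.
Unset Strict Implicit.
Unset Printing Implicit Defensive.

Import GRing.Theory.

Section WreathProduct.

Variables (k : nat) (gT : finGroupType).

Local Open Scope group_scope.

Definition base_group : finGroupType := {dffun forall i : 'I_k, gT}.

(* MathComp permutations compose left to right, (s * t) i = t (s i), and actions
   are right actions, hence the inverse. *)
Definition coord_perm (x : base_group) (s : 'S_k) : base_group :=
  [ffun i => x (s^-1 i)].

Lemma coord_perm_is_action : is_action [set: 'S_k] coord_perm.
Proof.
apply: is_total_action => [x | x s t]; apply/ffunP=> i; rewrite !ffunE.
  by rewrite invg1 perm1.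
by rewrite invMg permM.
Qed.

Definition coord_action := Action coord_perm_is_action.

Lemma coord_action_is_groupAction :
  is_groupAction [set: base_group] coord_action.
Proof.
move=> s _; rewrite inE; apply/andP; split.
  by apply/subsetP=> x _; rewrite inE.
by apply/morphicP=> x y _ _; rewrite !actpermE; apply/ffunP=> i; rewrite !ffunE.
Qed.

Definition coord_groupAction := GroupAction coord_action_is_groupAction.

(* S_k[G] = G^k ><| S_k *)
Definition sym_wreath : finGroupType := sdprod_by coord_groupAction.

Lemma card_sym_wreath : #|[set: sym_wreath]| = (#|gT| ^ k * k`!)%N.
Proof.
rewrite -(sdprod_card (sdprod_sdpair coord_groupAction)).
rewrite !card_injm ?injm_sdpair1 ?injm_sdpair2 // !cardsT card_Sn.
rewrite card_dep_ffun; congr (_ * _)%N.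
by rewrite foldrE big_map big_enum prod_nat_const card_ord.
Qed.

End WreathProduct.

(* [S_d]^n; the base case 'S_0 is the trivial group. *)
Fixpoint iter_sym_wreath (d n : nat) : finGroupType :=
  if n is m.+1 then sym_wreath d (iter_sym_wreath d m) else 'S_0.

Local Open Scope ring_scope.

Section GenericPolynomial.

Variables (K : fieldType) (d : nat).

(* K(s_1, ..., s_(d-1), t) *)
Definition Kst : fieldType := {fraction {mpoly K[d]}}.

(* Indices start at 0: param i is s_(i+1) for i < d - 1, and the last one,
   param (d - 1), is t. *)
Definition param (i : 'I_d) : Kst := FracField.tofrac ('X_i : {mpoly K[d]}).

Definition generic_poly : {poly Kst} :=
  'X^d + \sum_(i < d) param i *: 'X^(d - i.+1).

End GenericPolynomial.

Definition iter_poly (F : fieldType) (f : {poly F}) (n : nat) : {poly F} :=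
  iter n (fun g => f \Po g) 'X.

(* Main.v *)
(** Write [f_] for the generic polynomial and [T k] for the roots of [f' o f^k].
    The Galois group [G] acts on the tree whose levels are [T 0, ..., T n] (a root
    with children [T 0], the map [f_] sending each node to its parent), and one has
    to show that every automorphism of this tree comes from [G].  Level by level this
    reduces to realizing, for any two siblings [a], [b] of [T k], the transposition
    [(a b)] on [T k].

    Such elements come from inertia groups.  Specialize [f] to a curve of polynomials
    over [F[u]], [F] an algebraic closure of [K(s, t)], which is the generic
    polynomial at [u = 1] and an arbitrarily chosen polynomial [fb] at [u = 0]; the
    curve is injective on [K[s, t]], so nothing is lost.  The roots acquire values
    [phi x] in [F] at [u = 0], and if [f^k(c') - c] vanishes there to order exactly
    one in [u], then the inertia group permutes transitively the roots [x] of
    [f^k(x) = c] with [phi x = phi c'], and preserves [phi] on all of [T k].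
    With [fb = X^d] this gives transitivity; with [fb = X^d - X^(d-1)], a node whose
    stabilizer is transitive on its siblings; and with [fb = X^d - e X^(d-1) + t0],
    whose critical point [A = (d-1)e/d] is periodic of exact period [k] while [0]
    avoids [A] and [0], exactly two nodes of [T k] collide, which gives a
    transposition.  (On [T 0] one prescribes [f'] at [u = 0] in the same spirit.)
    The parameter [t0] exists by deforming the superattracting parameters of [X^d + t]
    (the case [e = 0]), which are simple roots by Gleason's argument. *)

(* Order exactly one matters because, over the field generated by [T 0], the product of [c' - x]
   over the nodes [x] above [c] is the polynomial [f^k(c') - c] in [u]: two inertia-invariant groups
   of factors, each vanishing at [u = 0], would each contribute a factor [u]. The coefficient of [u]
   follows the chain rule along the orbit of [c']; in the periodic case this makes it a derivative
   with respect to [t], nonzero because the parameter is a simple root. The parameter [e] is there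
   because for [X^d + t] all critical points merge at [0] and [d] nodes would collide at once; [e]
   detaches a simple critical point [A]. Two nodes above the same [c] with equal values must
   separate at a critical point of [fb], and exact periodicity confines this to a single level. As
   [e] is transcendental over the rationals, nonvanishing at one point with [e = 0] passes to [e].
   One transposition [(a b)] yields all of them by conjugation: transitivity moves [a] to any node,
   and the stabilizer of a node then moves [b] to any sibling. *)
Require Import Defs.
From HB Require Import structures.
From mathcomp Require Import all_boot all_order all_algebra all_fingroup.
From mathcomp Require Import all_solvable all_field.
From mathcomp Require Import mpoly.
From mathcomp Require Import ring zify.
From Stdlib Require Import ClassicalEpsilon.

Set Implicit Arguments.
Unset Strict Implicit.
Unset Printing Implicit Defensive.

Import GRing.Theory.
Local Open Scope ring_scope.

(** * Countable fields and fractions *)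

Section Countability.

Lemma can_pcancel (T : Type) (C : countType) (f : T -> C) (g : C -> T) :
  cancel f g -> {f : T -> nat & {g : nat -> option T | pcancel f g}}.
Proof.
move=> fK; exists (pickle \o f); exists (fun k => omap g (unpickle k)) => x.
by rewrite /= pickleK /= fK.
Qed.

Lemma fieldExt_pcancel (K : fieldExtType rat) :
  {f : K -> nat & {g : nat -> option K | pcancel f g}}.
Proof. by apply: can_pcancel (passmx.rVofK (vbasisP {:K})). Qed.

Lemma mpoly_pcancel (R : countNzRingType) n :
  {f : {mpoly R[n]} -> nat & {g : nat -> option {mpoly R[n]} | pcancel f g}}.
Proof.
pose C : countType := seq ('X_{1..n} * R)%type.
pose f (p : {mpoly R[n]}) : C := [seq (m, p@_m) | m <- msupp p].
pose g (s : C) : {mpoly R[n]} := \sum_(x <- s) x.2 *: 'X_[x.1].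
by apply: (@can_pcancel _ C f g) => p; rewrite /f /g big_map -mpolyE.
Qed.

Lemma fraction_pcancel (R : idomainType) :
  {f : R -> nat & {g : nat -> option R | pcancel f g}} ->
  {f : {fraction R} -> nat & {g : nat -> option {fraction R} | pcancel f g}}.
Proof.
move=> [f [g fK]].
exists (fun x => pickle (f (frac (generic_quotient.repr x)).1, f (frac (generic_quotient.repr x)).2)).
exists (fun n => if unpickle n is Some (a, b) then
   if (g a, g b) is (Some x, Some y) then Some (\pi_(FracField.type R)%qT (Ratio x y)) else None else None).
move=> x /=; rewrite pickleK /= !fK; congr Some.
by rewrite Ratio_numden generic_quotient.reprK.
Qed.

(** [countable_algebraic_closure] applies to countable fields. Number fields, polynomial rings over
    them and fraction fields inherit an encoding in [nat], which the preceding lemmas carry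
    along. *)
Lemma closure_exists (F : fieldType) :
  {f : F -> nat & {g : nat -> option F | pcancel f g}} ->
  {C : countClosedFieldType & {rmorphism F -> C}}.
Proof.
move=> [f [g fK]].
pose cF : countFieldType := HB.pack_for countFieldType F (PCanIsCountable fK).
have [C [j _]] := countable_algebraic_closure cF.
by exists C; exact: j.
Qed.

End Countability.

Section FractionLift.

Variables (R : idomainType) (O : fieldType) (j : {rmorphism R -> O}).
Hypothesis j_inj : injective j.

Lemma fraction_decomp (x : {fraction R}) :
  {ab : R * R | ab.2 != 0 & x * FracField.tofrac ab.2 = FracField.tofrac ab.1}.
Proof.
exists (frac (generic_quotient.repr x)); first exact: denom_ratioP.
suff P (r : {ratio R}) :
    (\pi_(FracField.type R)%qT r : {fraction R}) * FracField.tofrac (frac r).2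
    = FracField.tofrac (frac r).1.
  by apply: etrans (P _); congr (_ * _); rewrite generic_quotient.reprK.
case: r => -[a b] /= b0; unlock FracField.tofrac.
rewrite -[LHS]FracField.pi_mul; apply/generic_quotient.eqmodP/eqP => /=.
by rewrite /FracField.mulf /= !numden_Ratio ?mulr1 ?oner_eq0 // mulrC.
Qed.

(** The universal property of the fraction field, for an injective morphism into a field;
    [frac_liftP] shows independence of the chosen numerator and denominator. *)
Definition frac_lift (x : {fraction R}) : O :=
  let: exist2 ab _ _ := fraction_decomp x in j ab.1 / j ab.2.

Lemma j_neq0 a : a != 0 -> j a != 0.
Proof. by apply: contra => /eqP ja; rewrite -(inj_eq j_inj) ja rmorph0. Qed.

Lemma frac_liftP x a b : b != 0 ->
  x * FracField.tofrac b = FracField.tofrac a -> frac_lift x = j a / j b.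
Proof.
rewrite /frac_lift; case: (fraction_decomp x) => -[a' b'] /= b'0 Hx b0 Hx'.
apply/eqP; rewrite eqr_div ?j_neq0 // -!rmorphM; apply/eqP; congr (j _).
apply/eqP; rewrite -tofrac_eq !rmorphM /= -Hx -Hx'.
by apply/eqP; ring.
Qed.

Lemma frac_lift_tofrac a : frac_lift (FracField.tofrac a) = j a.
Proof.
by rewrite (@frac_liftP _ a 1) ?oner_eq0 ?rmorph1 ?mulr1 ?divr1.
Qed.

Lemma frac_lift_zmod : zmod_morphism frac_lift.
Proof.
move=> x y; have [[a b] /= b0 Hx] := fraction_decomp x.
have [[a' b'] /= b'0 Hy] := fraction_decomp y.
rewrite (frac_liftP b0 Hx) (frac_liftP b'0 Hy).
rewrite (@frac_liftP _ (a * b' - a' * b) (b * b')) ?mulf_neq0 //.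
  by rewrite rmorphB !rmorphM; field; rewrite !j_neq0.
by rewrite rmorphB !rmorphM /= -Hx -Hy; ring.
Qed.

Lemma frac_lift_monoid : monoid_morphism frac_lift.
Proof.
split; first by rewrite -(rmorph1 j) -frac_lift_tofrac rmorph1.
move=> x y; have [[a b] /= b0 Hx] := fraction_decomp x.
have [[a' b'] /= b'0 Hy] := fraction_decomp y.
rewrite (frac_liftP b0 Hx) (frac_liftP b'0 Hy).
rewrite (@frac_liftP _ (a * a') (b * b')) ?mulf_neq0 //.
  by rewrite !rmorphM; field; rewrite !j_neq0.
by rewrite !rmorphM /= -Hx -Hy; ring.
Qed.

Lemma fraction_lift :
  {J : {rmorphism {fraction R} -> O} | forall a, J (FracField.tofrac a) = j a}.
Proof.
pose A := GRing.isZmodMorphism.Build _ _ frac_lift frac_lift_zmod.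
pose B := GRing.isMonoidMorphism.Build _ _ frac_lift frac_lift_monoid.
pose J : {rmorphism {fraction R} -> O} := HB.pack frac_lift A B.
by exists J => a; rewrite -frac_lift_tofrac.
Qed.

End FractionLift.

(** In characteristic 0 the integers are infinitely many points. This provides generic linear
    combinations whose coefficients are the powers of one integer. *)
Lemma avoid_roots (F : fieldType) (ps : seq {poly F}) :
  [pchar F] =i pred0 -> {in ps, forall p, p != 0} ->
  exists m : nat, {in ps, forall p, p.[m%:R] != 0}.
Proof.
move=> F0 ps0; pose P := \prod_(p <- ps) p.
have P0 : P != 0 by rewrite prodf_seq_neq0; apply/allP => p /ps0 ->.
pose s := [seq (m%:R : F) | m <- iota 0 (size P)].
have us : uniq s.
  rewrite map_inj_uniq ?iota_uniq // => a b /eqP.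
  wlog le_ab : a b / (a <= b)%N.
    by move=> W E; case/orP: (leq_total a b) => /W; [|rewrite eq_sym in E] => ->.
  rewrite eq_sym -subr_eq0 -natrB // (pcharf0P _).1 // => E.
  by apply/eqP; rewrite eqn_leq le_ab -subn_eq0.
have /allPn [_ /mapP [m _ ->] nm] : ~~ all (root P) s.
  apply/negP => aP; have := max_poly_roots P0 aP us.
  by rewrite size_map size_iota ltnn.
exists m => p ps_p; apply: contra nm => /eqP pm.
by rewrite /root horner_prod prodf_seq_eq0; apply/hasP; exists p; rewrite ?pm ?eqxx.
Qed.

(** * Specializing at [u = 0] *)

Section HomExtension.

Variables (F0 : fieldType) (L : fieldExtType F0) (O : closedFieldType).
Variable (J : {rmorphism F0 -> O}).
Hypothesis F0_char0 : [pchar F0] =i pred0.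

(** In characteristic 0 [L] is generated by one element [th], which is sent to any root in [O] of
    the image of its minimal polynomial. *)
Lemma hom_extends : exists h : {rmorphism L -> O}, forall a, h a%:A = J a.
Proof.
have L0 : [pchar L] =i pred0 by move=> p; rewrite pchar_lalg.
have sepL : separable 1%AS {:L}%AS.
  by apply/separableP => x _; apply: pcharf0_separable.
pose th := separable_generator 1%AS {:L}%AS.
have thL z : z \in <<1; th>>%VS.
  by rewrite -(eq_adjoin_separable_generator sepL (sub1v _)) memvf.
have /polyOver1P [q Eq] := minPolyOver 1%AS th.
have sq : size (map_poly J q) != 1%N.
  rewrite size_map_poly -(size_map_poly (in_alg L)) -Eq size_minPoly.
  by rewrite eqSS -lt0n adjoin_degreeE divn_gt0 ?adim_gt0 // dimvS ?subv_adjoin.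
have [th' root_th'] : exists x, root (map_poly J q) x.
  exact/closed_rootP.
have ex z : exists p, z = (map_poly (in_alg L) p).[th].
  have /polyOver1P [p Ep] := Fadjoin_polyOver 1%AS th z.
  by exists p; rewrite -Ep Fadjoin_poly_eq.
have ex' z : exists p, z == (map_poly (in_alg L) p).[th].
  by have [p /eqP] := ex z; exists p.
pose p_ z := xchoose (ex' z).
have p_P z : z = (map_poly (in_alg L) (p_ z)).[th] by apply/eqP/(xchooseP (ex' z)).
pose h z := (map_poly J (p_ z)).[th'].
have hP p : h (map_poly (in_alg L) p).[th] = (map_poly J p).[th'].
  apply/eqP; rewrite -subr_eq0 /h -hornerN -hornerD -rmorphN -rmorphD /=.
  set r := (p_ _ + _); have : root (map_poly (in_alg L) r) th.
    by rewrite /root /r rmorphD rmorphN /= hornerD hornerN -p_P subrr.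
  move=> rt; have : map_poly (in_alg L) q %| map_poly (in_alg L) r.
    by rewrite -Eq; apply: minPoly_dvdp => //; apply: alg_polyOver.
  rewrite dvdp_map => /dvdpP [s ->].
  by rewrite rmorphM hornerM (rootP root_th') mulr0.
have h_zmod : zmod_morphism h.
  move=> x y; rewrite {1}(p_P x) {1}(p_P y) -hornerN -hornerD -rmorphN -rmorphD hP.
  by rewrite rmorphD rmorphN hornerD hornerN.
have h_mon : monoid_morphism h.
  split; first by have := hP 1; rewrite !rmorph1 -!polyC1 !hornerC.
  move=> x y; rewrite {1}(p_P x) {1}(p_P y) -hornerM -rmorphM hP.
  by rewrite rmorphM hornerM.
pose A := GRing.isZmodMorphism.Build _ _ h h_zmod.
pose B := GRing.isMonoidMorphism.Build _ _ h h_mon.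
pose H : {rmorphism L -> O} := HB.pack h A B.
exists H => a; rewrite -[a%:A](hornerC _ th) -[a%:A]/(in_alg L a) -map_polyC.
by rewrite [LHS]hP map_polyC hornerC.
Qed.

End HomExtension.

Section Place.

Variables (F O : closedFieldType) (iota : {rmorphism {poly F} -> O}).
Hypothesis iota_inj : injective iota.
Hypothesis F_char0 : [pchar F] =i pred0.

(* A ring morphism [phi] from a subring [S] of [O] to [F] extending evaluation at [u = 0]
   on [iota F[u]]; outside [S], [phi] is unconstrained. *)
Record is_place (S : O -> Prop) (phi : O -> F) : Prop := IsPlace {
  place_iota p : S (iota p);
  place_iotaE p : phi (iota p) = p.[0];
  place_add x y : S x -> S y -> S (x + y) /\ phi (x + y) = phi x + phi y;
  place_mul x y : S x -> S y -> S (x * y) /\ phi (x * y) = phi x * phi y;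
  place_integral x : S x -> integralOver iota x }.

Lemma mmap_mmap (n m : nat) (A B : comNzRingType) (f : {rmorphism A -> B})
    (v : 'I_m -> B) (lq : 'I_n -> {mpoly A[m]}) (p : {mpoly A[n]}) :
  mmap f v (mmap (@mpolyC m A) lq p) = mmap f (fun i => mmap f v (lq i)) p.
Proof.
rewrite [mmap (@mpolyC m A) lq p]/mmap rmorph_sum; apply: eq_bigr => k _.
rewrite rmorphM /= mmapC; congr (_ * _).
by rewrite /mmap1 rmorph_prod; apply: eq_bigr => i _; rewrite rmorphXn.
Qed.

Lemma mmap_mesym (n : nat) (A B : comNzRingType) (f : {rmorphism A -> B})
    (v : 'I_n -> B) k : mmap f v (mesym n A k) = (mesym n B k).@[v].
Proof.
rewrite /mesym !rmorph_sum; apply: eq_bigr => h _.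
by rewrite !rmorph_prod; apply: eq_bigr => i _; rewrite /= mmapX mmap1U mevalXU.
Qed.

Lemma mmap_eqv n (A B : comNzRingType) (f : {rmorphism A -> B}) (v w : 'I_n -> B) p :
  v =1 w -> mmap f v p = mmap f w p.
Proof.
by move=> vw; rewrite /mmap; apply: eq_bigr => m _; congr (_ * _); apply: mmap1_eq.
Qed.

Lemma mmap_msym n (A B : comNzRingType) (f : {rmorphism A -> B}) (v : 'I_n -> B)
    (s : 'S_n) p : mmap f v (msym s p) = mmap f (fun i => v (s i)) p.
Proof.
rewrite /msym mmap_mmap; apply: mmap_eqv => i.
by rewrite mmapX mmap1U.
Qed.

Lemma rmorph_meval n (A B : comNzRingType) (f : {rmorphism A -> B}) (v : 'I_n -> A) p :
  f p.@[v] = mmap f (fun i => f (v i)) p.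
Proof.
rewrite /meval /mmap rmorph_sum; apply: eq_bigr => m _; rewrite rmorphM.
by congr (_ * _); rewrite /mmap1 rmorph_prod; apply: eq_bigr => i _; rewrite rmorphXn.
Qed.

(* If every [s] failed, a generic combination [p] of the witnesses of failure would
   satisfy [p(xs) = 0] while no [p(rs o s)] vanishes; the symmetrization of [p] is a
   polynomial in the elementary symmetric functions, so its value at [xs] is in
   [iota F[u]] and specializes to its value at [rs], a contradiction. *)
Lemma specialization_exists n (xs : n.-tuple O) (rs : n.-tuple F) (P : {poly {poly F}}) :
  \prod_(x <- xs) ('X - x%:P) = map_poly iota P ->
  \prod_(r <- rs) ('X - r%:P) = map_poly (horner_eval 0) P ->
  exists s : 'S_n, forall q : {mpoly {poly F}[n]},
    mmap iota (tnth xs) q = 0 ->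
    mmap (horner_eval 0) (fun i => tnth rs (s i)) q = 0.
Proof.
move=> HO HF; apply: NNPP => nex.
pose ev0 (s : 'S_n) (q : {mpoly {poly F}[n]}) :=
  mmap (horner_eval 0) (fun i => tnth rs (s i)) q.
pose ev (q : {mpoly {poly F}[n]}) := mmap iota (tnth xs) q.
have {nex} ex s : exists q, ev q = 0 /\ ev0 s q != 0.
  apply: NNPP => nq; apply: nex; exists s => q ev_q; apply/eqP/negPn/negP => nz.
  by apply: nq; exists q.
have [Q QP] : exists Q : 'S_n -> {mpoly {poly F}[n]},
    forall s, ev (Q s) = 0 /\ ev0 s (Q s) != 0.
  by exists (fun s => proj1_sig (constructive_indefinite_description _ (ex s))) => s;
     case: constructive_indefinite_description.
(* The value of [R s] at [m] is [ev0 s] of the combination [p] below. Its coefficient at the rank of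
   [s] is nonzero, so one integer [m] serves all [s] at once. *)
pose R s := \sum_(g : 'S_n) ev0 s (Q g) *: 'X^(enum_rank g) : {poly F}.
have R0 s : R s != 0.
  apply: contraNneq (QP s).2 => /(congr1 (fun p : {poly F} => p`_(enum_rank s))).
  rewrite coef0 coef_sum (bigD1 s) //= coefZ coefXn eqxx mulr1 big1 ?addr0 => [-> //|g].
  rewrite coefZ coefXn (inj_eq val_inj) (inj_eq enum_rank_inj) eq_sym.
  by move/negPf->; rewrite mulr0.
have [m Hm] : exists m : nat, {in codom R, forall p, p.[m%:R] != 0}.
  by apply: avoid_roots => // _ /codomP [s ->].
pose p := \sum_(g : 'S_n) (m ^ enum_rank g)%:R * Q g.
have ev_p : ev p = 0.
  by rewrite /ev rmorph_sum big1 // => g _; rewrite rmorphM /=; have := (QP g).1; rewrite /ev => ->; rewrite mulr0.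
have ev0_p s : ev0 s p != 0.
  have := Hm _ (codom_f R s); rewrite /ev0 rmorph_sum /R horner_sum.
  congr (_ != 0); apply: eq_bigr => g _.
  by rewrite hornerZ hornerXn rmorphM rmorph_nat natrX mulrC.
pose q := \prod_(g : 'S_n) msym g p.
have q_sym : q \is symmetric.
  apply/issymP => g; rewrite /q rmorph_prod [RHS](reindex_inj (mulIg g)) /=.
  by apply: eq_bigr => k _; rewrite msymMm.
have [t [Et _]] := sym_fundamental q_sym.
(* By Vieta, [e i] becomes the elementary symmetric function of index [i.+1] of [xs] under [iota],
   and that of [rs] at [u = 0]. *)
pose e (i : 'I_n) : {poly F} := (-1) ^+ i.+1 * P`_(n - i.+1).
have e_O i : iota (e i) = ev (mesym n {poly F} i.+1).
  rewrite /ev mmap_mesym /e rmorphM rmorphXn rmorphN1 -coef_map -HO.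
  have := @mroots_coeff O n xs (inord i.+1); rewrite inordK ?ltnS // => ->.
  by rewrite mulrA -exprD addnn -mul2n exprM sqrrN !expr1n mul1r.
have e_F s i : (e i).[0] = ev0 s (mesym n {poly F} i.+1).
  rewrite -[LHS]/(horner_eval 0 (e i)) /ev0 -(mmap_msym _ (tnth rs)).
  rewrite (issymP _ (mesym_sym _ _ _)) mmap_mesym /e.
  rewrite rmorphM rmorphXn rmorphN1 -coef_map -HF.
  have := @mroots_coeff F n rs (inord i.+1); rewrite inordK ?ltnS // => ->.
  by rewrite mulrA -exprD addnn -mul2n exprM sqrrN !expr1n mul1r.
have tE : t.@[e] = 0.
  apply: iota_inj; rewrite rmorph0.
  suff <- : ev q = iota t.@[e].
    by rewrite /ev /q rmorph_prod (bigD1 1%g) //= msym1m -/(ev p) ev_p mul0r.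
  rewrite -Et /ev /comp_mpoly mmap_mmap rmorph_meval.
  by apply: mmap_eqv => i; rewrite tnth_mktuple e_O.
have : ev0 1%g q = 0.
  rewrite -Et /ev0 /comp_mpoly mmap_mmap.
  transitivity (horner_eval 0 t.@[e]); last by rewrite tE rmorph0.
  rewrite rmorph_meval.
  by apply: mmap_eqv => i; rewrite tnth_mktuple -[LHS](e_F 1%g).
move/eqP; rewrite /ev0 /q rmorph_prod prodf_seq_eq0 => /hasP [g _ /= /eqP].
rewrite mmap_msym => E; have := ev0_p g; rewrite /ev0; case/eqP.
by rewrite -[RHS]E; apply: mmap_eqv => i; rewrite perm1.
Qed.

(** [S] is the ring generated by [xs] over [iota F[u]]. For a suitable numbering of the roots [rs]
    at [u = 0], every polynomial relation among the [xs] holds for the [rs], so that sending [xs] to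
    [rs] is well defined. *)
Lemma place_exists (xs : seq O) (P : {poly {poly F}}) :
  \prod_(x <- xs) ('X - x%:P) = map_poly iota P ->
  exists S phi, is_place S phi /\ {in xs, forall x, S x}.
Proof.
move=> HO; set n := size xs; pose xt : n.-tuple O := in_tuple xs.
have mP : P \is monic.
  rewrite monicE -(inj_eq iota_inj) rmorph1 -lead_coef_map_inj ?rmorph0 // -HO.
  by rewrite -monicE monic_prod_XsubC.
have [rs Ers] := closed_field_poly_normal (map_poly (horner_eval 0) P).
have mP0 : map_poly (horner_eval 0) P \is monic by apply: monic_map.
rewrite (monicP mP0) scale1r in Ers.
have srs : size rs == n.
  rewrite -eqSS -(size_prod_XsubC _ id) -Ers size_map_poly_id0; last first.
    by rewrite (monicP mP) rmorph1 oner_eq0.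
  by rewrite -(size_map_inj_poly iota_inj) ?rmorph0 // -HO size_prod_XsubC.
have [s Hs] := @specialization_exists n xt (Tuple srs) P HO (esym Ers).
pose ev (q : {mpoly {poly F}[n]}) := mmap iota (tnth xt) q.
pose ev0 (q : {mpoly {poly F}[n]}) :=
  mmap (horner_eval 0) (fun i => tnth (Tuple srs) (s i)) q.
pose S x := exists q, x = ev q.
pose phi x := if excluded_middle_informative (S x) is left Sx
  then ev0 (proj1_sig (constructive_indefinite_description _ Sx)) else 0.
have phiE q : phi (ev q) = ev0 q.
  rewrite /phi; case: excluded_middle_informative => [Sx|[]]; last by exists q.
  case: constructive_indefinite_description => q' /= E; apply/eqP.
  rewrite -subr_eq0 /ev0 -rmorphB /=; apply/eqP/Hs.
  by rewrite rmorphB /= -!/(ev _) -E subrr.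
exists S, phi; split; last first.
  move=> x /(nthP 0) [i i_lt <-]; exists 'X_(Ordinal i_lt).
  by rewrite /ev mmapX mmap1U (tnth_nth 0).
split.
- by move=> p; exists p%:MP; rewrite /ev mmapC.
- by move=> p; rewrite -[RHS]/(horner_eval 0 p) -(mmapC (fun i => tnth (Tuple srs) (s i)))
    -[RHS]phiE /ev mmapC.
- move=> _ _ [p ->] [q ->]; rewrite !phiE /ev -rmorphD; split; first by exists (p + q).
  by rewrite -/(ev _) phiE /ev0 rmorphD.
- move=> _ _ [p ->] [q ->]; rewrite !phiE /ev -rmorphM; split; first by exists (p * q).
  by rewrite -/(ev _) phiE /ev0 rmorphM.
move=> _ [q ->]; rewrite /ev /mmap.
apply: (big_ind (integralOver iota)); [exact: integral0 | exact: integral_add |].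
move=> m _; apply: integral_mul; first exact: integral_id.
apply: (big_ind (integralOver iota)); [exact: integral1 | exact: integral_mul |].
move=> i _; elim: (m i) => [|k IHk]; first by rewrite expr0; apply: integral1.
rewrite exprS; apply: integral_mul => //.
exists P; first exact: mP.
by rewrite -HO root_prod_XsubC mem_tnth.
Qed.

End Place.

Section PlaceTheory.

Variables (F O : closedFieldType) (iota : {rmorphism {poly F} -> O}).
Variables (S : O -> Prop) (phi : O -> F).
Hypothesis plS : is_place iota S phi.

Lemma place_const c : S (iota c%:P) /\ phi (iota c%:P) = c.
Proof. by split; [exact: (place_iota plS) | rewrite (place_iotaE plS) hornerC]. Qed.

Lemma place0 : S 0 /\ phi 0 = 0.
Proof. by have := place_const 0; rewrite polyC0 rmorph0. Qed.

Lemma place1 : S 1 /\ phi 1 = 1.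
Proof. by have := place_const 1; rewrite polyC1 rmorph1. Qed.

Lemma place_opp x : S x -> S (- x) /\ phi (- x) = - phi x.
Proof.
move=> Sx; have [Sm phim] := place_const (-1).
have := place_mul plS Sm Sx.
by rewrite phim rmorphN1 /= rmorphN1 !mulN1r.
Qed.

Lemma place_sub x y : S x -> S y -> S (x - y) /\ phi (x - y) = phi x - phi y.
Proof.
move=> Sx Sy; have [Sy' <-] := place_opp Sy; exact: (place_add plS).
Qed.

Lemma place_nat n : S n%:R /\ phi n%:R = n%:R.
Proof.
elim: n => [|n [Sn phin]]; first exact: place0.
have [S1 phi1] := place1; have := place_add plS S1 Sn.
by rewrite phi1 phin !nat1r.
Qed.

Lemma place_sum (I : Type) (r : seq I) (P : pred I) (f : I -> O) :
  (forall i, P i -> S (f i)) ->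
  S (\sum_(i <- r | P i) f i) /\
  phi (\sum_(i <- r | P i) f i) = \sum_(i <- r | P i) phi (f i).
Proof.
move=> Sf; elim: r => [|x r [Sr IHr]]; first by rewrite !big_nil; apply: place0.
rewrite !big_cons; case: ifP => Px //.
by have := place_add plS (Sf x Px) Sr; rewrite IHr.
Qed.

Lemma place_prod (I : Type) (r : seq I) (P : pred I) (f : I -> O) :
  (forall i, P i -> S (f i)) ->
  S (\prod_(i <- r | P i) f i) /\
  phi (\prod_(i <- r | P i) f i) = \prod_(i <- r | P i) phi (f i).
Proof.
move=> Sf; elim: r => [|x r [Sr IHr]]; first by rewrite !big_nil; apply: place1.
rewrite !big_cons; case: ifP => Px //.
by have := place_mul plS (Sf x Px) Sr; rewrite IHr.
Qed.

Lemma place_prod_seq (I : eqType) (r : seq I) (P : pred I) (f : I -> O) :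
  (forall i, i \in r -> P i -> S (f i)) ->
  S (\prod_(i <- r | P i) f i) /\
  phi (\prod_(i <- r | P i) f i) = \prod_(i <- r | P i) phi (f i).
Proof.
move=> Sf; rewrite [\prod_(i <- r | P i) f i]big_seq_cond.
rewrite [\prod_(i <- r | P i) phi (f i)]big_seq_cond.
by apply: place_prod => i /andP [ri Pi]; apply: Sf.
Qed.

Lemma place_horner (p : {poly O}) x : S x -> (forall i, S p`_i) -> S p.[x].
Proof.
move=> Sx; elim/poly_ind: p => [|p c IH] Hp; first by rewrite horner0; case: place0.
rewrite hornerMXaddC; apply: (place_add plS _ _).1; last first.
  by have := Hp 0%N; rewrite coefD coefMX coefC /= add0r.
apply: (place_mul plS _ Sx).1; apply: IH => i.
by have := Hp i.+1; rewrite coefD coefMX coefC /= addr0.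
Qed.

Lemma place_poly_prod (I : Type) (r : seq I) (P : pred I) (f : I -> O) :
  (forall i, P i -> S (f i)) -> forall m,
  S (\prod_(i <- r | P i) ('X - (f i)%:P))`_m /\
  phi (\prod_(i <- r | P i) ('X - (f i)%:P))`_m =
    (\prod_(i <- r | P i) ('X - (phi (f i))%:P))`_m.
Proof.
move=> Sf; elim: r => [|x r IHr] m.
  by rewrite !big_nil !coef1; case: (m == 0)%N; [apply: place1 | apply: place0].
rewrite !big_cons; case: ifP => Px //.
rewrite !mulrBl !coefB !coefXM !coefCM.
have [Sp Ep] := place_mul plS (Sf x Px) (IHr m).1.
case: m IHr Sp Ep => [|m] IHr Sp Ep /=.
  have [S0 E0] := place0; have := place_sub S0 Sp.
  by rewrite E0 Ep (IHr 0).2.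
by have := place_sub (IHr m).1 Sp; rewrite Ep (IHr m).2 (IHr m.+1).2.
Qed.

Lemma place_split (xs : seq O) (P : {poly {poly F}}) : {in xs, forall x, S x} ->
  \prod_(x <- xs) ('X - x%:P) = map_poly iota P ->
  \prod_(x <- xs) ('X - (phi x)%:P) = map_poly (horner_eval 0) P.
Proof.
move=> Sxs E; apply/polyP => m; rewrite coef_map.
have := place_poly_prod xs (P := mem xs) (f := id) Sxs m.
by rewrite -!big_seq E coef_map /= (place_iotaE plS) => -[_ <-].
Qed.

(** [F[u]] is integrally closed: in lowest terms, clearing denominators in the integral equation
    shows that [q] divides a power of [p], hence is constant. *)
Lemma fraction_integral_poly z (p q : {poly F}) : injective iota -> q != 0 ->
  integralOver iota z -> z * iota q = iota p -> exists r, z = iota r.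
Proof.
move=> iota_inj; wlog cpq : p q / coprimep p q.
  move=> W q0 intz E; have gq := dvdp_gcdr p q; have gp := dvdp_gcdl p q.
  have g0 : gcdp p q != 0 by rewrite gcdp_eq0 negb_and q0 orbT.
  apply: (W (p %/ gcdp p q) (q %/ gcdp p q)) => //.
  - by rewrite coprimep_div_gcd ?q0 ?orbT.
  - by rewrite dvdp_div_eq0.
  apply: (@mulIf _ (iota (gcdp p q))); first by rewrite -(rmorph0 iota) (inj_eq iota_inj).
  by rewrite -mulrA -!rmorphM !divpK.
move=> q0 [P mP /rootP Pz] E.
have iq0 : iota q != 0 by rewrite -(rmorph0 iota) (inj_eq iota_inj).
have Ez : z = iota p / iota q by rewrite -E mulfK.
pose n := (size P).-1.
have sP : size P = n.+1 by rewrite /n prednK // size_poly_gt0 monic_neq0.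
have : p ^+ n = - q * \sum_(i < n) P`_i * p ^+ i * q ^+ (n - i.+1).
  apply: iota_inj.
  move: Pz; rewrite (horner_coef_wide _ (n := n.+1)) ?(leq_trans (size_poly _ _)) ?sP //.
  rewrite big_ord_recr /= coef_map.
  have -> : P`_n = (1 : {poly F}) by move/monicP: mP; rewrite lead_coefE sP.
  rewrite -[X in _ + X * _]/(iota 1) rmorph1 mul1r Ez => /(congr1 (fun t => t * iota q ^+ n)).
  rewrite mul0r mulrDl exprMn exprVn mulfVK ?expf_neq0 // => /eqP.
  rewrite addrC addr_eq0 => /eqP E1; rewrite rmorphXn E1 rmorphM rmorphN mulNr.
  congr (- _); rewrite rmorph_sum mulr_suml mulr_sumr; apply: eq_bigr => i _.
  rewrite !rmorphM !rmorphXn /= coef_map /=.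
  have -> : iota q ^+ n = iota q * iota q ^+ (n - i.+1) * iota q ^+ i.
    by rewrite -exprS -exprD; congr (_ ^+ _); have := ltn_ord i; lia.
  by rewrite exprMn exprVn; field; rewrite expf_neq0.
move=> Epn; have dq : q %| p ^+ n by rewrite Epn dvdp_mulr // dvdpNr.
have : coprimep q (p ^+ n) by apply: coprimep_expr; rewrite coprimep_sym.
rewrite /coprimep => /eqP; rewrite (eqp_size (dvdp_gcd_idl dq)) => sq.
have [c c0 Eq] : exists2 c, c != 0 & q = c%:P.
  by exists q`_0; last rewrite [LHS]size1_polyC ?sq //;
    apply: contra q0 => /eqP c0; rewrite [q]size1_polyC ?sq // c0 polyC0.
have Ep : p = c%:P * (c^-1%:P * p) by rewrite mulrA -polyCM divff // mul1r.
by exists (c^-1%:P * p); rewrite Ez Eq {1}Ep rmorphM mulrC mulKf -?Eq.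
Qed.

End PlaceTheory.

(** * Inertia groups *)

Section Inertia.

Variables (F O : closedFieldType) (iota : {rmorphism {poly F} -> O}).
Hypothesis iota_inj : injective iota.
Hypothesis F_char0 : [pchar F] =i pred0.
Variables (F0 : fieldType) (L : splittingFieldType F0) (E M0 : {subfield L}).
Hypothesis galE : galois M0 E.
Variable h : {rmorphism L -> O}.
Hypothesis h_fixed : forall z, z \in M0 ->
  exists p q : {poly F}, q != 0 /\ h z * iota q = iota p.
Variables (S : O -> Prop) (phi : O -> F).
Hypothesis plS : is_place iota S phi.
Variable T : seq L.
Hypothesis T_sub_E : {in T, forall x, x \in E}.
Hypothesis T_S : {in T, forall x, S (h x)}.
Let H := 'Gal(E / M0)%g.
Hypothesis T_stable : forall g x, g \in H -> x \in T -> g x \in T.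

(** Inertia relative to the finite set [T]: only the residues of its elements have to be kept.
    Stability of [T] under [H] makes this a group. *)
Definition inertia := [set g in H | all (fun x => phi (h (g x)) == phi (h x)) T].

Lemma inertiaP g : reflect (g \in H /\ {in T, forall x, phi (h (g x)) = phi (h x)})
  (g \in inertia).
Proof.
rewrite inE; apply: (iffP andP) => -[Hg Tg]; split => //.
  by move=> x Tx; apply/eqP/(allP Tg).
by apply/allP => x Tx; apply/eqP/Tg.
Qed.

Lemma inertia_group_set : group_set inertia.
Proof.
apply/group_setP; split.
  by apply/inertiaP; split=> [|x Tx]; rewrite ?group1 ?gal_id.
move=> g k /inertiaP [Hg Tg] /inertiaP [Hk Tk]; apply/inertiaP.
split=> [|x Tx]; first exact: groupM.
by rewrite galM ?T_sub_E // Tk ?Tg ?T_stable.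
Qed.

Canonical inertia_group := Group inertia_group_set.

Lemma inertia_sub : inertia \subset H.
Proof. by apply/subsetP => g /inertiaP []. Qed.

(* The elements of [E] all of whose conjugates are defined at the place. *)
Definition inB z := z \in E /\ forall g, g \in H -> S (h (g z)).

Lemma inB_T x : x \in T -> inB x.
Proof. by move=> Tx; split=> [|g Hg]; [exact: T_sub_E | apply/T_S/T_stable]. Qed.

Lemma inB_gal g z : g \in H -> inB z -> inB (g z).
Proof.
move=> Hg [Ez Sz]; split=> [|k Hk]; first exact: memv_gal.
by rewrite -galM //; apply/Sz/groupM.
Qed.

Lemma inB_S z : inB z -> S (h z).
Proof. by case=> Ez /(_ 1%g (group1 _)); rewrite gal_id. Qed.

Lemma inB_add x y : inB x -> inB y -> inB (x + y).
Proof.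
move=> [Ex Sx] [Ey Sy]; split=> [|g Hg]; first exact: rpredD.
by rewrite !rmorphD; apply: (place_add plS (Sx g Hg) (Sy g Hg)).1.
Qed.

Lemma inB_mul x y : inB x -> inB y -> inB (x * y).
Proof.
move=> [Ex Sx] [Ey Sy]; split=> [|g Hg]; first exact: rpredM.
by rewrite !rmorphM; apply: (place_mul plS (Sx g Hg) (Sy g Hg)).1.
Qed.

Lemma inB_sub x y : inB x -> inB y -> inB (x - y).
Proof.
move=> [Ex Sx] [Ey Sy]; split=> [|g Hg]; first exact: rpredB.
by rewrite !rmorphB; apply: (place_sub plS (Sx g Hg) (Sy g Hg)).1.
Qed.

Lemma inB_nat n : inB n%:R.
Proof.
split=> [|g Hg]; first by rewrite rpred_nat.
by rewrite !rmorph_nat; apply: (place_nat plS n).1.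
Qed.

Lemma inB_sum (I : Type) (r : seq I) (P : pred I) (f : I -> L) :
  (forall i, P i -> inB (f i)) -> inB (\sum_(i <- r | P i) f i).
Proof.
by move=> Bf; apply: big_ind => //; [exact: (inB_nat 0) | exact: inB_add].
Qed.

Lemma inB_prod (I : Type) (r : seq I) (P : pred I) (f : I -> L) :
  (forall i, P i -> inB (f i)) -> inB (\prod_(i <- r | P i) f i).
Proof.
by move=> Bf; apply: big_ind => //; [exact: (inB_nat 1) | exact: inB_mul].
Qed.

Lemma inB_poly_prod (I : Type) (r : seq I) (P : pred I) (f : I -> L) :
  (forall i, P i -> inB (f i)) ->
  forall m, inB (\prod_(i <- r | P i) ('X - (f i)%:P))`_m.
Proof.
move=> Bf; elim: r => [|x r IHr] m.
  by rewrite big_nil coef1; apply: inB_nat.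
rewrite big_cons; case: ifP => Px //.
rewrite mulrBl coefB coefXM coefCM; apply: inB_sub; last exact/inB_mul/IHr/Bf.
by case: m => [|m] /=; [exact: (inB_nat 0) | apply: IHr].
Qed.

(** A fixed element lies in [M0], so its image is a quotient of polynomials in [u]; it is also
    integral over [F[u]]. *)
Lemma fixed_poly z : inB z -> (forall g, g \in H -> g z = z) -> exists r, h z = iota r.
Proof.
move=> Bz fixz; have [Ez _] := Bz.
have /h_fixed [p [q [q0 Epq]]] : z \in M0.
  by rewrite -(galois_fixedField galE); apply/fixedFieldP.
by apply: (fraction_integral_poly iota_inj q0 _ Epq); apply/(place_integral plS)/inB_S.
Qed.

Lemma fixed_poly_poly (P : {poly L}) : (forall m, inB P`_m) ->
  (forall g m, g \in H -> g P`_m = P`_m) ->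
  exists R : {poly {poly F}}, map_poly h P = map_poly iota R.
Proof.
move=> BP fixP.
have ex (i : 'I_(size P)) : exists r, h P`_i = iota r.
  by apply: fixed_poly => // g Hg; apply: fixP.
have /fin_all_exists [r Hr] := ex.
exists (\poly_(i < size P) (if insub i is Some k then r k else 0)).
apply/polyP => i; rewrite !coef_map coef_poly.
case: ltnP => [lt|ge]; first by rewrite insubT /= -Hr.
by rewrite [P`_i]nth_default //; exact: etrans (rmorph0 h) (esym (rmorph0 iota)).
Qed.

(** A generic combination [b0] of [T] has residues that separate [inertia] from the rest of [H]. To
    be fixed by [inertia] as well, [b] is the value at a suitable integer of the product of the
    [X - k b0] over [k] in [inertia]. *)
Lemma separating_element :
  exists b, [/\ inB b, (forall g, g \in inertia -> g b = b) &
    forall g, g \in H -> phi (h (g b)) = phi (h b) -> g \in inertia].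
Proof.
pose N := size T; pose x_ (i : 'I_N) := T`_i.
have Tx i : x_ i \in T by apply: mem_nth.
pose p0 (g : gal_of E) : {poly F} :=
  \sum_(i < N) (phi (h (g (x_ i))) - phi (h (x_ i))) *: 'X^i.
have p0_neq0 g : g \in H -> g \notin inertia -> p0 g != 0.
  move=> Hg; apply: contra => /eqP E0; apply/inertiaP; split=> // x Tx0.
  have lt : (index x T < N)%N by rewrite index_mem.
  have := congr1 (fun p : {poly F} => p`_(Ordinal lt)) E0.
  rewrite coef0 coef_sum (bigD1 (Ordinal lt)) //= coefZ coefXn eqxx mulr1.
  rewrite big1 ?addr0 => [/eqP|i]; last first.
    move=> ne; rewrite coefZ coefXn (_ : (_ == _) = false) ?mulr0 //.
    by apply: contraNF ne => /eqP Ei; apply/eqP/val_inj.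
  by rewrite subr_eq0 /x_ /= nth_index // => /eqP.
have [m Hm] : exists m : nat,
    {in [seq p0 g | g <- enum (H :\: inertia)], forall p, p.[m%:R] != 0}.
  apply: avoid_roots => // p /mapP [g]; rewrite mem_enum => /setDP [Hg ng] ->.
  exact: p0_neq0.
pose b0 := \sum_(i < N) (m ^ i)%:R * x_ i.
have Bb0 : inB b0 by apply: inB_sum => i _; apply/inB_mul/inB_T/Tx/inB_nat.
have gb0 g : g \in H -> g b0 = \sum_(i < N) (m ^ i)%:R * g (x_ i).
  by move=> Hg; rewrite /b0 rmorph_sum; apply: eq_bigr => i _; rewrite rmorphM rmorph_nat.
have phib0 g : g \in H ->
    phi (h (g b0)) = \sum_(i < N) (m ^ i)%:R * phi (h (g (x_ i))).
  move=> Hg; rewrite gb0 // rmorph_sum /=.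
  have Sg i : S (h (g (x_ i))) by apply/T_S/T_stable.
  have SS (i : 'I_N) : S (h ((m ^ i)%:R * g (x_ i))).
    by rewrite rmorphM rmorph_nat; apply: (place_mul plS (place_nat plS _).1 (Sg _)).1.
  rewrite (place_sum plS _ (P := xpredT) (fun (i : 'I_N) _ => SS i)).2.
  apply: eq_bigr => i _; rewrite rmorphM rmorph_nat.
  by rewrite (place_mul plS (place_nat plS _).1 (Sg _)).2 (place_nat plS _).2.
have sep0 g : g \in H -> phi (h (g b0)) = phi (h b0) -> g \in inertia.
  move=> Hg Eg; apply/negPn/negP => ng.
  have /Hm/eqP [] : p0 g \in [seq p0 g | g <- enum (H :\: inertia)].
    by apply: map_f; rewrite mem_enum; apply/setDP.
  have {}Eg : phi (h (g b0)) - phi (h ((1%g : gal_of E) b0)) = 0.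
    by rewrite gal_id Eg subrr.
  rewrite -{}Eg !phib0 ?group1 // -sumrB /p0 horner_sum; apply: eq_bigr => i _.
  by rewrite gal_id hornerZ hornerXn natrX mulrC mulrBr.
(* For [g] outside [inertia], the residue of [b0] is a root of [G 1] but not of [G g], so some
   integer [m'] tells all these [G g] from [G 1]. *)
pose G (g : gal_of E) : {poly F} :=
  \prod_(k in inertia) ('X - (phi (h ((k * g)%g b0)))%:P).
have IH k : k \in inertia -> k \in H by apply: (subsetP inertia_sub).
have G_neq g : g \in H -> g \notin inertia -> G g - G 1%g != 0.
  move=> Hg ng; apply/eqP => /(congr1 (horner^~ (phi (h b0)))).
  rewrite hornerD hornerN horner0 /G !horner_prod [X in _ - X](bigD1 1%g) ?group1 //=.
  rewrite mulg1 gal_id hornerXsubC subrr mul0r subr0 => /eqP.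
  case/prodf_eq0 => k Ik.
  rewrite hornerXsubC subr_eq0 eq_sym => /eqP /sep0.
  rewrite (groupM (IH _ Ik) Hg) => /(_ isT) Ikg.
  by case/negP: ng; rewrite -(groupMl _ Ik).
have [m' Hm'] : exists m : nat,
    {in [seq G g - G 1%g | g <- enum (H :\: inertia)], forall p, p.[m%:R] != 0}.
  apply: avoid_roots => // p /mapP [g]; rewrite mem_enum => /setDP [Hg ng] ->.
  exact: G_neq.
pose b := \prod_(k in inertia) (m'%:R - k b0).
have gb g : g \in H -> g b = \prod_(k in inertia) (m'%:R - (k * g)%g b0).
  move=> Hg; rewrite /b rmorph_prod; apply: eq_bigr => k Ik.
  by rewrite rmorphB rmorph_nat galM //; case: Bb0.
have phib g : g \in H -> phi (h (g b)) = (G g).[m'%:R].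
  move=> Hg; rewrite gb // rmorph_prod /G horner_prod.
  have Sk k : k \in inertia -> S (h ((k * g)%g b0)).
    by move=> Ik; case: Bb0 => _; apply; apply: groupM => //; apply: IH.
  have SS k : k \in inertia -> S (h (m'%:R - (k * g)%g b0)).
    by move=> Ik; rewrite rmorphB rmorph_nat; apply: (place_sub plS (place_nat plS _).1 (Sk _ Ik)).1.
  rewrite (place_prod plS _ SS).2; apply: eq_bigr => k Ik.
  rewrite hornerXsubC rmorphB rmorph_nat (place_sub plS (place_nat plS _).1 (Sk _ Ik)).2.
  by rewrite (place_nat plS _).2.
exists b; split.
- apply: inB_prod => k Ik; apply: inB_sub; first exact: inB_nat.
  by apply: inB_gal => //; apply: IH.
- move=> g Ig; rewrite gb ?IH // /b [RHS](reindex_inj (mulIg g)) /=.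
  by apply: eq_bigl => k; rewrite groupMr.
move=> g Hg Eg; apply/negPn/negP => ng.
have /Hm'/eqP [] : G g - G 1%g \in [seq G g - G 1%g | g <- enum (H :\: inertia)].
  by apply: map_f; rewrite mem_enum; apply/setDP.
by rewrite hornerD hornerN -!phib ?group1 // gal_id Eg subrr.
Qed.

Lemma perm_map_gal (g : gal_of E) (s : seq L) : uniq s ->
  (forall x, x \in s -> g x \in s) -> perm_eq [seq g x | x <- s] s.
Proof.
move=> us gs; have um : uniq [seq g x | x <- s] by rewrite map_inj_uniq //; apply: fmorph_inj.
apply: uniq_perm => //; apply: (uniq_min_size um _ _).2; last by rewrite size_map.
by move=> _ /mapP [x sx ->]; apply: gs.
Qed.

(* With [b] separating the inertia group from the rest of [H] and [chi] the product of
   [X - y] over the conjugates [y] of [b], Lagrange interpolation writes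
   [h w * chi'(h b)], up to a positive integer, as the value at [h b] of a polynomial
   [La] over [iota F[u]]; both [chi] and [La] vanish at [X = phi (h b)], [u = 0]. *)
Lemma inertia_divides w : inB w -> (forall g, g \in inertia -> g w = w) ->
  phi (h w) = 0 ->
  exists dl s, [/\ S dl, S s, phi dl != 0 & dl * h w = iota 'X * s].
Proof.
move=> Bw Iw phiw; have [b [Bb Ib sepb]] := separating_element.
pose s := undup [seq (g : gal_of E) b | g <- enum H].
have us : uniq s by apply: undup_uniq.
have sP y : reflect (exists2 g : gal_of E, g \in H & y = g b) (y \in s).
  rewrite mem_undup; apply: (iffP mapP) => -[g Hg ->]; exists g => //.
    by rewrite mem_enum in Hg.
  by rewrite mem_enum.
have Bs y : y \in s -> inB y by case/sP => g Hg ->; apply: inB_gal.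
have Ss y : y \in s -> S (h y) by move/Bs/inB_S.
have sb : b \in s by apply/sP; exists 1%g; rewrite ?group1 ?gal_id.
have Eb : b \in E by case: Bb.
have perm_s (g : gal_of E) : g \in H -> perm_eq [seq g y | y <- s] s.
  move=> Hg; apply: perm_map_gal => // _ /sP [k Hk ->].
  by apply/sP; exists (k * g)%g; [apply: groupM | rewrite galM].
pose chi := \prod_(y <- s) ('X - y%:P).
pose La := \sum_(g in H) (g w)%:P * \prod_(y <- s | y != g b) ('X - y%:P).
have fix_chi (g : gal_of E) m : g \in H -> g chi`_m = chi`_m.
  move=> Hg; rewrite -coef_map; suff -> : map_poly g chi = chi by [].
  rewrite rmorph_prod -[RHS](perm_big _ (perm_s g Hg)) big_map.
  by apply: eq_bigr => y _; rewrite rmorphB /= map_polyX map_polyC.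
have fix_La (g : gal_of E) m : g \in H -> g La`_m = La`_m.
  move=> Hg; rewrite -coef_map; suff -> : map_poly g La = La by [].
  rewrite rmorph_sum [RHS](reindex_inj (mulIg g)) /=; apply: eq_big => k.
    by rewrite groupMr.
  move=> Hk; rewrite rmorphM /= map_polyC !galM //; last by case: Bw.
  congr (_ * _); rewrite rmorph_prod -[RHS](perm_big _ (perm_s g Hg)) big_map.
  apply: eq_big => y; first by rewrite (inj_eq (fmorph_inj _)).
  by rewrite rmorphB /= map_polyX map_polyC.
have B_chi m : inB chi`_m by rewrite /chi big_seq; apply: inB_poly_prod.
have B_La m : inB La`_m.
  rewrite coef_sum; apply: inB_sum => g Hg; rewrite coefCM; apply: inB_mul.
    exact: inB_gal.
  by rewrite -big_filter big_seq; apply: inB_poly_prod => y; rewrite mem_filter => /andP [_ /Bs].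
have [chi' Echi] := fixed_poly_poly B_chi (fun g m => @fix_chi g m).
have [La' ELa] := fixed_poly_poly B_La (fun g m => @fix_La g m).
pose be := phi (h b).
have [Sbe phibe] := place_const plS be.
pose D (r : O) := \prod_(y <- s | y != b) (r - h y).
have phis y : y \in s -> y != b -> be - phi (h y) != 0.
  case/sP => g Hg -> nb; rewrite subr_eq0; apply: contra nb => /eqP E0.
  by rewrite Ib // sepb.
have DP r : S r -> phi r = be -> S (D r) /\ phi (D r) != 0.
  move=> Sr Er.
  have [|SD ED] := @place_prod_seq _ _ _ _ _ plS _ s (fun y => y != b) (fun y => r - h y).
    by move=> y sy _; apply: (place_sub plS Sr (Ss _ sy)).1.
  split=> //; rewrite /D ED prodf_seq_neq0; apply/allP => y sy; apply/implyP => nb.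
  by rewrite (place_sub plS Sr (Ss _ sy)).2 Er phis.
have root0_X (p : {poly F}) : p.[0] = 0 -> exists e, p = 'X * e.
  by move=> /rootP/factor_theorem [q ->]; exists q; rewrite subr0 mulrC.
have [SDbe phiDbe] := DP _ Sbe phibe.
have [SDb phiDb] := DP _ (inB_S Bb) erefl.
have Sbb := place_sub plS Sbe (inB_S Bb).
have Ehchi : (iota be%:P - h b) * D (iota be%:P) = iota chi'.[be%:P].
  rewrite -horner_map -Echi /chi rmorph_prod horner_prod.
  rewrite [RHS](big_rem b sb) /= rem_filter // big_filter.
  rewrite rmorphB /= map_polyX map_polyC hornerXsubC; congr (_ * _).
  by apply: eq_bigr => y _; rewrite rmorphB /= map_polyX map_polyC hornerXsubC.
have [e1 Ee1] : exists e1, chi'.[be%:P] = 'X * e1.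
  apply: root0_X; rewrite -(place_iotaE plS) -Ehchi.
  by rewrite (place_mul plS Sbb.1 SDbe).2 Sbb.2 phibe subrr mul0r.
have hLa r : (map_poly h La).[r] =
    \sum_(g in H) h (g w) * \prod_(y <- s | y != g b) (r - h y).
  rewrite /La rmorph_sum horner_sum; apply: eq_bigr => g _.
  rewrite rmorphM /= map_polyC hornerM hornerC rmorph_prod horner_prod.
  by congr (_ * _); apply: eq_bigr => y _; rewrite rmorphB /= map_polyX map_polyC hornerXsubC.
(* Every summand has residue [0] at [be]: if [g b != b], the product keeps the factor of [y = b];
   otherwise [g] lies in [inertia] and [g w = w] has residue [0]. *)
have [e2 Ee2] : exists e2, La'.[be%:P] = 'X * e2.
  apply: root0_X; rewrite -(place_iotaE plS) -horner_map -ELa hLa.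
  have SP (g : gal_of E) : S (\prod_(y <- s | y != g b) (iota be%:P - h y)) /\
      phi (\prod_(y <- s | y != g b) (iota be%:P - h y)) =
      \prod_(y <- s | y != g b) phi (iota be%:P - h y).
    apply: (place_prod_seq plS) => y sy _.
    by apply: (place_sub plS Sbe (Ss _ sy)).1.
  have Sgw (g : gal_of E) : g \in H -> S (h (g w)) by case: Bw => _; apply.
  rewrite (place_sum plS _ (P := mem H) (fun g Hg =>
     (place_mul plS (Sgw g Hg) (SP g).1).1)).2.
  apply: big1 => g Hg; rewrite (place_mul plS (Sgw g Hg) (SP g).1).2 (SP g).2.
  have [gb|nb] := eqVneq b (g b); last first.
    by rewrite -big_filter (big_rem b) ?mem_filter ?nb ?sb //= Sbb.2 phibe subrr mul0r mulr0.
  by rewrite Iw ?phiw ?mul0r // sepb // -gb.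
(* At [X = h b] only the [g] fixing [b] contribute; they lie in [inertia], hence fix [w], and give
   [n] equal terms. *)
pose n := #|[set g in H | g b == b]|.
have n_gt0 : (0 < n)%N.
  by apply/card_gt0P; exists 1%g; rewrite inE group1 gal_id eqxx.
have hLab : (map_poly h La).[h b] = n%:R * (h w * D (h b)).
  rewrite hLa (bigID (fun g : gal_of E => g b == b)) /= [X in _ + X]big1 ?addr0; last first.
    move=> g /andP [Hg nb].
    by rewrite -big_filter (big_rem b) ?mem_filter 1?eq_sym ?nb ?sb //= subrr mul0r mulr0.
  rewrite (eq_bigr (fun _ => h w * D (h b))).
    rewrite sumr_const mulr_natl; congr (_ *+ _); rewrite /n.
    by apply: eq_card => g; rewrite !inE.
  by move=> g /andP [Hg /eqP gb]; rewrite gb Iw // sepb // gb.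
have [L1 EL1] : exists L1, La' = L1 * ('X - (be%:P)%:P) + (La'.[be%:P])%:P.
  have /factor_theorem [L1 E1] : root (La' - (La'.[be%:P])%:P) be%:P.
    by rewrite /root hornerD hornerN hornerC subrr.
  by exists L1; rewrite -E1 subrK.
have hLab2 : (map_poly h La).[h b] =
    (map_poly iota L1).[h b] * (h b - iota be%:P) + iota 'X * iota e2.
  rewrite -rmorphM -Ee2 ELa {1}EL1 rmorphD rmorphM rmorphB /= map_polyX !map_polyC.
  by rewrite hornerD hornerM hornerXsubC hornerC.
have SL1 : S (map_poly iota L1).[h b].
  apply: (place_horner plS); first exact: inB_S.
  by move=> i; rewrite coef_map; apply: (place_iota plS).
have [Sn phin] := place_nat plS n.
(* Multiplication by [D (iota be%:P)] turns the factor [h b - iota be%:P] of [hLab2] into [- iota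
   chi'.[be%:P]], which is divisible by [u] too. *)
exists (n%:R * D (h b) * D (iota be%:P)),
       (iota e2 * D (iota be%:P) - (map_poly iota L1).[h b] * iota e1).
have Sa := place_mul plS Sn SDb.
have Sd := place_mul plS Sa.1 SDbe.
split.
- exact: Sd.1.
- have Se2 := (place_mul plS (place_iota plS e2) SDbe).1.
  exact: (place_sub plS Se2 (place_mul plS SL1 (place_iota plS e1)).1).1.
- by rewrite Sd.2 Sa.2 phin !mulf_neq0 // (pcharf0P _).1 // -lt0n.
rewrite mulrBr mulrCA [iota 'X * (_ * _)]mulrCA -[iota 'X * iota e1]rmorphM -Ee1 -Ehchi.
have -> : n%:R * D (h b) * D (iota be%:P) * h w =
   n%:R * (h w * D (h b)) * D (iota be%:P) by ring.
by rewrite -hLab hLab2; ring.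
Qed.

(* If [y'] were not in the inertia orbit of [y], the product of [h a - h x] would split
   into two inertia-invariant factors, each divisible by [u]: then [u^2] divides [q]. *)
Lemma inertia_transitive (X : seq L) (a : L) (q : {poly F}) : uniq X ->
  {in X, forall x, inB x} -> (forall g x, g \in H -> x \in X -> g x \in X) ->
  inB a -> (forall g, g \in H -> g a = a) ->
  \prod_(x <- X) (h a - h x) = iota q -> q`_0 = 0 -> q`_1 != 0 ->
  {in X &, forall y y', phi (h y) = phi (h a) -> phi (h y') = phi (h a) ->
     exists2 g, g \in inertia & g y = y'}.
Proof.
move=> uX BX HX Ba fixa Eq q0 q1 y y' Xy Xy' phiy phiy'.
pose orb := [seq (g : gal_of E) y | g <- enum inertia].
have orbP x : reflect (exists2 g : gal_of E, g \in inertia & x = g y) (x \in orb).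
  apply: (iffP mapP) => -[g Hg ->]; exists g => //.
    by rewrite mem_enum in Hg.
  by rewrite mem_enum.
have [/orbP [g Ig ->]|ny'] := boolP (y' \in orb); first by exists g.
have IH g : g \in inertia -> g \in H by apply: (subsetP inertia_sub).
pose w (b : bool) := \prod_(x <- X | (x \in orb) == b) (a - x).
have Bw b : inB (w b).
  rewrite /w -big_filter big_seq; apply: inB_prod => x.
  by rewrite mem_filter => /andP [_ Xx]; apply: inB_sub; last exact: BX.
have Iw b g : g \in inertia -> g (w b) = w b.
  move=> Ig; have Hg := IH _ Ig.
  rewrite /w rmorph_prod -[RHS](perm_big _ (perm_map_gal uX (fun x => HX g x Hg))).
  rewrite big_map; apply: eq_big => x; last by rewrite rmorphB /= fixa.
  congr (_ == b); apply/orbP/orbP => -[k Ik E1].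
    by exists (k * g)%g; [apply: groupM | rewrite E1 galM //; case: (BX _ Xy)].
  have Ey : y \in E by case: (BX _ Xy).
  exists (k * g^-1)%g; first by rewrite groupM ?groupV.
  by apply: (fmorph_inj g); rewrite /= E1 -galM // mulgKV.
have phiw b z : z \in X -> phi (h z) = phi (h a) -> (z \in orb) == b -> phi (h (w b)) = 0.
  move=> Xz phiz zb; rewrite /w rmorph_prod.
  have Sx x : x \in X -> S (h (a - x)) by move=> Xx; apply/inB_S/inB_sub/BX.
  have [|_ ->] := @place_prod_seq _ _ _ _ _ plS _ X (fun x => (x \in orb) == b)
      (fun x => h (a - x)); first by move=> x /Sx.
  rewrite -big_filter (big_rem z) ?mem_filter ?zb //= rmorphB.
  by rewrite (place_sub plS (inB_S Ba) (inB_S (BX _ Xz))).2 phiz subrr mul0r.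
have orb_y : y \in orb by apply/orbP; exists 1%g; rewrite ?group1 ?gal_id.
have [d1 [s1 [Sd1 Ss1 d1_0 E1]]] : exists dl s, [/\ S dl, S s, phi dl != 0 &
    dl * h (w true) = iota 'X * s].
  by apply: inertia_divides => //; [exact: Iw | apply: (phiw _ y); rewrite ?orb_y].
have [d2 [s2 [Sd2 Ss2 d2_0 E2]]] : exists dl s, [/\ S dl, S s, phi dl != 0 &
    dl * h (w false) = iota 'X * s].
  apply: inertia_divides => //; [exact: Iw | apply: (phiw _ y') => //].
  by rewrite (negPf ny').
have Ew : h (w true) * h (w false) = iota q.
  rewrite -rmorphM -Eq /w [RHS](eq_bigr (fun x => h (a - x))); last by move=> x _; rewrite rmorphB.
  rewrite -rmorph_prod; congr (h _); rewrite [RHS](bigID (mem orb)) /=.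
  congr (_ * _); apply: eq_bigl => x; first by case: (x \in orb).
  by case: (x \in orb).
have [r Er] : exists r, q = 'X * r.
  have /rootP/factor_theorem [r ->] : q.[0] = 0 by rewrite horner_coef0.
  by exists r; rewrite subr0 mulrC.
have r0 : r.[0] != 0 by move: q1; rewrite Er coefXM /= horner_coef0.
have iX0 : iota 'X != 0 by rewrite -(rmorph0 iota) (inj_eq iota_inj) polyX_eq0.
(* [q] is [u] times [r], while the two factors bring [u^2]: after cancellation one [u] remains on
   the right, but the left side has nonzero residue. *)
have Er' : d1 * d2 * iota r = iota 'X * (s1 * s2).
  apply: (mulfI iX0); transitivity (d1 * d2 * iota q); first by rewrite Er rmorphM; ring.
  by rewrite -Ew; transitivity ((d1 * h (w true)) * (d2 * h (w false)));
    [ring | rewrite E1 E2; ring].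
have Sdd := place_mul plS Sd1 Sd2.
have := congr1 phi Er'.
rewrite (place_mul plS Sdd.1 (place_iota plS r)).2 Sdd.2 (place_iotaE plS).
rewrite (place_mul plS (place_iota plS 'X) (place_mul plS Ss1 Ss2).1).2.
rewrite (place_iotaE plS) hornerX mul0r => /eqP.
by rewrite !mulf_eq0 (negPf d1_0) (negPf d2_0) (negPf r0).
Qed.

End Inertia.

(** * Superattracting parameters *)

Section Gleason.

Variable d : nat.
Hypothesis d_gt1 : (1 < d)%N.

(** The orbit of the critical point [0] of [z^d + c], as polynomials in [c]: for [j > 0] the roots
    are the [c] for which [0] is periodic of period dividing [j]. *)
Definition gleason (R : nzRingType) (j : nat) : {poly R} := iter j (fun g => g ^+ d + 'X) 0.

Lemma gleasonS (R : nzRingType) j : gleason R j.+1 = gleason R j ^+ d + 'X.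
Proof. by []. Qed.

Lemma map_gleason (R R' : nzRingType) (f : {rmorphism R -> R'}) j :
  map_poly f (gleason R j) = gleason R' j.
Proof.
elim: j => [|j IH]; first by rewrite /gleason /= rmorph0.
by rewrite !gleasonS rmorphD rmorphXn /= IH map_polyX.
Qed.

Lemma size_gleason (R : idomainType) j :
  gleason R j.+1 \is monic /\ size (gleason R j.+1) = (d ^ j).+1.
Proof.
elim: j => [|j [mG sG]].
  by rewrite /gleason /= expr0n gtn_eqF ?(ltnW d_gt1) // add0r monicX size_polyX.
rewrite -[gleason R j.+2]/(gleason R j.+1 ^+ d + 'X).
have sGd : size (gleason R j.+1 ^+ d) = (d ^ j.+1).+1.
  by rewrite polySpred ?expf_neq0 ?monic_neq0 // size_exp sG expnSr.
have lt : (size ('X : {poly R}) < size (gleason R j.+1 ^+ d)%R)%N.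
  by rewrite sGd size_polyX ltnS (leq_trans d_gt1) // -{1}(expn1 d) leq_exp2l.
split; last by rewrite size_polyDl.
by rewrite monicE lead_coefDl // -monicE monic_exp.
Qed.

(* The derivative of [G^d + X] is [1 + d G^(d-1) G'], so at a double root the algebraic
   integer [G^(d-1) G'] would equal [-1/d]. *)
Lemma gleason_root_simple k (x : algC) : root (gleason algC k.+1) x ->
  (gleason algC k.+1)^`().[x] != 0.
Proof.
move=> rx.
have GI j : gleason algC j \is a polyOver Num.int.
  by rewrite -(map_gleason intr); apply/polyOverP => i; rewrite coef_map rpred_int.
have xA : x \in Aint by apply: root_monic_Aint rx (size_gleason _ _).1 (GI _).
have GA j : (gleason algC j).[x] \in Aint.
  elim: j => [|j IH]; first by rewrite /gleason /= horner0 Aint0.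
  by rewrite gleasonS hornerD hornerX horner_exp rpredD ?rpredX.
have DA j : (gleason algC j)^`().[x] \in Aint.
  elim: j => [|j IH]; first by rewrite /gleason /= deriv0 horner0 Aint0.
  rewrite gleasonS derivD derivX deriv_exp hornerD hornerMn hornerM horner_exp hornerC.
  by rewrite rpredD ?rpredMn ?rpredM ?rpredX ?Aint1.
apply/eqP; rewrite gleasonS derivD derivX deriv_exp hornerD hornerMn hornerM horner_exp hornerC.
set y := _ * _ => E.
have yA : y \in Aint by rewrite rpredM ?rpredX.
have d0 : (d%:R : algC) != 0 by rewrite Num.Theory.pnatr_eq0 -lt0n (ltnW d_gt1).
have yE : y = - d%:R^-1.
  by apply: (mulIf d0); rewrite mulNr mulVf // mulr_natr; apply/eqP; rewrite -addr_eq0 E.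
have /Num.Theory.intrP [m Em] : y \in Num.int.
  by apply: Cint_rat_Aint => //; rewrite yE rpredN rpredV rpred_nat.
move: E; rewrite Em -mulr_natr -[d%:R]/((d%:Z)%:~R) -intrM -[1]/(1%:~R) -intrD.
move/eqP; rewrite intr_eq0 => /eqP Em0.
have [m0|m0] : (0 <= m \/ m <= -1)%R by lia.
  by nia.
by nia.
Qed.

(* The [d ^ k] simple roots outnumber the roots of all the polynomials of smaller index,
   whose degrees add up to less than [d ^ k]. *)
Lemma gleason_primitive_root k :
  exists x : algC, [/\ root (gleason algC k.+1) x,
    (forall j, (0 < j <= k)%N -> ~~ root (gleason algC j) x) &
    (gleason algC k.+1)^`().[x] != 0].
Proof.
have [r Er] := closed_field_poly_normal (gleason algC k.+1).
have [mG sG] := size_gleason algC k.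
rewrite (monicP mG) scale1r in Er.
have sr : size r = (d ^ k)%N by apply/eqP; rewrite -eqSS -sG Er (size_prod_XsubC _ id).
have ur : uniq r.
  rewrite -separable_prod_XsubC -Er unlock.
  apply/coprimepP => q; rewrite -[q %= 1]size_poly_eq1 => dq dq'.
  apply/negPn/negP => /closed_rootP [x qx].
  have rx := root_dvdp dq qx; have := gleason_root_simple rx.
  by have /rootP -> := root_dvdp dq' qx; rewrite eqxx.
pose P := \prod_(j < k) gleason algC j.+1.
have mP : P \is monic by apply: monic_prod => j _; exact: (size_gleason _ _).1.
have sP : (size P <= d ^ k)%N.
  rewrite /P size_prod; last by move=> j _; rewrite monic_neq0 //; exact: (size_gleason _ _).1.
  rewrite (eq_bigr (fun j : 'I_k => (d ^ j).+1)); last by move=> j _; exact: (size_gleason _ _).2.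
  rewrite card_ord; elim: k {r Er mG sG sr ur P mP} => [|k IH]; first by rewrite big_ord0.
  rewrite big_ord_recr /=; move: IH; set S := (\sum_(_ < _) _)%N.
  rewrite expnS; nia.
have /allPn [x rx nx] : ~~ all (root P) r.
  apply/negP => /max_poly_roots /(_ ur); rewrite monic_neq0 // sr => /(_ isT).
  by rewrite ltnNge sP.
have rGx : root (gleason algC k.+1) x by rewrite Er root_prod_XsubC.
exists x; split=> // [j /andP [j0 jk]|]; last exact: gleason_root_simple.
apply: contra nx => /rootP Gx; case: j j0 jk Gx => // j _ jk Gx.
by apply/rootP; rewrite /P horner_prod (bigD1 (Ordinal jk)) //= Gx mul0r.
Qed.

End Gleason.

Section TwoParameters.

(** The inner variable stands for [e] and receives [x], the outer one stands for [t]. *)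
Definition ev2 (G : fieldType) (rho : {rmorphism rat -> G}) (x t : G)
    : {poly {poly rat}} -> G :=
  horner_eval t \o map_poly (horner_eval x \o map_poly rho).

HB.instance Definition _ G rho x t := GRing.RMorphism.copy (@ev2 G rho x t)
  (horner_eval t \o map_poly (horner_eval x \o map_poly rho)).

(* As [P] is monic in the second variable, if [Q(e, -)] vanished at all roots of
   [P(e, -)], then [P] would divide a power of [Q] already over [rat[X]]. *)
Lemma ev2_avoid (G : fieldType) (C : closedFieldType)
    (rho : {rmorphism rat -> C}) (rho' : {rmorphism rat -> G}) (e : C) (e' t' : G)
    (P Q : {poly {poly rat}}) :
  injective (horner_eval e \o map_poly rho : {poly rat} -> C) ->
  P \is monic -> ev2 rho' e' t' P = 0 -> ev2 rho' e' t' Q != 0 ->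
  exists t : C, ev2 rho e t P = 0 /\ ev2 rho e t Q != 0.
Proof.
move=> e_inj mP P0 Q0; apply: NNPP => nex.
pose f := horner_eval e \o map_poly rho.
have [r Er] := closed_field_poly_normal (map_poly f P).
have mP' : map_poly f P \is monic by apply: monic_map.
rewrite (monicP mP') scale1r in Er.
have rQ t : t \in r -> root (map_poly f Q) t.
  move=> rt; apply/negPn/negP => nQ; apply: nex; exists t; split => //.
  by apply/eqP; rewrite -[_ == 0]/(root (map_poly f P) t) Er root_prod_XsubC.
pose n := size r.
have dPQ : map_poly f P %| map_poly f (Q ^+ n).
  rewrite rmorphXn Er /n; elim: (r) rQ => [|t s IH] rQ; first by rewrite big_nil dvd1p.
  rewrite big_cons exprS dvdp_mul ?IH //; first by rewrite dvdp_XsubCl rQ ?mem_head.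
  by move=> u su; rewrite rQ // inE su orbT.
have Ediv := Pdiv.RingMonic.rdivp_eq mP (Q ^+ n).
set R := Pdiv.Ring.rmodp (Q ^+ n) P in Ediv.
have R0 : R = 0.
  apply: (map_inj_poly e_inj (rmorph0 f)); rewrite map_poly0; apply/eqP.
  have dR : map_poly f P %| map_poly f R.
    by move: dPQ; rewrite Ediv rmorphD rmorphM /= dvdp_addr // dvdp_mull.
  apply: contraT => R0; move: (dvdp_leq R0 dR).
  rewrite !(size_map_inj_poly e_inj (rmorph0 f)) leqNgt.
  by rewrite Pdiv.Ring.ltn_rmodpN0 // monic_neq0.
have := congr1 (ev2 rho' e' t') Ediv; rewrite R0 addr0 rmorphXn rmorphM /= P0 mulr0.
by move/eqP; rewrite expf_eq0 (negPf Q0) andbF.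
Qed.

End TwoParameters.

Section Superattracting.

Variable d : nat.
Hypothesis d_gt1 : (1 < d)%N.

Section Recursions.
Variables (R : comNzRingType) (A e t : R).
Definition fam x := x ^+ d - e * x ^+ d.-1 + t.
Definition fam' x := d%:R * x ^+ d.-1 - e * (d.-1%:R * x ^+ d.-2).
(** The derivative of [iter j fam A] with respect to [t], with [A] and [e] held fixed. *)
Fixpoint orbit_deriv j := if j is i.+1 then 1 + fam' (iter i fam A) * orbit_deriv i else 0.
(** The divided difference [(fam x - fam y) / (x - y)], written without division. *)
Definition divdiff x y : R :=
  \sum_(i < d) x ^+ (d.-1 - i) * y ^+ i - e * \sum_(i < d.-1) x ^+ (d.-2 - i) * y ^+ i.
Definition orbit_quot j := \prod_(i < j) divdiff (iter i.+1 fam A) (iter i.+1 fam 0).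

(** When [A] is a multiple of [e], the orbits of [A] and [0] coincide at [e = 0], so that their
    being distinct cannot be tested there. Once the factor [A^d - e A^(d-1)] is split off, the
    quotient can be. *)
Lemma orbit_quotP j : iter j.+1 fam A - iter j.+1 fam 0 =
  (A ^+ d - e * A ^+ d.-1) * orbit_quot j.
Proof.
elim: j => [|j IH].
  have z n : (0 < n)%N -> (0 : R) ^+ n = 0 by move=> n0; rewrite expr0n gtn_eqF.
  rewrite /orbit_quot big_ord0 mulr1 /= /fam !z ?(ltnW d_gt1) -1?ltnS ?prednK ?(ltnW d_gt1) //.
  by ring.
rewrite /orbit_quot big_ord_recr -/(orbit_quot j) [RHS]mulrA -IH.
rewrite !(iterS j.+1); move: (iter j.+1 fam A) (iter j.+1 fam 0) => x y.
rewrite /fam /divdiff mulrBr mulrCA -!subrXX.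
by ring.
Qed.

End Recursions.

Section Morph.
Variables (R R' : comNzRingType) (f : {rmorphism R -> R'}) (A e t : R).

Lemma fam_morph x : f (fam e t x) = fam (f e) (f t) (f x).
Proof. by rewrite /fam rmorphD rmorphB rmorphM !rmorphXn. Qed.

Lemma iter_fam_morph j x : f (iter j (fam e t) x) = iter j (fam (f e) (f t)) (f x).
Proof. by elim: j => //= j IH; rewrite fam_morph IH. Qed.

Lemma orbit_deriv_morph j : f (orbit_deriv A e t j) = orbit_deriv (f A) (f e) (f t) j.
Proof.
elim: j => [|j IH] /=; first exact: rmorph0.
rewrite rmorphD rmorph1 rmorphM IH /fam'; congr (1 + _ * _).
by rewrite rmorphB !rmorphM !rmorphXn !rmorph_nat iter_fam_morph.
Qed.

Lemma divdiff_morph x y : f (divdiff e x y) = divdiff (f e) (f x) (f y).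
Proof.
rewrite /divdiff rmorphB rmorphM !rmorph_sum.
by congr (_ - _ * _); apply: eq_bigr => i _; rewrite rmorphM !rmorphXn.
Qed.

Lemma orbit_quot_morph j : f (orbit_quot A e t j) = orbit_quot (f A) (f e) (f t) j.
Proof.
rewrite /orbit_quot rmorph_prod; apply: eq_bigr => i _.
by rewrite divdiff_morph !iter_fam_morph rmorph0.
Qed.

End Morph.

Section Gleason0.
Variables (R : comNzRingType) (t : R).

Lemma iter_fam0 j : iter j (fam 0 t) 0 = (gleason d R j).[t].
Proof.
elim: j => [|j IH]; first by rewrite /gleason /= horner0.
by rewrite iterS IH gleasonS hornerD hornerX horner_exp /fam mul0r subr0.
Qed.

Lemma orbit_deriv0 j : orbit_deriv 0 0 t j = (gleason d R j)^`().[t].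
Proof.
elim: j => [|j IH]; first by rewrite /gleason /= deriv0 horner0.
rewrite gleasonS derivD derivX deriv_exp hornerD hornerMn hornerM horner_exp hornerC.
by rewrite /= IH iter_fam0 /fam' mul0r subr0 addrC; congr (_ + _); ring.
Qed.

Lemma orbit_quot0 j :
  orbit_quot 0 0 t j = \prod_(i < j) (d%:R * (gleason d R i.+1).[t] ^+ d.-1).
Proof.
apply: eq_bigr => i _; rewrite /divdiff mul0r subr0 !iter_fam0.
rewrite (eq_bigr (fun _ => (gleason d R i.+1).[t] ^+ d.-1)).
  by rewrite sumr_const card_ord mulr_natl.
by move=> k _; rewrite -exprD subnK // -ltnS prednK ?(ltnW d_gt1).
Qed.

End Gleason0.

Lemma iter_fam_monic (R : idomainType) (A e : R) j :
  let H := iter j.+1 (fam e%:P 'X) A%:P in H \is monic /\ (1 < size H)%N.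
Proof.
elim: j => [|j [mH sH]] /=.
  suff -> : fam e%:P 'X A%:P = 'X - (- (A ^+ d - e * A ^+ d.-1))%:P.
    by rewrite monicXsubC size_XsubC.
  by rewrite /fam polyCN opprK polyCB polyCM !polyC_exp addrC.
rewrite -iterS; move: (iter j.+1 _ _) mH sH => H mH sH.
pose s := (size H).-1; have sHE : size H = s.+1 by rewrite /s prednK // ltnW.
have sX n : (size (H ^+ n) = (s * n).+1)%N.
  by rewrite polySpred ?expf_neq0 ?monic_neq0 // size_exp.
have lt : (size ('X - e%:P * H ^+ d.-1)%R < size (H ^+ d)%R)%N.
  rewrite sX ltnS (leq_trans (size_polyD _ _)) // geq_max size_polyX.
  rewrite size_polyN mul_polyC (leq_trans (size_scale_leq _ _)) ?sX; nia.
rewrite /fam -addrA [- _ + _]addrC; split.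
  by rewrite monicE lead_coefDl // -monicE monic_exp.
by rewrite size_polyDl // sX; nia.
Qed.

(** The inequalities reduce to the nonvanishing of one polynomial [Pi] in [e] and [t] somewhere on
    the locus [fam^(k+1) A = A], which is monic in [t]. By [ev2_avoid] one point of the locus with
    [Pi] nonzero is enough: [e = 0] and [t = tau], a root from [gleason_primitive_root]. *)
Lemma superattracting (F : closedFieldType) (rho : {rmorphism rat -> F}) (e : F) k :
  injective (horner_eval e \o map_poly rho : {poly rat} -> F) ->
  exists t : F, let A := rho (d.-1%:R / d%:R) * e in
  [/\ A != 0 /\ iter k.+1 (fam e t) A = A,
      forall j, (0 < j <= k)%N -> iter j (fam e t) A != A,
      forall j, (0 < j <= k.+1)%N -> iter j (fam e t) A != 0,
      forall j, (0 < j <= k.+1)%N -> iter j (fam e t) 0 != A /\ iter j (fam e t) 0 != 0 &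
      orbit_deriv A e t k.+1 != 0].
Proof.
have d_gt0 : (0 < d)%N by lia.
have dp_gt0 : (0 < d.-1)%N by lia.
move=> e_inj; pose a : rat := d.-1%:R / d%:R.
have d0 : (d%:R : rat) != 0 by rewrite Num.Theory.pnatr_eq0 -lt0n.
have a0 : a != 0 by rewrite mulf_neq0 ?invr_eq0 ?Num.Theory.pnatr_eq0 // -lt0n.
have a1 : a - 1 != 0.
  rewrite subr_eq0; apply/eqP => /(congr1 ( *%R^~ d%:R)); rewrite mulfVK // mul1r => /eqP.
  by rewrite Num.Theory.eqr_nat; lia.
pose Ae : {poly rat} := a *: 'X.
pose H j : {poly {poly rat}} := iter j (fam ('X%:P) 'X) Ae%:P.
pose C j : {poly {poly rat}} := iter j (fam ('X%:P) 'X) 0.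
pose D := orbit_deriv Ae%:P ('X%:P : {poly {poly rat}}) 'X k.+1.
pose Q := orbit_quot Ae%:P ('X%:P : {poly {poly rat}}) 'X k.
pose c := a ^+ d - a ^+ d.-1.
(* [fam^(k+1) 0 = 0] would mean [A = c e^d Q]. Divided by [e], this is [Z = 0], which can be tested
   at [e = 0], where [Z = - a]. *)
pose Z := ((c *: 'X^(d.-1))%:P * Q - a%:P%:P) : {poly {poly rat}}.
pose Pi := (\prod_(j < k) ((H j.+1 - Ae%:P) * H j.+1 * (C j.+1 - Ae%:P) * C j.+1)) * D * Q * Z.
have [tau [rtau ntau dtau]] := gleason_primitive_root d_gt1 k.
have ev2X (G : fieldType) (r : {rmorphism rat -> G}) x t : ev2 r x t 'X = t.
  by rewrite /ev2 /= map_polyX /horner_eval hornerX.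
have ev2C (G : fieldType) (r : {rmorphism rat -> G}) x t p : ev2 r x t p%:P = (map_poly r p).[x].
  by rewrite /ev2 /= map_polyC /horner_eval hornerC.
have ev2e (G : fieldType) (r : {rmorphism rat -> G}) x t : ev2 r x t 'X%:P = x.
  by rewrite ev2C map_polyX hornerX.
have ev2A (G : fieldType) (r : {rmorphism rat -> G}) x t : ev2 r x t Ae%:P = r a * x.
  by rewrite ev2C map_polyZ map_polyX hornerZ hornerX.
have ev2H (G : fieldType) (r : {rmorphism rat -> G}) x t j :
    ev2 r x t (H j) = iter j (fam x t) (r a * x).
  by rewrite /H iter_fam_morph /= ev2e ev2X ev2A.
have ev2Cj (G : fieldType) (r : {rmorphism rat -> G}) x t j :
    ev2 r x t (C j) = iter j (fam x t) 0.
  by rewrite /C iter_fam_morph /= ev2e ev2X rmorph0.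
have ev2B (G : fieldType) (r : {rmorphism rat -> G}) x t p q :
  ev2 r x t (p - q) = ev2 r x t p - ev2 r x t q by exact: rmorphB.
have ev2M (G : fieldType) (r : {rmorphism rat -> G}) x t p q :
  ev2 r x t (p * q) = ev2 r x t p * ev2 r x t q by exact: rmorphM.
have ev2prod (G : fieldType) (r : {rmorphism rat -> G}) x t (f : 'I_k -> _) :
  ev2 r x t (\prod_j f j) = \prod_j ev2 r x t (f j) by exact: rmorph_prod.
have ev2Z (G : fieldType) (r : {rmorphism rat -> G}) x t :
    ev2 r x t Z = r c * x ^+ d.-1 * ev2 r x t Q - r a.
  rewrite rmorphB rmorphM /= !ev2C map_polyC hornerC map_polyZ map_polyXn.
  by rewrite hornerZ hornerXn.
pose rC : {rmorphism rat -> algC} := ratr.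
have ev2Q (G : fieldType) (r : {rmorphism rat -> G}) x t : ev2 r x t Q = orbit_quot (r a * x) x t k.
  by rewrite /Q orbit_quot_morph /= ev2e ev2X ev2A.
have ev2D (G : fieldType) (r : {rmorphism rat -> G}) x t : ev2 r x t D = orbit_deriv (r a * x) x t k.+1.
  rewrite /D orbit_deriv_morph.
  by congr (orbit_deriv _ _ _ _); [exact: ev2A | exact: ev2e | exact: ev2X].
have dn0 : (d%:R : algC) != 0 by rewrite Num.Theory.pnatr_eq0 -lt0n.
have mHA : H k.+1 - Ae%:P \is monic.
  have [mH sH] := iter_fam_monic Ae 'X k.
  by rewrite monicE lead_coefDl -?monicE // size_polyN (leq_ltn_trans (size_polyC_leq1 _)).
clearbody H C.
have [||t [Pt0 Pit0]] :=
    @ev2_avoid algC F rho rC e 0 tau (H k.+1 - Ae%:P) Pi e_inj mHA _ _.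
- by rewrite ev2B ev2H ev2A mulr0 iter_fam0 subr0; apply/rootP.
- rewrite /Pi !ev2M ev2prod ev2D ev2Z ev2Q mulr0 expr0n.
  rewrite gtn_eqF // mulr0 mul0r sub0r orbit_deriv0 orbit_quot0.
  rewrite !mulf_neq0 ?oppr_eq0 ?fmorph_eq0 //; last first.
    apply/prodf_neq0 => j _; apply: mulf_neq0; [exact: dn0 | apply: expf_neq0].
    by apply: (ntau j.+1); rewrite /= ltn_ord.
  apply/prodf_neq0 => j _; rewrite !ev2M !ev2B ev2H ev2Cj ev2A mulr0 iter_fam0 subr0.
  by rewrite !mulf_neq0 //; apply: (ntau j.+1); rewrite /= ltn_ord.
exists t => A; have EA : iter k.+1 (fam e t) A = A.
  by apply/eqP; move: Pt0; rewrite ev2B ev2H ev2A => /eqP; rewrite subr_eq0.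
have e0 : e != 0.
  apply/eqP => e0; have /e_inj/eqP : (horner_eval e \o map_poly rho) 'X
      = (horner_eval e \o map_poly rho) (0 : {poly rat}).
    by rewrite rmorph0 /= map_polyX /horner_eval hornerX.
  by rewrite polyX_eq0.
have A0 : A != 0 by rewrite mulf_neq0 // fmorph_eq0.
rewrite /Pi !ev2M !mulf_eq0 !negb_or in Pit0.
case/andP: Pit0 => /andP [/andP [prod0 D0] Q0] Z0.
have prodP j : (0 < j <= k)%N -> [/\ iter j (fam e t) A != A, iter j (fam e t) A != 0,
    iter j (fam e t) 0 != A & iter j (fam e t) 0 != 0].
  case: j => // j jk; move: prod0; rewrite ev2prod => /prodf_neq0/(_ (Ordinal jk) isT).
  rewrite !ev2M !ev2B ev2H ev2Cj ev2A !mulf_eq0 !negb_or !subr_eq0 /=.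
  by case/andP=> /andP [/andP [? ?] ?] ?.
have Ed (G : comNzRingType) (x : G) : x ^+ d = x * x ^+ d.-1 by rewrite -exprS prednK.
have EQ : A - iter k.+1 (fam e t) 0 = rho c * e ^+ d * ev2 rho e t Q.
  rewrite -{1}EA orbit_quotP ev2Q; congr (_ * _).
  rewrite /A /c rmorphB !rmorphXn !exprMn mulrBl; congr (_ - _).
  by rewrite (Ed _ e); ring.
have c0 : c != 0.
  by rewrite /c Ed -[X in _ - X]mul1r -mulrBl mulf_neq0 ?expf_neq0.
have Ck : iter k.+1 (fam e t) 0 != A /\ iter k.+1 (fam e t) 0 != 0.
  split; apply/eqP => E.
    move/eqP: EQ; rewrite E subrr eq_sym !mulf_eq0 (negPf Q0) fmorph_eq0 (negPf c0).
    by rewrite expf_eq0 (negPf e0) andbF.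
  case/eqP: Z0; rewrite ev2Z; apply: (mulIf e0); rewrite mul0r mulrBl -[rho a * e]/A.
  move: EQ; rewrite E subr0 => ->.
  by rewrite (Ed _ e); ring.
split.
- by split.
- by move=> j /prodP [].
- move=> j /andP [j0]; rewrite leq_eqVlt => /orP [/eqP ->|]; first by rewrite EA.
  by rewrite ltnS => jk; case: (prodP j) => //; rewrite j0.
- move=> j /andP [j0]; rewrite leq_eqVlt => /orP [/eqP ->|] //.
  by rewrite ltnS => jk; case: (prodP j) => //; rewrite j0.
by rewrite -ev2D.
Qed.

End Superattracting.

(** * Curves through the generic polynomial *)

Lemma rmorph_mpolyE n (A : comNzRingType) (B : comNzRingType)
    (f : {rmorphism {mpoly A[n]} -> B}) p :
  f p = mmap (f \o @mpolyC n A) (fun i => f 'X_i) p.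
Proof.
rewrite {1}[p]mpolyE rmorph_sum; apply: eq_bigr => m _.
rewrite -mul_mpolyC rmorphM /=; congr (_ * _).
by rewrite mpolyXE_id rmorph_prod; apply: eq_bigr => i _; rewrite rmorphXn.
Qed.

Lemma deriv_inj_char0 (F : fieldType) (p q : {poly F}) : [pchar F] =i pred0 ->
  p^`() = q^`() -> p`_0 = q`_0 -> p = q.
Proof.
move=> F0 E E0; apply/polyP => -[//|i].
have := congr1 (fun r : {poly F} => r`_i) E; rewrite !coef_deriv => /eqP.
rewrite -subr_eq0 -mulrnBl -mulr_natr mulf_eq0 (pcharf0P _).1 // orbF subr_eq0.
by move/eqP.
Qed.

Section Curve.

Variables (K : fieldExtType rat) (d : nat).
Hypothesis d_gt1 : (1 < d)%N.
Variables (F O : closedFieldType) (theta : {rmorphism Kst K d -> F}).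
Variable (iota : {rmorphism {poly F} -> O}).
Hypothesis iota_inj : injective iota.

Local Notation f := (generic_poly K d).

Definition rat_Kst : {rmorphism rat -> Kst K d} :=
  @FracField.tofrac {mpoly K[d]} \o @mpolyC d K \o in_alg K.

Lemma Kst_char0 : [pchar Kst K d] =i pred0.
Proof. by move=> p; rewrite (fmorph_pchar rat_Kst) Num.Theory.pchar_num. Qed.

Lemma F_char0 : [pchar F] =i pred0.
Proof. by move=> p; rewrite (fmorph_pchar theta) Kst_char0. Qed.

Lemma coef_generic (i : 'I_d) : f`_(d - i.+1) = param K i.
Proof.
rewrite /generic_poly coefD coefXn ltn_eqF ?add0r; last by have := ltn_ord i; lia.
rewrite coef_sum (bigD1 i) //= coefZ coefXn eqxx mulr1 big1 ?addr0 // => j ne.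
rewrite coefZ coefXn; case: eqP => [E|]; last by rewrite mulr0.
by case/eqP: ne; apply: val_inj; have := ltn_ord i; have := ltn_ord j; move: E => /=; lia.
Qed.

Lemma generic_monic : f \is monic /\ size f = d.+1.
Proof.
have lt : (size (\sum_(i < d) param K i *: 'X^(d - i.+1))%R < size ('X^d : {poly Kst K d})%R)%N.
  rewrite size_polyXn ltnS (leq_trans (size_sum _ _ _)) //; apply/bigmax_leqP => i _.
  by rewrite (leq_trans (size_scale_leq _ _)) // size_polyXn; have := ltn_ord i; lia.
split; last by rewrite size_polyDl // size_polyXn.
by rewrite monicE lead_coefDl // lead_coefXn.
Qed.

Lemma coef_generic_lead : f`_d = 1.
Proof. by have [/monicP <- sf] := generic_monic; rewrite lead_coefE sf. Qed.

Lemma generic_coefP i : [\/ i = d, (d < i)%N | exists j : 'I_d, i = (d - j.+1)%N].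
Proof.
have [lt|gt|->] := ltngtP i d; [constructor 3 | by constructor 2 | by constructor 1].
have lt' : (d - i.+1 < d)%N by lia.
by exists (Ordinal lt') => /=; lia.
Qed.

(* The antiderivative of [d * g] with constant term [t]. *)
Definition curve_poly (g : {poly {poly F}}) (t : {poly F}) : {poly {poly F}} :=
  \poly_(i < d.+1) (if i is j.+1 then (d%:R / j.+1%:R)%:P * g`_j else t).

Variables (g : {poly {poly F}}) (t : {poly F}).
Hypothesis g_monic : g \is monic.
Hypothesis g_size : size g = d.

Local Notation fu := (curve_poly g t).

Lemma curve_poly0 : fu`_0 = t.
Proof. by rewrite coef_poly. Qed.

Lemma deriv_curve_poly : fu^`() = d%:R *: g.
Proof.
apply/polyP => i; rewrite coef_deriv coefZ coef_poly ltnS.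
have [lt|ge] := ltnP i d; last by rewrite [g`_i]nth_default ?g_size // mulr0 mul0rn.
rewrite -mulrnAl; congr (_ * _).
by rewrite -polyCMn -(mulr_natr (d%:R / _)) mulfVK ?polyC_natr // (pcharf0P _).1 //; exact: F_char0.
Qed.

Lemma curve_poly_lead : fu`_d = 1.
Proof.
have d_gt0 : (0 < d)%N by apply: ltnW.
rewrite coef_poly ltnSn; case: (d) d_gt0 g_size => // j _ sg.
move/monicP: g_monic; rewrite lead_coefE sg /= => ->; rewrite mulr1 divff ?polyC1 //.
by rewrite (pcharf0P _).1 //; exact: F_char0.
Qed.

Lemma curve_poly_monic : fu \is monic /\ size fu = d.+1.
Proof.
have sz : size fu = d.+1.
  apply/eqP; rewrite eqn_leq size_poly ltnNge; apply/negP => le.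
  by have := curve_poly_lead; rewrite nth_default // => /esym/eqP; rewrite oner_eq0.
by split=> //; rewrite monicE lead_coefE sz curve_poly_lead.
Qed.

Hypothesis g_generic : map_poly (horner_eval 1) (d%:R *: g) = map_poly theta f^`().
Hypothesis t_generic : t.[1] = theta f`_0.

Lemma curve_poly_generic : map_poly (horner_eval 1) fu = map_poly theta f.
Proof.
apply: deriv_inj_char0; first exact: F_char0.
  by rewrite !deriv_map deriv_curve_poly g_generic.
by rewrite [LHS]coef_map [RHS]coef_map curve_poly0; exact: t_generic.
Qed.

Definition curve_map : {mpoly K[d]} -> {poly F} :=
  mmap (polyC \o theta \o @FracField.tofrac {mpoly K[d]} \o @mpolyC d K)
    (fun i : 'I_d => fu`_(d - i.+1)).
HB.instance Definition _ := GRing.RMorphism.on curve_map.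

Lemma curve_map1 p : (curve_map p).[1] = theta (FracField.tofrac p).
Proof.
rewrite -[LHS]/((horner_eval 1 \o curve_map) p).
rewrite -[RHS]/((theta \o @FracField.tofrac {mpoly K[d]}) p).
rewrite [LHS]rmorph_mpolyE [RHS]rmorph_mpolyE /mmap; apply: eq_bigr => m _; congr (_ * _).
  by rewrite /= /curve_map mmapC /= /horner_eval hornerC.
apply: mmap1_eq => i; rewrite /= /curve_map mmapX mmap1U -[LHS]/(horner_eval 1 _).
by rewrite -coef_map curve_poly_generic coef_map /= coef_generic.
Qed.

(** Followed by evaluation at [u = 1], it is the embedding of [K[s, t]] in [F] through [theta]. *)
Lemma curve_map_inj : injective curve_map.
Proof.
move=> p q E; apply/eqP; rewrite -tofrac_eq -(inj_eq (fmorph_inj theta)).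
by rewrite -!curve_map1 E.
Qed.

Variable L : fieldExtType (Kst K d).

(** The injection of [K[s, t]] in [O] along the curve extends to fractions, then to the finite
    extension [L]. The second clause, that the base field lands in [F(u)], is the form in which
    [Inertia] uses it. *)
Lemma curve_hom : exists h : {rmorphism L -> O},
  map_poly h (map_poly (in_alg L) f) = map_poly iota fu /\
  forall a : Kst K d, exists p q : {poly F}, q != 0 /\ h a%:A * iota q = iota p.
Proof.
pose j : {rmorphism {mpoly K[d]} -> O} := iota \o curve_map.
have j_inj : injective j by apply: inj_comp; [exact: iota_inj | exact: curve_map_inj].
have [J HJ] := fraction_lift j_inj.
have [h Hh] := hom_extends L J Kst_char0.
exists h; split; last first.
  move=> a; have [[x y] /= y0 Hxy] := fraction_decomp a.
  exists (curve_map x), (curve_map y); split.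
    by rewrite -(rmorph0 curve_map) (inj_eq curve_map_inj).
  by rewrite Hh -[iota _]/(j y) -[iota _]/(j x) -!HJ -rmorphM Hxy.
apply/polyP => i; rewrite !coef_map /= Hh.
have [->|lt|[k ->]] := generic_coefP i.
- by rewrite coef_generic_lead curve_poly_lead !rmorph1.
- rewrite !nth_default ?rmorph0 ?generic_monic.2 ?curve_poly_monic.2 //.
- by rewrite coef_generic HJ /= /curve_map mmapX mmap1U.
Qed.

End Curve.

(** * Calculus modulo [u^2] *)

Section FirstOrder.

Variable F : fieldType.
Implicit Types (p q x : {poly F}) (P : {poly {poly F}}).

Local Notation "P ^0" := (map_poly (horner_eval 0) P) (at level 2).

Definition coef1fun (p : {poly F}) : F := p`_1.

Lemma coef1fun0 : coef1fun 0 = 0. Proof. exact: coef0. Qed.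

Lemma coef_map_coef1 P i : (map_poly coef1fun P)`_i = (P`_i)`_1.
Proof. by rewrite (coef_map_id0 P i coef1fun0). Qed.

Lemma coef1M p q : (p * q)`_1 = p`_0 * q`_1 + p`_1 * q`_0.
Proof. by rewrite coefM !big_ord_recl big_ord0 addr0. Qed.

Lemma horner_poly_coef0 P x : (P.[x])`_0 = P^0.[x`_0].
Proof. by rewrite -!horner_coef0 -[LHS]/(horner_eval 0 _) -horner_map. Qed.

(** Modulo [u^2], [P = P0 + c u], and Taylor expansion of [P0] at the constant term of [x] gives the
    coefficient of [u]. *)
Lemma horner_coef1 P x c : (forall i, (P`_i)`_1 = if i == 0%N then c else 0) ->
  (P.[x])`_1 = c + (P^0)^`().[x`_0] * x`_1.
Proof.
move=> HP.
have -> : (P.[x])`_1 = (map_poly coef1fun P).[x`_0] + (P^0)^`().[x`_0] * x`_1.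
  elim/poly_ind: P {HP} => [|P a IH]; first by rewrite horner0 coef0 !map_poly0 deriv0 !horner0 mul0r addr0.
  rewrite hornerMXaddC coefD coef1M IH horner_poly_coef0.
  rewrite rmorphD rmorphM /= map_polyX map_polyC derivD derivM derivX derivC addr0 mulr1.
  rewrite !hornerE /=.
  have -> : map_poly coef1fun (P * 'X + a%:P) = map_poly coef1fun P * 'X + (a`_1)%:P.
    apply/polyP => -[|i]; rewrite coef_map_coef1 !coefD !coefC !coefMX /=.
      by rewrite ?coef0 !add0r.
    by rewrite ?coef0 !addr0 coef_map_coef1.
  by rewrite !hornerE /=; ring.
congr (_ + _); rewrite -[RHS](hornerC c x`_0); congr (_.[_]); apply/polyP => i.
by rewrite coef_map_coef1 HP coefC.
Qed.

Definition flat x := x`_1 = 0.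

Lemma flat_prod_coef (cs : seq {poly F}) : {in cs, forall c, flat c} ->
  forall i, flat (\prod_(c <- cs) ('X - c%:P))`_i.
Proof.
elim: cs => [|c cs IH] Hc i; rewrite /flat.
  by rewrite big_nil coef1; case: (i == 0)%N; rewrite ?coef1 ?coef0.
rewrite big_cons mulrBl !coefB coefXM coefCM coef1M (Hc c) ?mem_head //.
have IH' j : (\prod_(j <- cs) ('X - j%:P))`_j`_1 = 0.
  by apply: IH => y cy; apply: Hc; rewrite inE cy orbT.
by rewrite IH' mulr0 mul0r addr0 subr0; case: i => [|i] /=; rewrite ?coef0 ?IH'.
Qed.

End FirstOrder.

(** * Curves with a prescribed centre *)

Section Centers.

Variables (K : fieldExtType rat) (d : nat).
Hypothesis d_gt1 : (1 < d)%N.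
Variables (F : closedFieldType) (theta : {rmorphism Kst K d -> F}).
Local Notation f := (generic_poly K d).

Definition is_curve (g : {poly {poly F}}) (t : {poly F}) : Prop :=
  [/\ g \is monic, size g = d,
    map_poly (horner_eval 1) (d%:R *: g) = map_poly theta f^`() & t.[1] = theta f`_0].

Lemma generic_crit : exists v : seq F,
  size v = d.-1 /\ map_poly theta f^`() = d%:R *: \prod_(c <- v) ('X - c%:P).
Proof.
have [mf sf] := generic_monic K d_gt1.
have F0 := F_char0 theta; have d0 : (d%:R : F) != 0 by rewrite (pcharf0P _).1 // -lt0n ltnW.
have [v Ev] := closed_field_poly_normal (map_poly theta f^`()).
have lc : (f^`())`_d.-1 = d%:R.
  by rewrite coef_deriv prednK ?(ltnW d_gt1) // (coef_generic_lead K d_gt1).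
have sz : size f^`() = d.
  apply/eqP; rewrite eqn_leq -ltnS -{1}sf lt_size_deriv ?monic_neq0 //.
  rewrite -{1}[d]prednK ?(ltnW d_gt1) // ltnNge; apply/negP => le.
  move: lc; rewrite nth_default // => /esym/(congr1 theta); rewrite rmorph_nat rmorph0 => /eqP.
  by rewrite (negPf d0).
have lE : lead_coef (map_poly theta f^`()) = d%:R.
  by rewrite lead_coef_map lead_coefE sz lc rmorph_nat.
exists v; rewrite Ev lE; split=> //.
by apply/eqP; rewrite -eqSS prednK ?(ltnW d_gt1) // -(size_prod_XsubC v id)
  -(size_scale _ (_ : d%:R != 0)) // -lE -Ev size_map_poly sz.
Qed.

(* The [u^2] corrections move the prescribed centre to the generic polynomial at [u = 1]
   without disturbing it to first order. *)
Lemma crit_center (cb : seq F) (tb : F) : size cb = d.-1 ->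
  exists g t cs, [/\ is_curve g t, g = \prod_(c <- cs) ('X - c%:P),
    [seq c`_0 | c : {poly F} <- cs] = cb, {in cs, forall c, flat c} & t`_0 = tb /\ t`_1 = 1].
Proof.
move=> scb; have [v [sv Ev]] := generic_crit.
pose cs := [seq x.1%:P + 'X^2 * (x.2 - x.1)%:P | x <- zip cb v] : seq {poly F}.
pose tau := theta f`_0.
pose t : {poly F} := tb%:P + 'X + 'X^2 * (tau - tb - 1)%:P.
have szip : size (zip cb v) = d.-1 by rewrite size_zip scb sv minnn.
exists (\prod_(c <- cs) ('X - c%:P)), t, cs; split=> //.
- split; first exact: monic_prod_XsubC.
  + by rewrite (size_prod_XsubC _ id) size_map szip prednK // ltnW.
  + rewrite Ev map_polyZ rmorph_nat; congr (_ *: _).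
    rewrite rmorph_prod big_map -[X in _ = \prod_(c <- X) _](unzip2_zip (s := cb)); last first.
      by rewrite scb sv.
    rewrite big_map; apply: eq_bigr => x _; rewrite rmorphB /= map_polyX map_polyC.
    by congr (_ - _%:P); rewrite /= /horner_eval !hornerE; ring.
  by rewrite /t !hornerE -/tau; ring.
- rewrite -map_comp -[RHS](unzip1_zip (t := v)) ?scb ?sv //.
  by apply: eq_map => x /=; rewrite coefD coefC coefXnM addr0.
- by move=> _ /mapP [x _ ->]; rewrite /flat coefD coefC coefXnM addr0.
by rewrite /t !coefD !coefC !coefX !coefXnM !addr0 add0r.
Qed.

(** The curve is [gb + u + u^2 (G - gb - 1)], equal to [gb] at [u = 0] and to the generic [G] at
    [u = 1]. Its linear term makes [g(0)] vanish to order exactly one as soon as [gb(0) = 0]. In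
    [crit_center] it is [t] that moves to first order, while the critical points stay polynomials in
    [u]. *)
Lemma flat_center (gb : {poly F}) : gb \is monic -> size gb = d ->
  exists g t, [/\ is_curve g t, map_poly (horner_eval 0) g = gb & (g`_0)`_1 = 1].
Proof.
move=> mgb sgb; have [v [sv Ev]] := generic_crit.
pose G := \prod_(c <- v) ('X - c%:P).
have mG : G \is monic by apply: monic_prod_XsubC.
have sG : size G = d by rewrite (size_prod_XsubC _ id) sv prednK // ltnW.
pose r : {poly {poly F}} := ('X%:P + 'X^2 *: map_poly polyC (G - gb - 1)).
have sr : (size r < size (map_poly polyC gb))%N.
  rewrite (size_map_inj_poly (@polyC_inj _)) ?polyC0 // sgb.
  rewrite (leq_ltn_trans (size_polyD _ _)) // gtn_max (leq_ltn_trans (size_polyC_leq1 _)) //=.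
  rewrite (leq_ltn_trans (size_scale_leq _ _)) // (size_map_inj_poly (@polyC_inj _)) ?polyC0 //.
  rewrite (leq_ltn_trans (size_polyD _ _)) // gtn_max size_polyN size_poly1 d_gt1 andbT.
  have d1 : (d.-1 < d)%N by rewrite ltn_predL ltnW.
  apply: leq_ltn_trans d1; apply/leq_sizeP => j; rewrite leq_eqVlt => /orP [/eqP <-|].
    by rewrite coefB -{1}sG -sgb -!lead_coefE (monicP mG) (monicP mgb) subrr.
  by rewrite prednK ?(ltnW d_gt1) // => le; rewrite coefB !nth_default ?subrr ?sG ?sgb.
exists (map_poly polyC gb + r), (theta f`_0)%:P; split.
- split; last by rewrite hornerC.
  + by rewrite monicE lead_coefDl // -monicE monic_map.
  + by rewrite size_polyDl // (size_map_inj_poly (@polyC_inj _)) ?polyC0.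
  rewrite Ev map_polyZ rmorph_nat; congr (_ *: _); apply/polyP => i.
  rewrite coef_map /r !coefD coefZ !coef_map_id0 ?polyC0 // coefC !coefB coef1 /= /horner_eval.
  by case: i => [|i] /=; rewrite ?(hornerD, hornerM, hornerC, hornerX, hornerXn, horner0); ring.
- apply/polyP => i; rewrite coef_map /r !coefD coefZ !coef_map_id0 ?polyC0 // coefC /= /horner_eval.
  by case: i => [|i] /=; rewrite ?(hornerD, hornerM, hornerC, hornerX, hornerXn, horner0); ring.
rewrite /r !coefD coefZ !coef_map_id0 ?polyC0 // coefC /= coefD coefC.
by rewrite coefX coefXnM addr0 add0r.
Qed.

Lemma curve_poly_coef1 (g : {poly {poly F}}) (cs : seq {poly F}) (t : {poly F}) :
  g = \prod_(c <- cs) ('X - c%:P) -> {in cs, forall c, flat c} -> t`_1 = 1 ->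
  forall i, ((curve_poly d g t)`_i)`_1 = if i == 0%N then 1 else 0.
Proof.
move=> Eg fcs t1 [|i]; first by rewrite curve_poly0.
rewrite coef_poly; case: ifP => _; last by rewrite coef0.
by rewrite coefCM Eg flat_prod_coef ?mulr0.
Qed.

Lemma curve_poly_center (g : {poly {poly F}}) (t : {poly F}) : size g = d ->
  (map_poly (horner_eval 0) (curve_poly d g t))^`() =
    d%:R *: map_poly (horner_eval 0) g /\
  (map_poly (horner_eval 0) (curve_poly d g t))`_0 = t`_0.
Proof.
move=> sg; split.
  by rewrite deriv_map (deriv_curve_poly theta _ sg) // map_polyZ rmorph_nat.
by rewrite coef_map curve_poly0 /= /horner_eval horner_coef0.
Qed.

End Centers.

(** * The tree of preimages *)

Lemma comp_iter_poly (A : fieldType) (p q : {poly A}) n :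
  p \Po iter_poly q n = iter n (fun r => r \Po q) p.
Proof.
rewrite /iter_poly; elim: n p => [|n IH] p /=; first by rewrite comp_polyXr.
by rewrite comp_polyA IH -iterSr.
Qed.

Lemma horner_iter_comp (A : comNzRingType) (p q : {poly A}) n x :
  (iter n (fun r => r \Po q) p).[x] = p.[iter n (fun y => q.[y]) x].
Proof. by elim: n x => //= n IH x; rewrite horner_comp IH -iterSr. Qed.

Lemma map_iter_comp (A B : comNzRingType) (h : {rmorphism A -> B}) (p q : {poly A}) n :
  map_poly h (iter n (fun r => r \Po q) p) =
  iter n (fun r => r \Po map_poly h q) (map_poly h p).
Proof. by elim: n => //= n <-; rewrite map_comp_poly. Qed.

Lemma closed_iter_root (O : closedFieldType) (p : {poly O}) n y :
  (1 < size p)%N -> exists z, iter n (fun y => p.[y]) z = y.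
Proof.
move=> sp; elim: n y => [|n IH] y; first by exists y.
have /closed_rootP [w rw] : size (p - y%:P) != 1%N.
  by rewrite size_polyDl ?size_polyN ?(leq_ltn_trans (size_polyC_leq1 _)) // gtn_eqF.
have [z Ez] := IH w; exists z; rewrite iterS Ez.
by apply/eqP; rewrite -subr_eq0; move: rw; rewrite /root hornerD hornerN hornerC.
Qed.

Lemma prod_XsubC_perm (A : idomainType) (s t : seq A) :
  \prod_(x <- s) ('X - x%:P) = \prod_(x <- t) ('X - x%:P) -> perm_eq s t.
Proof.
elim: s t => [|x s IH] t Est.
  have := size_prod_XsubC t id; rewrite -Est big_nil size_poly1 => -[].
  by case: t {Est}.
have xt : x \in t by rewrite -root_prod_XsubC -Est root_prod_XsubC mem_head.
rewrite perm_sym (perm_trans (perm_to_rem xt)) // perm_cons perm_sym; apply: IH.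
apply: (mulfI (negbT (polyXsubC_eq0 x))).
by move: Est; rewrite big_cons (big_rem x xt).
Qed.

Section Levels.

Variables (K : fieldExtType rat) (d : nat).
Hypothesis d_gt1 : (1 < d)%N.
Variables (F O : closedFieldType) (theta : {rmorphism Kst K d -> F}).
Variable (iota : {rmorphism {poly F} -> O}).
Hypothesis iota_inj : injective iota.
Local Notation f := (generic_poly K d).
Variables (L : splittingFieldType (Kst K d)) (E : {subfield L}) (n : nat) (rs : seq L).
Hypothesis rsP : map_poly (in_alg L) (f^`() \Po iter_poly f n) %= \prod_(x <- rs) ('X - x%:P).
Hypothesis rsE : <<1 & rs>>%VS = E.

Definition fL := map_poly (in_alg L) f.
Definition f_ (x : L) := fL.[x].
Definition gL := d%:R^-1 *: fL^`().
Definition level_poly k := iter k (fun q => q \Po fL) gL.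
(* For [k <= n] these are the roots of [f' o f^k], see [level_root]. *)
Definition level k := undup [seq iter (n - k) f_ x | x <- rs].

Local Notation T := level.

Lemma F_pchar0 : [pchar F] =i pred0. Proof. exact: (F_char0 theta). Qed.

Lemma L_pchar0 : [pchar L] =i pred0.
Proof. by move=> p; rewrite (fmorph_pchar (in_alg L)) Kst_char0. Qed.

Lemma dL_neq0 : (d%:R : L) != 0.
Proof. by rewrite (pcharf0P _).1 ?gtn_eqF // ?(ltnW d_gt1) //; exact: L_pchar0. Qed.

Lemma dF_neq0 : (d%:R : F) != 0.
Proof. by rewrite (pcharf0P _).1 ?gtn_eqF // ?(ltnW d_gt1) //; exact: F_pchar0. Qed.

Lemma fL_monic : fL \is monic /\ size fL = d.+1.
Proof.
have [mf sf] := generic_monic K d_gt1.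
by rewrite /fL monic_map // size_map_poly sf.
Qed.

Lemma gL_fL : fL^`() = d%:R *: gL.
Proof. by rewrite /gL scalerA divff ?scale1r // dL_neq0. Qed.

Section CurveHom.

Variables (g : {poly {poly F}}) (t : {poly F}).
Hypothesis g_curve : is_curve theta g t.
Local Notation fu := (curve_poly d g t).
Variable h : {rmorphism L -> O}.
Hypothesis hf : map_poly h fL = map_poly iota fu.

Lemma hom_gL : map_poly h gL = map_poly iota g.
Proof.
have [_ sg _ _] := g_curve.
have dO : (d%:R : O) != 0 by rewrite -(rmorph_nat h) fmorph_eq0 dL_neq0.
apply: (scalerI dO); rewrite -{1}(rmorph_nat h) -map_polyZ -gL_fL -deriv_map hf.
by rewrite deriv_map (deriv_curve_poly theta _ sg) // map_polyZ rmorph_nat.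
Qed.

Lemma hom_f_ x : h (f_ x) = (map_poly iota fu).[h x].
Proof. by rewrite /f_ -hf horner_map. Qed.

Lemma hom_iter k x : h (iter k f_ x) = iter k (fun y => (map_poly iota fu).[y]) (h x).
Proof. by elim: k => //= k IH; rewrite hom_f_ IH. Qed.

(** [rs] describes level [n]: [y] is lifted there by [n - k] preimages in the closed field [O],
    matched with an element of [rs], and brought back by [f_]. *)
Lemma root_lift k y : (k <= n)%N ->
  root (map_poly iota g) (iter k (fun y => (map_poly iota fu).[y]) y) ->
  exists2 x, x \in T k & y = h x.
Proof.
move=> kn ry; have [mg sg _ _] := g_curve.
have sfu : (1 < size (map_poly iota fu))%N.
  by rewrite -hf size_map_poly fL_monic.2 ltnS ltnW.
have [z Ez] := closed_iter_root (n - k) y sfu.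
have rz : root (map_poly h (map_poly (in_alg L) (f^`() \Po iter_poly f n))) z.
  rewrite comp_iter_poly map_iter_comp -/fL map_iter_comp hf.
  rewrite /root horner_iter_comp -deriv_map -/fL gL_fL map_polyZ hom_gL.
  rewrite hornerZ -[n in iter n](subnKC kn) iterD Ez.
  by rewrite (rootP ry) mulr0.
have := rsP; rewrite -(eqp_map h) => /eqp_root E1.
move: rz; rewrite E1 rmorph_prod /root horner_prod prodf_seq_eq0 => /hasP [x rx /=].
rewrite rmorphB /= map_polyX map_polyC hornerXsubC subr_eq0 => /eqP Ezx.
exists (iter (n - k) f_ x); last by rewrite hom_iter -Ezx Ez.
by rewrite mem_undup map_f.
Qed.

End CurveHom.

Lemma curve_L g t : is_curve theta g t -> exists h : {rmorphism L -> O},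
  map_poly h fL = map_poly iota (curve_poly d g t) /\
  forall a : Kst K d, exists p q : {poly F}, q != 0 /\ h a%:A * iota q = iota p.
Proof. by case=> mg sg eg et; apply: (curve_hom d_gt1 (theta := theta)). Qed.

(** That a root comes from [rs] is seen in a closed field, where preimages exist; any curve supplies
    an embedding of [L] in one. *)
Lemma level_root k x : (k <= n)%N -> (x \in T k) = root (level_poly k) x.
Proof.
move=> kn; rewrite /root /level_poly horner_iter_comp -/f_; apply/idP/idP; last first.
  have [g [t [cs [gc _ _ _ _]]]] := crit_center d_gt1 theta 0 (size_nseq d.-1 0).
  have [h [hf _]] := curve_L gc => rx.
  have [|x' Tx' /fmorph_inj ->] := @root_lift _ _ gc _ hf k (h x) kn; last by [].
  by rewrite -(hom_iter hf) -(hom_gL gc hf) fmorph_root.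
rewrite mem_undup => /mapP [y ry ->]; rewrite -iterD subnKC //.
have : root (map_poly (in_alg L) (f^`() \Po iter_poly f n)) y.
  by rewrite (eqp_root rsP) root_prod_XsubC.
rewrite comp_iter_poly map_iter_comp -/fL /root horner_iter_comp -deriv_map -/fL gL_fL.
by rewrite hornerZ mulf_eq0 (negPf dL_neq0).
Qed.

Lemma natr_inj_char0 (A : fieldType) : [pchar A] =i pred0 -> injective (fun i : nat => i%:R : A).
Proof.
move=> A0 a b /eqP; wlog le_ab : a b / (a <= b)%N.
  by move=> W E1; case/orP: (leq_total a b) => /W; [|rewrite eq_sym in E1] => ->.
rewrite eq_sym -subr_eq0 -natrB // (pcharf0P _).1 // => E1.
by apply/eqP; rewrite eqn_leq le_ab -subn_eq0.
Qed.

(** Tested on a curve whose critical points take the distinct values [0, ..., d - 2] at [u = 0]. *)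
Lemma sep_gL : separable_poly gL.
Proof.
pose cb : seq F := mkseq (fun i => i%:R) d.-1.
have [g [t [cs [gc Eg Ecs _ _]]]] := crit_center d_gt1 theta 0 (size_mkseq _ _ : size cb = _).
have [h [hf _]] := curve_L gc.
rewrite -(separable_map h) (hom_gL gc hf) Eg map_prod_XsubC -(big_map iota xpredT (fun y => 'X - y%:P)).
rewrite separable_prod_XsubC map_inj_uniq //; apply: (map_uniq (f := fun c : {poly F} => c`_0)).
by rewrite Ecs mkseq_uniq //; apply: natr_inj_char0 F_pchar0.
Qed.

Lemma map0_center (g : {poly {poly F}}) (t : {poly F}) (fb : {poly F}) :
  size g = d -> fb`_0 = t`_0 -> fb^`() = d%:R *: map_poly (horner_eval 0) g ->
  map_poly (horner_eval 0) (curve_poly d g t) = fb.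
Proof.
move=> sg f0 f1; have [E1 E0] := curve_poly_center theta t sg.
by apply: deriv_inj_char0; [exact: F_pchar0 | rewrite E1 f1 | rewrite E0 f0].
Qed.

Section IterCoef.

Variables (fu : {poly {poly F}}) (fb : {poly F}).
Hypothesis fu1 : forall i, (fu`_i)`_1 = if i == 0%N then 1 else 0.
Hypothesis fu0 : map_poly (horner_eval 0) fu = fb.

Lemma iter_coef0 k (x : {poly F}) : (iter k (horner fu) x)`_0 = iter k (horner fb) x`_0.
Proof. by elim: k => //= k IH; rewrite horner_poly_coef0 fu0 IH. Qed.

Lemma iter_coef1S k (x : {poly F}) : (iter k.+1 (horner fu) x)`_1 =
  1 + fb^`().[iter k (horner fb) x`_0] * (iter k (horner fu) x)`_1.
Proof. by rewrite iterS (horner_coef1 _ fu1) fu0 iter_coef0. Qed.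

Lemma iota_iter k (x : {poly F}) :
  iter k (fun y => (map_poly iota fu).[y]) (iota x) = iota (iter k (horner fu) x).
Proof. by elim: k => //= k ->; rewrite horner_map. Qed.

End IterCoef.

(** On a curve with centre [X^d] the critical points are [0] modulo [u^2]. By the chain rule each
    positive iterate of a critical point has coefficient [1] at [u], since the derivative of the
    centre vanishes at [0]; hence it is not critical. *)
Lemma iter_notin_level0 c j : root gL c -> ~~ root gL (iter j.+1 f_ c).
Proof.
move=> rc; have [g [t [cs [gc Eg Ecs fcs [t0 t1]]]]] :=
  crit_center d_gt1 theta 0 (size_nseq d.-1 0).
have [mg sg _ _] := gc; have [h [hf _]] := curve_L gc.
have cs_root y : root (map_poly iota g) y -> exists2 x, x \in cs & y = iota x.
  rewrite Eg map_prod_XsubC -(big_map iota xpredT (fun y => 'X - y%:P)).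
  by rewrite root_prod_XsubC => /mapP.
have [x xcs Ex] : exists2 x, x \in cs & h c = iota x.
  by apply: cs_root; rewrite -(hom_gL gc hf) fmorph_root.
have cs0 y : y \in cs -> y`_0 = 0.
  by move=> ycs; have := map_f (fun c : {poly F} => c`_0) ycs; rewrite Ecs => /nseqP [].
have fu0 : map_poly (horner_eval 0) (curve_poly d g t) = 'X^d.
  apply: map0_center => //; first by rewrite t0 coefXn eq_sym gtn_eqF // ltnW.
  rewrite derivXn -scaler_nat; congr (_ *: _).
  rewrite Eg map_prod_XsubC (eq_big_seq (fun _ => 'X)); last first.
    by move=> y /cs0 y0; rewrite /= /horner_eval horner_coef0 y0 subr0.
  by rewrite big_const_seq count_predT -(size_map (fun c : {poly F} => c`_0)) Ecs size_nseq
    -Monoid.iteropE -?/('X ^+ _).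
have fu1 := curve_poly_coef1 d Eg fcs t1.
apply/negP => rj.
have [y ycs] : exists2 y, y \in cs & h (iter j.+1 f_ c) = iota y.
  by apply: cs_root; rewrite -(hom_gL gc hf) fmorph_root.
rewrite (hom_iter hf) Ex iota_iter => /iota_inj /(congr1 (fun p : {poly F} => p`_1)).
rewrite (iter_coef1S fu1 fu0) (fcs y ycs) (cs0 x xcs).
have -> : iter j (horner 'X^d) 0 = 0 :> F.
  by elim: (j) => //= i ->; rewrite hornerXn expr0n gtn_eqF // ltnW.
have dp : (0 < d.-1)%N by lia.
rewrite derivXn hornerMn hornerXn expr0n gtn_eqF //.
by rewrite mul0rn mul0r addr0 => /eqP; rewrite oner_eq0.
Qed.

Lemma level_sub k x : x \in T k -> x \in E.
Proof.
rewrite mem_undup => /mapP [y ry ->]; rewrite -rsE.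
have : y \in <<1 & rs>>%VS by apply: seqv_sub_adjoin.
elim: (n - k)%N => //= j IH Ey; rewrite /f_ rpred_horner ?IH // /fL.
apply/polyOverP => i; rewrite coef_map; apply: rpredZ; exact: rpred1.
Qed.

(** A multiple root would be a critical point [c] with [f_ c = a], so that the iterate of [c] of
    order [k.+1] would be critical too. *)
Lemma fL_sub_root_simple k a : (k < n)%N -> a \in T k -> separable_poly (fL - a%:P).
Proof.
move=> kn Ta; have [g [t [cs [gc _ _ _ _]]]] := crit_center d_gt1 theta 0 (size_nseq d.-1 0).
have [h [hf _]] := curve_L gc.
rewrite -(separable_map h) unlock; apply/coprimepP => q dq dq'.
rewrite -size_poly_eq1; apply/negPn/negP => /closed_rootP [y ry].
have /rootP ra := root_dvdp dq ry.
have rg : root (map_poly iota g) y.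
  have := root_dvdp dq' ry; rewrite deriv_map derivB derivC subr0 gL_fL map_polyZ (hom_gL gc hf).
  by rewrite rootZ // rmorph_nat -(rmorph_nat h) fmorph_eq0 dL_neq0.
have [c Tc Ey] := root_lift gc hf (leq0n n) rg.
have rc : root gL c by rewrite -(level_root _ (leq0n n)).
have Efc : f_ c = a.
  apply: (fmorph_inj h); apply/eqP; rewrite -subr_eq0 -ra Ey.
  by rewrite rmorphB /= map_polyC hornerD hornerN hornerC (hom_f_ hf) hf.
move: Ta; rewrite level_root 1?ltnW // /root /level_poly horner_iter_comp -/f_ -Efc -iterSr.
by apply/negP; exact: (iter_notin_level0 k rc).
Qed.

Definition fiber k a := [seq x <- T k.+1 | f_ x == a].

Lemma fiberP k a : (k < n)%N -> a \in T k ->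
  \prod_(x <- fiber k a) ('X - x%:P) = fL - a%:P.
Proof.
move=> kn Ta; have [g [t [cs [gc _ _ _ _]]]] := crit_center d_gt1 theta 0 (size_nseq d.-1 0).
have [h [hf _]] := curve_L gc.
apply: (map_poly_inj h); rewrite map_prod_XsubC -(big_map h xpredT (fun y => 'X - y%:P)).
have mfa : fL - a%:P \is monic.
  rewrite monicE lead_coefDl -?monicE ?fL_monic.1 // size_polyN fL_monic.2.
  by rewrite (leq_ltn_trans (size_polyC_leq1 _)) // ltnS ltnW.
have [r Er] := closed_field_poly_normal (map_poly h (fL - a%:P)).
rewrite (monicP (monic_map h mfa)) scale1r in Er.
rewrite Er; apply: perm_big; apply: uniq_perm.
- by rewrite map_inj_uniq; [apply/filter_uniq/undup_uniq | apply: fmorph_inj].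
- by rewrite -separable_prod_XsubC -Er separable_map (fL_sub_root_simple kn Ta).
move=> y; rewrite -[in RHS]root_prod_XsubC -Er; apply/mapP/idP => [[x]|ry].
  rewrite mem_filter => /andP [/eqP fx _] ->.
  by rewrite fmorph_root /root hornerD hornerN hornerC -/(f_ x) fx subrr.
have ha : (map_poly iota (curve_poly d g t)).[y] = h a.
  apply/eqP; rewrite -subr_eq0 -hf; move: ry.
  by rewrite /root rmorphB /= map_polyC hornerD hornerN hornerC.
have [|x Tx Ey] := @root_lift g t gc h hf k.+1 y kn.
  rewrite iterSr ha -(hom_iter hf) -(hom_gL gc hf) fmorph_root.
  by move: Ta; rewrite level_root 1?ltnW // /root /level_poly horner_iter_comp.
exists x => //; rewrite mem_filter Tx andbT; apply/eqP/(fmorph_inj h).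
by rewrite (hom_f_ hf) -Ey ha.
Qed.

Lemma level0P : \prod_(x <- T 0) ('X - x%:P) = gL.
Proof.
have [g [t [cs [gc _ _ _ _]]]] := crit_center d_gt1 theta 0 (size_nseq d.-1 0).
have [mg _ _ _] := gc; have [h [hf _]] := curve_L gc.
apply: (map_poly_inj h); rewrite map_prod_XsubC -(big_map h xpredT (fun y => 'X - y%:P)).
have [r Er] := closed_field_poly_normal (map_poly h gL).
have mg' : map_poly h gL \is monic by rewrite (hom_gL gc hf) monic_map.
rewrite (monicP mg') scale1r in Er.
rewrite Er; apply: perm_big; apply: uniq_perm.
- by rewrite map_inj_uniq; [apply: undup_uniq | apply: fmorph_inj].
- by rewrite -separable_prod_XsubC -Er separable_map sep_gL.
move=> y; rewrite -[in RHS]root_prod_XsubC -Er; apply/mapP/idP => [[x Tx ->]|].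
  by rewrite fmorph_root -(level_root x (leq0n n)).
by rewrite (hom_gL gc hf) => ry; have [x Tx ->] := root_lift gc hf (leq0n n) ry; exists x.
Qed.

Lemma size_level0 : size (T 0) = d.-1.
Proof.
have [g [t [cs [gc _ _ _ _]]]] := crit_center d_gt1 theta 0 (size_nseq d.-1 0).
have [_ sg _ _] := gc; have [h [hf _]] := curve_L gc.
apply/eqP; rewrite -eqSS -(size_prod_XsubC _ id) level0P -(size_map_poly h) (hom_gL gc hf).
by rewrite (size_map_inj_poly iota_inj) ?rmorph0 // sg prednK // ltnW.
Qed.

Lemma size_fiber k a : (k < n)%N -> a \in T k -> size (fiber k a) = d.
Proof.
move=> kn Ta; apply/eqP; rewrite -eqSS -(size_prod_XsubC _ id) fiberP //.
rewrite size_polyDl ?fL_monic.2 // size_polyN (leq_ltn_trans (size_polyC_leq1 _)) //.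
by rewrite ltnS ltnW.
Qed.

Lemma level_f_ k x : (k < n)%N -> x \in T k.+1 -> f_ x \in T k.
Proof. by move=> kn; rewrite (level_root _ kn) (level_root _ (ltnW kn)) /root /level_poly !horner_iter_comp -iterSr. Qed.

Lemma level_iter k x : (k <= n)%N -> x \in T k -> iter k f_ x \in T 0.
Proof. by move=> kn; rewrite !level_root // /root /level_poly !horner_iter_comp. Qed.

Definition tree k c := [seq x <- T k | iter k f_ x == c].

Lemma treeP k c : (k <= n)%N -> c \in T 0 ->
  \prod_(x <- tree k c) ('X - x%:P) = iter k (fun q => q \Po fL) ('X - c%:P).
Proof.
elim: k => [|k IH] kn Tc.
  rewrite /tree /= -(eq_filter (a1 := pred1 c)) //.
  by rewrite filter_pred1_uniq ?undup_uniq // big_seq1.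
rewrite iterS -(IH (ltnW kn) Tc); transitivity (\prod_(a <- tree k c) (fL - a%:P)); last first.
  rewrite rmorph_prod; apply: eq_bigr => a _.
  by rewrite /= comp_polyB comp_polyX comp_polyC.
rewrite [RHS](eq_big_seq (fun a => \prod_(x <- fiber k a) ('X - x%:P))); last first.
  by move=> a; rewrite mem_filter => /andP [_ Ta]; rewrite fiberP.
under [RHS]eq_bigr => a _ do rewrite /fiber big_filter.
rewrite (exchange_big_dep xpredT) //= /tree big_filter [LHS]big_mkcond /=.
apply: eq_big_seq => x Tx.
rewrite -iterS iterSr -[RHS]big_filter (eq_filter (a2 := pred1 (f_ x))); last first.
  by move=> a /=; rewrite eq_sym.
case: eqP => [E1|E1].
  rewrite filter_pred1_uniq ?big_seq1 ?filter_uniq ?undup_uniq //.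
  by rewrite mem_filter E1 eqxx level_f_.
rewrite (_ : [seq a <- _ | _] = [::]) ?big_nil //; apply/eqP; rewrite -size_eq0.
rewrite size_filter -leqn0 leqNgt -has_count; apply/hasP => -[a].
by rewrite mem_filter => /andP [/eqP ia _] /eqP Ea; apply: E1; rewrite -Ea.
Qed.

(** With [a] in level 0, this is the product to which [inertia_transitive] is applied. *)
Lemma horner_tree k c a : (k <= n)%N -> c \in T 0 ->
  \prod_(x <- tree k c) (a - x) = iter k f_ a - c.
Proof.
move=> kn Tc; have := congr1 (horner^~ a) (treeP kn Tc).
rewrite horner_prod horner_iter_comp hornerXsubC => <-.
by apply: eq_bigr => x _; rewrite hornerXsubC.
Qed.

End Levels.

Lemma place_horner_map (F O : closedFieldType) (iota : {rmorphism {poly F} -> O}) S phi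
    (P : {poly {poly F}}) y : is_place iota S phi -> S y ->
  S (map_poly iota P).[y] /\ phi (map_poly iota P).[y] = (map_poly (horner_eval 0) P).[phi y].
Proof.
move=> plS Sy; elim/poly_ind: P => [|P a [IHS IH]].
  by rewrite !map_poly0 !horner0; apply: (place0 plS).
rewrite !rmorphD !rmorphM /= !map_polyX !map_polyC !hornerMXaddC.
have SM := place_mul plS IHS Sy; have Sa := place_iota plS a.
by rewrite (place_add plS SM.1 Sa).2 SM.2 IH (place_iotaE plS); split=> //;
  apply: (place_add plS SM.1 Sa).1.
Qed.

(** * Galois elements from specializations *)

Section Specializations.

Variables (K : fieldExtType rat) (d : nat).
Hypothesis d_gt1 : (1 < d)%N.
Variables (F O : closedFieldType) (theta : {rmorphism Kst K d -> F}).
Variable (iota : {rmorphism {poly F} -> O}).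
Hypothesis iota_inj : injective iota.
Local Notation f := (generic_poly K d).
Variables (L : splittingFieldType (Kst K d)) (E : {subfield L}) (n : nat) (rs : seq L).
Hypothesis rsP : map_poly (in_alg L) (f^`() \Po iter_poly f n) %= \prod_(x <- rs) ('X - x%:P).
Hypothesis rsE : <<1 & rs>>%VS = E.

Local Notation T := (level n rs).
Local Notation fL := (fL L).
Local Notation gL := (gL L).
Local Notation f_ := (@f_ K d L).
Local Notation tree := (tree n rs).
Local Notation fiber := (fiber n rs).

Lemma galois_1E : galois 1%AS E.
Proof.
apply/and3P; split; first exact: sub1v.
  apply/separableP => x _; apply: pcharf0_separable; exact: L_pchar0.
apply/splitting_normalField; first exact: sub1v.
exists (map_poly (in_alg L) (f^`() \Po iter_poly f n)); first exact: alg_polyOver.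
by exists rs.
Qed.

Lemma map_gal_fL (g : gal_of E) : map_poly g fL = fL.
Proof.
rewrite /fL -map_poly_comp; apply: eq_map_poly => a /=.
by rewrite linearZ /= rmorph1.
Qed.

Lemma gal_f_ (g : gal_of E) x : g (f_ x) = f_ (g x).
Proof. by rewrite /f_ -horner_map /= map_gal_fL. Qed.

Lemma gal_iter (g : gal_of E) k x : g (iter k f_ x) = iter k f_ (g x).
Proof. by elim: k => //= k IH; rewrite gal_f_ IH. Qed.

Lemma gal_level (g : gal_of E) k x : (k <= n)%N -> x \in T k -> g x \in T k.
Proof.
move=> kn; rewrite !(level_root d_gt1 theta iota_inj rsP) // /root /level_poly !horner_iter_comp -/f_.
rewrite -gal_iter => /eqP gx; have <- : map_poly g gL = gL.
  by rewrite map_polyZ fmorphV rmorph_nat -deriv_map map_gal_fL.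
by rewrite [_.[_]]horner_map gx rmorph0.
Qed.

Lemma map_adjoin_frac (h : {rmorphism L -> O}) (M : {subfield L}) (cs : seq L) :
  let good z := exists p q : {poly F}, q != 0 /\ h z * iota q = iota p in
  (forall z, z \in M -> good z) -> (forall c, c \in cs -> good c) ->
  forall z, z \in <<M & cs>>%VS -> good z.
Proof.
move=> good; elim: cs M => [|c cs IH] M goodM goodcs z.
  by rewrite adjoin_nil subfield_closed; apply: goodM.
rewrite adjoin_cons; apply: (IH <<M; c>>%AS) => [{}z|c' cc']; last first.
  by apply: goodcs; rewrite inE cc' orbT.
have goodD x y : good x -> good y -> good (x + y).
  move=> [p [q [q0 E1]]] [p' [q' [q'0 E2]]]; exists (p * q' + p' * q), (q * q').
  by rewrite mulf_neq0 //; split=> //; rewrite rmorphD rmorphM rmorphD !rmorphM -E1 -E2; ring.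
have goodM' x y : good x -> good y -> good (x * y).
  move=> [p [q [q0 E1]]] [p' [q' [q'0 E2]]]; exists (p * p'), (q * q').
  by rewrite mulf_neq0 //; split=> //; rewrite !rmorphM -E1 -E2; ring.
case/Fadjoin_polyP => p Mp ->; have goodc := goodcs c (mem_head _ _).
elim/poly_ind: p Mp => [|p a IHp] Mp; first by rewrite horner0; apply/goodM/mem0v.
have Mpa i : (p * 'X + a%:P)`_i \in M by apply: (polyOverP Mp).
rewrite hornerMXaddC; apply: goodD; last first.
  by apply: goodM; have := Mpa 0%N; rewrite coefD coefMX coefC /= add0r.
apply: goodM' goodc; apply: IHp; apply/polyOverP => i.
by have := Mpa i.+1; rewrite coefD coefMX coefC /= addr0.
Qed.

Section Curve.

Variables (g : {poly {poly F}}) (t : {poly F}).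
Hypothesis g_curve : is_curve theta g t.
Local Notation fu := (curve_poly d g t).
Variable h : {rmorphism L -> O}.
Hypothesis hf : map_poly h fL = map_poly iota fu.

(** The place is built on the roots [rs] of level [n]; lower levels are their images under
    polynomials with coefficients in [iota F[u]]. *)
Lemma curve_place : exists S phi, is_place iota S phi /\
  forall k x, x \in T k -> S (h x).
Proof.
have [mg sg _ _] := g_curve.
pose P := iter n (fun q => q \Po fu) g.
have mP : level_poly L n \is monic.
  rewrite /level_poly; have mgL : gL \is monic.
    rewrite -(map_monic h) (hom_gL d_gt1 g_curve hf) monic_map //.
  have [mfL sfL] := fL_monic d_gt1 L.
  elim: (n) => [|k mk]; first exact: mgL.
  rewrite iterS monicE lead_coef_comp ?sfL ?ltnS ?(ltnW d_gt1) //.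
    by rewrite (monicP mk) (monicP mfL) expr1n mulr1.
have Ers : \prod_(x <- rs) ('X - x%:P) = level_poly L n.
  have : \prod_(x <- rs) ('X - x%:P) %= level_poly L n.
    move: rsP; rewrite comp_iter_poly map_iter_comp -/fL -deriv_map -/fL (gL_fL d_gt1).
    have -> : iter n (fun r => r \Po fL) (d%:R *: gL) = d%:R *: level_poly L n.
      by rewrite /level_poly; elim: (n) => //= j ->; rewrite comp_polyZ.
    rewrite eqp_sym => /eqp_trans; apply.
    exact: eqp_scale (dL_neq0 d_gt1 L).
  by rewrite eqp_monic ?monic_prod_XsubC // => /eqP.
have EP : \prod_(y <- [seq h x | x <- rs]) ('X - y%:P) = map_poly iota P.
  rewrite big_map -map_prod_XsubC Ers /level_poly /P !map_iter_comp hf.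
  by rewrite (hom_gL d_gt1 g_curve hf).
have [S [phi [plS Srs]]] := place_exists iota_inj (F_char0 theta) EP.
exists S, phi; split=> // k x; rewrite mem_undup => /mapP [y ry ->].
elim: (n - k)%N => [|j IH]; first by apply/Srs/map_f.
rewrite iterS (hom_f_ hf); apply: (place_horner plS) => // i.
by rewrite coef_map; apply: (place_iota plS).
Qed.

End Curve.

(** The base point is [a = 0]: the product of [h 0 - h x] over level 0 is [g(0)], whose coefficient
    of [u] is [1]. *)
Lemma flat_specialization (gb : {poly F}) : gb \is monic -> size gb = d -> gb.[0] = 0 ->
  exists phi : L -> F, \prod_(c <- T 0) ('X - (phi c)%:P) = gb /\
  {in T 0 &, forall y y', phi y = 0 -> phi y' = 0 -> exists2 s : gal_of E,
    s \in 'Gal(E / 1)%g & s y = y' /\ {in T 0, forall x, phi (s x) = phi x}}.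
Proof.
move=> mgb sgb gb0; have [g [t [gc Eg g1]]] := flat_center d_gt1 theta mgb sgb.
have [h [hf h1]] := curve_L d_gt1 iota_inj L gc.
have [S [phi [plS ST]]] := curve_place gc hf.
have hg' := hom_gL d_gt1 gc hf.
have T0P' := level0P d_gt1 theta iota_inj rsP.
exists (phi \o h); split.
  have E1 : \prod_(y <- [seq h x | x <- T 0]) ('X - y%:P) = map_poly iota g.
    by rewrite big_map -map_prod_XsubC T0P'.
  have := place_split plS _ E1; rewrite big_map Eg; apply.
  by move=> _ /mapP [x Tx ->]; apply: ST Tx.
have h1' z : z \in 1%AS -> exists p q : {poly F}, q != 0 /\ h z * iota q = iota p.
  by case/vlineP => a ->; apply: h1.
move=> y y' Ty Ty' py py'; have [S0 phi0] := place0 plS.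
have BT x : x \in T 0 -> inB E 1%AS h S x.
  by move=> Tx; split=> [|s _]; [exact: level_sub Tx | apply/ST/(gal_level s (leq0n n) Tx)].
have B0 : inB E 1%AS h S 0.
  split=> [|s _]; first exact: mem0v.
  rewrite (rmorph0 s) rmorph0; exact: S0.
have Eq : \prod_(x <- T 0) (h 0 - h x) = iota g`_0.
  have := congr1 (horner^~ (h 0)) hg'.
  rewrite -T0P' map_prod_XsubC horner_prod rmorph0 => E1.
  transitivity (map_poly iota g).[0]; last by rewrite horner_coef0 coef_map.
  by rewrite -E1; apply: eq_bigr => x _; rewrite hornerXsubC.
have q0 : (g`_0)`_0 = 0.
  transitivity gb.[0]; last exact: gb0.
  by rewrite -Eg [RHS]horner_coef0 coef_map /= /horner_eval horner_coef0.
have [||||||||s sI sy] := inertia_transitive iota_inj (F_char0 theta) galois_1E h1' plS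
    (T := T 0) _ _ _ (undup_uniq _) BT _ B0 _ Eq q0 _ Ty Ty'.
- by move=> x; apply: level_sub.
- by move=> x; apply: ST.
- by move=> s x _; apply: gal_level.
- by move=> s x _; apply: gal_level.
- by move=> s _; rewrite rmorph0.
- by rewrite g1 oner_eq0.
- by rewrite rmorph0 phi0.
- by rewrite rmorph0 phi0.
by exists s; case/inertiaP: sI.
Qed.

(* The coefficient of [u] in the [k]-th iterate of the critical point specializing to [a],
   see [iter_coef1S]. *)
Fixpoint orbit_order (fb : {poly F}) (a : F) (k : nat) : F :=
  if k is j.+1 then 1 + fb^`().[iter j (horner fb) a] * orbit_order fb a j else 0.

(** The Galois group is taken over [<<1 & T 0>>], whose image lies in [F(u)] because the critical
    points of the curve are polynomials in [u]. So [c] and [c'] are fixed, and the product of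
    [c' - z] over the tree above [c] becomes a polynomial in [u], with coefficient [orbit_order] at
    [u]. *)
Lemma crit_specialization (cb : seq F) (fb : {poly F}) : size cb = d.-1 ->
  fb^`() = d%:R *: \prod_(c <- cb) ('X - c%:P) ->
  exists phi : L -> F,
  [/\ perm_eq [seq phi c | c <- T 0] cb,
    (forall k x, (k < n)%N -> x \in T k.+1 -> phi (f_ x) = fb.[phi x]),
    (forall k a, (k < n)%N -> a \in T k ->
       \prod_(x <- fiber k a) ('X - (phi x)%:P) = fb - (phi a)%:P) &
    (forall k c c', (k <= n)%N -> c \in T 0 -> c' \in T 0 ->
       iter k (horner fb) (phi c') = phi c -> orbit_order fb (phi c') k != 0 ->
       {in tree k c &, forall y y', phi y = phi c' -> phi y' = phi c' ->
         exists2 s : gal_of E, s \in 'Gal(E / <<1 & T 0>>%AS)%g &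
           s y = y' /\ {in T k, forall x, phi (s x) = phi x}})].
Proof.
move=> scb dfb; have [g [t [cs [gc Eg Ecs fcs [t0 t1]]]]] := crit_center d_gt1 theta fb`_0 scb.
have [mg sg _ _] := gc; have [h [hf h1]] := curve_L d_gt1 iota_inj L gc.
have [S [phi [plS ST]]] := curve_place gc hf.
have hg' := hom_gL d_gt1 gc hf.
have T0P' := level0P d_gt1 theta iota_inj rsP.
have fu0 : map_poly (horner_eval 0) (curve_poly d g t) = fb.
  apply: (map0_center theta sg); first by rewrite t0.
  rewrite dfb Eg map_prod_XsubC -Ecs big_map; congr (_ *: _); apply: eq_bigr => c _.
  by rewrite /= /horner_eval horner_coef0.
have fu1 := curve_poly_coef1 d Eg fcs t1.
have hT0 : perm_eq [seq h c | c <- T 0] [seq iota c | c <- cs].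
  by apply: prod_XsubC_perm; rewrite !big_map -!map_prod_XsubC T0P' hg' Eg.
have hc c : c \in T 0 -> exists2 x, x \in cs & h c = iota x.
  by move=> Tc; apply/mapP; rewrite -(perm_mem hT0) map_f.
have phi_iota x : phi (iota x) = x`_0 by rewrite (place_iotaE plS) horner_coef0.
have phif k x : x \in T k -> phi (h (f_ x)) = fb.[phi (h x)].
  by move=> Tx; rewrite (hom_f_ hf) (place_horner_map _ plS (ST _ _ Tx)).2 fu0.
exists (phi \o h); split=> [|k x kn Tx|k a kn Ta|k c c' kn Tc Tc' Ek Dk y y' ty ty' py py'].
- have := perm_map phi hT0; rewrite -!map_comp.
  by rewrite (eq_map (f := phi \o iota) (g := fun c : {poly F} => c`_0) phi_iota) Ecs.
- exact: phif Tx.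
- have Sfib x : x \in fiber k a -> S (h x) by rewrite mem_filter => /andP [_ /ST].
  apply/polyP => m; have := place_poly_prod plS (fiber k a) (P := mem (fiber k a)) (f := h) Sfib m.
  rewrite -!big_seq -map_prod_XsubC (fiberP d_gt1 theta iota_inj rsP kn Ta) => -[_ <-].
  rewrite rmorphB /= map_polyC hf !coefB !coefC -fu0 !coef_map.
  case: m => [|m] /=; last by rewrite !subr0 (place_iotaE plS).
  by rewrite (place_sub plS (place_iota plS _) (ST _ _ Ta)).2 (place_iotaE plS).
have M0E : (<<1 & T 0>> <= E)%VS.
  by apply/Fadjoin_seqP; split=> [|x]; [exact: sub1v | apply: level_sub].
have galM : galois <<1 & T 0>>%AS E.
  by apply: galoisS galois_1E; rewrite sub1v M0E.
have fixT0 s c0 : s \in 'Gal(E / <<1 & T 0>>%AS)%g -> c0 \in T 0 -> s c0 = c0.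
  by move=> sG Tc0; apply: (fixed_gal M0E sG); apply: seqv_sub_adjoin.
have hM z : z \in <<1 & T 0>>%AS -> exists p q : {poly F}, q != 0 /\ h z * iota q = iota p.
  apply: map_adjoin_frac => [{}z /vlineP [b ->]|c0 /hc [x _ ->]]; first exact: h1.
  by exists x, 1; rewrite oner_neq0 rmorph1 mulr1.
have [x xcs Ex] := hc _ Tc; have [x' xcs' Ex'] := hc _ Tc'.
have Ephi : phi (h c') = x'`_0 by rewrite Ex' phi_iota.
rewrite /= Ephi Ex phi_iota in Ek Dk.
have BT z : z \in tree k c -> inB E <<1 & T 0>>%AS h S z.
  rewrite mem_filter => /andP [_ Tz].
  by split=> [|s _]; [exact: level_sub Tz | apply/ST/(gal_level s kn Tz)].
have Bc' : inB E <<1 & T 0>>%AS h S c'.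
  by split=> [|s sG]; [exact: level_sub Tc' | rewrite fixT0 //; apply: ST Tc'].
have Eq : \prod_(z <- tree k c) (h c' - h z) = iota (iter k (horner (curve_poly d g t)) x' - x).
  have := congr1 h (horner_tree d_gt1 theta iota_inj rsP c' kn Tc).
  rewrite rmorphB /= (hom_iter hf) Ex' iota_iter Ex -rmorphB => <-.
  by rewrite rmorph_prod; apply: eq_bigr => z _; rewrite rmorphB /= Ex'.
have q0 : (iter k (horner (curve_poly d g t)) x' - x)`_0 = 0.
  by rewrite coefB (iter_coef0 fu0) Ek subrr.
have q1 : (iter k (horner (curve_poly d g t)) x' - x)`_1 != 0.
  rewrite coefB (fcs _ xcs) subr0; suff -> : (iter k (horner (curve_poly d g t)) x')`_1 =
    orbit_order fb x'`_0 k by [].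
  elim: (k) => [|j IH]; first exact: fcs.
  by rewrite (iter_coef1S fu1 fu0) IH.
have [|||||||s sI sy] := inertia_transitive iota_inj (F_char0 theta) galM hM plS
    (T := T k) _ _ _ (filter_uniq _ (undup_uniq _)) BT _ Bc' _ Eq q0 q1 ty ty'.
- by move=> z; apply: level_sub.
- by move=> z; apply: ST.
- by move=> s z _; apply: gal_level.
- move=> s z sG; rewrite !mem_filter => /andP [/eqP iz Tz].
  by rewrite gal_level // andbT -gal_iter iz fixT0.
- by move=> s sG; apply: fixT0.
- exact: py.
- exact: py'.
by exists s; case/inertiaP: sI.
Qed.

End Specializations.

(** * Transitivity on levels and among siblings *)

Section Transpositions.

Variables (K : fieldExtType rat) (d : nat).
Hypothesis d_gt1 : (1 < d)%N.
Variables (F O : closedFieldType) (theta : {rmorphism Kst K d -> F}).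
Variable (iota : {rmorphism {poly F} -> O}).
Hypothesis iota_inj : injective iota.
Local Notation f := (generic_poly K d).
Variables (L : splittingFieldType (Kst K d)) (E : {subfield L}) (n : nat) (rs : seq L).
Hypothesis rsP : map_poly (in_alg L) (f^`() \Po iter_poly f n) %= \prod_(x <- rs) ('X - x%:P).
Hypothesis rsE : <<1 & rs>>%VS = E.

Local Notation T := (level n rs).
Local Notation f_ := (@f_ K d L).
Local Notation tree := (tree n rs).
Local Notation fiber := (fiber n rs).
Local Notation G := ('Gal(E / 1)%g).

Lemma fix_level0 (s : gal_of E) : s \in 'Gal(E / <<1 & T 0>>%AS)%g ->
  s \in G /\ {in T 0, forall c, s c = c}.
Proof.
have M0E : (<<1 & T 0>> <= E)%VS.
  by apply/Fadjoin_seqP; split=> [|x]; [exact: sub1v | exact: (level_sub rsE)].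
move=> sG; split; last by move=> c Tc; apply: (fixed_gal M0E sG); apply: seqv_sub_adjoin.
by apply: subsetP sG; apply/galS/sub1v.
Qed.

Lemma phi_iter (phi : L -> F) (fb : {poly F}) k x : (k <= n)%N ->
  (forall k x, (k < n)%N -> x \in T k.+1 -> phi (f_ x) = fb.[phi x]) ->
  x \in T k -> phi (iter k f_ x) = iter k (horner fb) (phi x).
Proof.
move=> + phif; elim: k x => // k IH x kn Tx.
rewrite iterSr IH ?(ltnW kn) //; first by rewrite (phif k) // -iterSr.
exact: (level_f_ d_gt1 theta iota_inj rsP).
Qed.

Lemma phi_fiber (phi : L -> F) (s : seq L) (r : seq F) :
  \prod_(x <- s) ('X - (phi x)%:P) = \prod_(z <- r) ('X - z%:P) ->
  perm_eq [seq phi x | x <- s] r.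
Proof. by move=> E1; apply: prod_XsubC_perm; rewrite big_map. Qed.

Lemma prod_nseq0 (A : comNzRingType) k : \prod_(c <- nseq k (0 : A)) ('X - c%:P) = 'X^k.
Proof. by rewrite big_nseq subr0 -Monoid.iteropE. Qed.

Lemma level0_transitive : {in T 0 &, forall x y, exists2 s : gal_of E, s \in G & s x = y}.
Proof.
move=> x y Tx Ty; have d_gt0 := ltnW d_gt1; have dp : (0 < d.-1)%N by lia.
have [||| phi [Ephi H]] := @flat_specialization K d d_gt1 F O theta iota iota_inj L E n rs
  rsP rsE 'X^(d.-1).
- exact: monicXn.
- by rewrite size_polyXn prednK.
- by rewrite hornerXn expr0n gtn_eqF.
have phi0 z : z \in T 0 -> phi z = 0.
  move=> Tz; have : perm_eq [seq phi x | x <- T 0] (nseq d.-1 0).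
    by apply: phi_fiber; rewrite Ephi prod_nseq0.
  by move/perm_mem/(_ (phi z)); rewrite map_f // => /esym/nseqP [].
by have [s sG [sx _]] := H x y Tx Ty (phi0 _ Tx) (phi0 _ Ty); exists s.
Qed.

(** [0] is its own only iterated preimage under [X^d], so the whole tree above [c] takes a single
    value and inertia is transitive on it. *)
Lemma tree_transitive k c : (k < n)%N -> c \in T 0 ->
  {in tree k.+1 c &, forall x y, exists2 s : gal_of E, s \in G & s x = y}.
Proof.
move=> kn Tc x y tx ty; have d_gt0 := ltnW d_gt1; have dp : (0 < d.-1)%N by lia.
have [||phi [pT0 phif _ H]] := @crit_specialization K d d_gt1 F O theta iota iota_inj L E n rs
  rsP rsE (nseq d.-1 0) 'X^d; first exact: size_nseq.
  by rewrite derivXn prod_nseq0 scaler_nat.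
have phi0 z : z \in T 0 -> phi z = 0.
  by move=> Tz; move/perm_mem/(_ (phi z)): pT0; rewrite map_f // => /esym/nseqP [].
have it0 j : iter j (horner 'X^d) 0 = 0 :> F.
  by elim: j => //= i ->; rewrite hornerXn expr0n gtn_eqF.
have it_eq0 j (z : F) : iter j (horner 'X^d) z = 0 -> z = 0.
  by elim: j => //= j IH /eqP; rewrite hornerXn expf_eq0 => /andP [_ /eqP /IH].
have tree0 z : z \in tree k.+1 c -> phi z = phi c.
  rewrite mem_filter => /andP [/eqP iz Tz]; rewrite (phi0 c Tc); apply: (it_eq0 k.+1).
  by rewrite -phi_iter // iz phi0.
have [||s sG [sx _]] := H k.+1 c c kn Tc Tc _ _ x y tx ty (tree0 _ tx) (tree0 _ ty).
- by rewrite phi0 // it0.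
- by rewrite phi0 //= it0 derivXn hornerMn hornerXn expr0n gtn_eqF // mul0rn mul0r addr0 oner_eq0.
by exists s => //; case/fix_level0: sG.
Qed.

Lemma level_transitive k : (k <= n)%N ->
  {in T k &, forall x y, exists2 s : gal_of E, s \in G & s x = y}.
Proof.
case: k => [|k] kn x y Tx Ty; first exact: level0_transitive.
have TI := level_iter d_gt1 theta iota_inj rsP kn.
have [s sG Es] := level0_transitive (TI _ Tx) (TI _ Ty).
have [||s' s'G Es'] := @tree_transitive k _ kn (TI _ Ty) (s x) y.
- by rewrite mem_filter -(gal_iter s) Es eqxx (gal_level d_gt1 theta iota_inj rsP).
- by rewrite mem_filter eqxx.
exists (s * s')%g; first exact: groupM.
by rewrite galM ?(level_sub rsE Tx).
Qed.

(* The nodes of level 0 are all children of the root. *)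
Definition siblings k (x y : L) := (k == 0%N) || (f_ x == f_ y).

Local Notation sib := siblings.

Lemma sib_gal k (s : gal_of E) x y : sib k x y -> sib k (s x) (s y).
Proof.
by case/orP => [/eqP ->|/eqP E1] //; apply/orP; right; rewrite -!gal_f_ E1.
Qed.

Lemma perm_lone (phi : L -> F) (s : seq L) m : uniq s ->
  perm_eq [seq phi x | x <- s] (1 :: nseq m 0) ->
  exists2 x0, x0 \in s & phi x0 = 1 /\ {in s, forall y, y != x0 -> phi y = 0}.
Proof.
move=> us ps; have /mapP [x0 sx0 E1] : 1 \in [seq phi x | x <- s].
  by rewrite (perm_mem ps) mem_head.
exists x0 => //; split=> // y sy ny.
move: ps; rewrite (permPl (perm_map phi (perm_to_rem sx0))) /= -E1 perm_cons.
move/perm_mem/(_ (phi y)); rewrite map_f; last by rewrite mem_rem_uniq // inE ny.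
by move/esym/nseqP => [].
Qed.

Lemma level_nonempty k : (k <= n)%N -> exists x, x \in T k.
Proof.
elim: k => [|k IH] kn.
  have := size_level0 d_gt1 theta iota_inj rsP; case: (T 0) => [|x s] /=; first by lia.
  by exists x; rewrite mem_head.
have [a Ta] := IH (ltnW kn).
have := size_fiber d_gt1 theta iota_inj rsP kn Ta; case E1: (fiber k a) => [|x s] /=; first by lia.
by exists x; have : x \in fiber k a by [rewrite E1 mem_head]; rewrite mem_filter => /andP [].
Qed.

Lemma sib_unique : d = 2%N -> forall k x0 y y', (k <= n)%N ->
  x0 \in T k -> y \in T k -> y' \in T k -> sib k x0 y -> sib k x0 y' ->
  y != x0 -> y' != x0 -> y = y'.
Proof.
move=> d2 k x0 y y' kn T0 Ty Ty' sy sy' ny ny'; apply/eqP/negPn/negP => nyy'.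
have us : uniq [:: x0; y; y'] by rewrite /= !inE !negb_or eq_sym ny eq_sym ny' nyy'.
case: k kn T0 Ty Ty' sy sy' => [|k] kn T0 Ty Ty' sy sy'.
  have sT : size (T 0) = 1%N.
    exact: etrans (size_level0 d_gt1 theta iota_inj rsP) (congr1 predn d2).
  have := uniq_leq_size us (s2 := T 0); rewrite sT /=.
  by move=> H; have : (3 <= 1)%N by apply: H => z; rewrite !inE => /or3P [] /eqP ->.
have Tf := level_f_ d_gt1 theta iota_inj rsP kn T0.
have sf : size (fiber k (f_ x0)) = 2%N.
  exact: etrans (size_fiber d_gt1 theta iota_inj rsP kn Tf) d2.
have := uniq_leq_size us (s2 := fiber k (f_ x0)); rewrite sf /= => H.
have : (3 <= 2)%N by apply: H => z; rewrite !inE mem_filter => /or3P [] /eqP ->;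
  rewrite ?eqxx ?T0 ?Ty ?Ty' ?andbT //= eq_sym.
by [].
Qed.

(** For [fb = X^(d-1) (X - 1)], in the fibre of a node of value [0] one node [x0] has value [1] and
    all others have value [0]. Inertia is transitive on the latter and, as it keeps values, fixes
    [x0]. On level 0 the same pattern is prescribed for [f'] itself. *)
Lemma stabilizer_transitive k : (k <= n)%N -> exists2 x0, x0 \in T k &
  forall y y', y \in T k -> y' \in T k -> sib k x0 y -> sib k x0 y' ->
  y != x0 -> y' != x0 -> exists2 s : gal_of E, s \in G & s x0 = x0 /\ s y = y'.
Proof.
move=> kn; have d_gt0 := ltnW d_gt1; have dp : (0 < d.-1)%N by lia.
(* For [d = 2], [0] is not critical for [X^2 - X]; but then a node has at most one other sibling and
   the identity will do. *)
have [d2|d3] : d = 2%N \/ (2 < d)%N by lia.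
  have [x0 Tx0] := level_nonempty kn; exists x0 => // y y' Ty Ty' sy sy' ny ny'.
  exists 1%g; first exact: group1.
  by rewrite !gal_id (sib_unique d2 kn Tx0 Ty Ty').
have szr : size (1 :: nseq d.-2 0 : seq F) = d.-1 by rewrite /= size_nseq; lia.
have dpp : (0 < d.-2)%N by lia.
case: k kn => [|k] kn.
  pose gb : {poly F} := \prod_(z <- 1 :: nseq d.-2 0) ('X - z%:P).
  have [||| phi [Ephi H]] := @flat_specialization K d d_gt1 F O theta iota iota_inj L E n rs
    rsP rsE gb.
  - exact: monic_prod_XsubC.
  - by rewrite /gb (size_prod_XsubC _ id) szr prednK.
  - by apply/rootP; rewrite root_prod_XsubC inE mem_nseq eqxx dpp orbT.
  have [x0 Tx0 [px0 p0]] := perm_lone (undup_uniq _) (phi_fiber Ephi).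
  exists x0 => // y y' Ty Ty' _ _ ny ny'.
  have [s sG [sy Hs]] := H y y' Ty Ty' (p0 _ Ty ny) (p0 _ Ty' ny').
  exists s => //; split=> //; apply/eqP/negPn/negP => nsx0.
  have /p0/(_ nsx0) := gal_level d_gt1 theta iota_inj rsP s kn Tx0.
  by rewrite Hs // px0 => /eqP; rewrite oner_eq0.
have Fd : (d%:R : F) != 0 by exact: (dF_neq0 d_gt1 theta).
pose A : F := d.-1%:R / d%:R.
pose fb : {poly F} := \prod_(z <- 1 :: nseq d.-1 0) ('X - z%:P).
have fbE : fb = 'X^d - 'X^(d.-1).
  by rewrite /fb big_cons prod_nseq0 mulrBl -exprS prednK // polyC1 mul1r.
have dfb : fb^`() = d%:R *: \prod_(z <- A :: nseq d.-2 0) ('X - z%:P).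
  rewrite big_cons prod_nseq0 fbE derivB !derivXn mulrBl -exprS [d.-2.+1]prednK //.
  rewrite scalerBr scaler_nat -[A%:P * _]/(A%:P * _) mul_polyC scalerA /A mulrC mulfVK //.
  by rewrite scaler_nat.
have [||phi [pT0 phif phib H]] := @crit_specialization K d d_gt1 F O theta iota iota_inj L E n rs
  rsP rsE (A :: nseq d.-2 0) fb; [by rewrite /= size_nseq; lia | exact: dfb |].
have [c Tc pc] : exists2 c, c \in T 0 & phi c = 0.
  have : 0 \in [seq phi c | c <- T 0] by rewrite (perm_mem pT0) inE mem_nseq eqxx dpp orbT.
  by case/mapP => c Tc E1; exists c.
have fb0 : fb.[0] = 0 by apply/rootP; rewrite root_prod_XsubC inE mem_nseq eqxx dp orbT.
have it0 j : iter j (horner fb) 0 = 0 by elim: j => //= j ->.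
have dfb0 : fb^`().[0] = 0.
  by rewrite fbE derivB !derivXn hornerD hornerN !hornerMn !hornerXn !expr0n !gtn_eqF // !mul0rn subrr.
have pfib j a : (j < n)%N -> a \in T j -> phi a = 0 ->
    perm_eq [seq phi x | x <- fiber j a] (1 :: nseq d.-1 0).
  by move=> jn Ta pa; apply: phi_fiber; rewrite phib // pa subr0.
(* Since [fb] fixes [0], a branch of nodes of value [0] leads from [c] up to level [k]. *)
have [a ta pa] : exists2 a, a \in tree k c & phi a = 0.
  elim: (k) (ltnW kn) => [|j IH] jn; first by exists c; rewrite // mem_filter eqxx.
  have [a ta pa] := IH (ltnW jn); move: ta; rewrite mem_filter => /andP [/eqP ia Ta].
  have : 0 \in [seq phi x | x <- fiber j a].
    by rewrite (perm_mem (pfib _ _ jn Ta pa)) inE mem_nseq eqxx dp orbT.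
  case/mapP => x; rewrite mem_filter => /andP [/eqP fx Tx] px; exists x => //.
  by rewrite mem_filter Tx andbT iterSr fx ia.
move: (ta); rewrite mem_filter => /andP [/eqP ia Ta].
have [x0 fx0 [px0 p0]] := perm_lone (filter_uniq _ (undup_uniq _)) (pfib _ _ kn Ta pa).
move: (fx0); rewrite mem_filter => /andP [/eqP ex0 Tx0].
exists x0 => // y y' Ty Ty' sy sy' ny ny'.
have fibP z : z \in T k.+1 -> sib k.+1 x0 z -> z \in fiber k a.
  by move=> Tz; rewrite /siblings /= ex0 eq_sym mem_filter Tz andbT.
have treeP z : z \in fiber k a -> z \in tree k.+1 c.
  rewrite !mem_filter => /andP [/eqP fz Tz].
  by rewrite Tz andbT iterSr fz ia.
have [||||s sG [Esy Hs]] := H k.+1 c c kn Tc Tc _ _ y y'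
  (treeP _ (fibP _ Ty sy)) (treeP _ (fibP _ Ty' sy')).
- by rewrite pc it0.
- by rewrite pc /= it0 dfb0 mul0r addr0 oner_eq0.
- by rewrite pc p0 // fibP.
- by rewrite pc p0 // fibP.
exists s; first by case/fix_level0: sG.
split=> //; apply/eqP/negPn/negP => nsx0.
have fsx0 : s x0 \in fiber k a.
  rewrite mem_filter (gal_level d_gt1 theta iota_inj rsP) // andbT.
  have /fibP := Ty; move/(_ sy); rewrite mem_filter => /andP [/eqP fy _].
  have /fibP := Ty'; move/(_ sy'); rewrite mem_filter => /andP [/eqP fy' _].
  by rewrite -gal_f_ ex0 -fy gal_f_ Esy fy' fy.
by have := p0 _ fsx0 nsx0; rewrite Hs // px0 => /eqP; rewrite oner_eq0.
Qed.

End Transpositions.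

(** * Transpositions of siblings *)

Lemma count_gt1 (A B : eqType) (phi : A -> B) (s : seq A) x x' : uniq s ->
  x \in s -> x' \in s -> x != x' -> phi x = phi x' ->
  (1 < count_mem (phi x) [seq phi y | y <- s])%N.
Proof.
move=> us sx sx' nx E1; rewrite (seq.permP (perm_map phi (perm_to_rem sx))) /= eqxx ltnS -has_count.
by rewrite has_pred1 E1 map_f // mem_rem_uniq // inE eq_sym nx.
Qed.

Lemma perm_pair (A B : eqType) (phi : A -> B) (s : seq A) z r : uniq s ->
  perm_eq [seq phi y | y <- s] [:: z, z & r] -> z \notin r ->
  exists a b, [/\ a \in s, b \in s, a != b, phi a = z /\ phi b = z &
    {in s, forall y, phi y = z -> y = a \/ y = b}].
Proof.
move=> us ps nz.
have /mapP [a sa Ea] : z \in [seq phi y | y <- s] by rewrite (perm_mem ps) mem_head.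
have ps1 : perm_eq [seq phi y | y <- rem a s] (z :: r).
  by move: ps; rewrite (permPl (perm_map phi (perm_to_rem sa))) /= -Ea perm_cons.
have /mapP [b sb Eb] : z \in [seq phi y | y <- rem a s] by rewrite (perm_mem ps1) mem_head.
have ps2 : perm_eq [seq phi y | y <- rem b (rem a s)] r.
  by move: ps1; rewrite (permPl (perm_map phi (perm_to_rem sb))) /= -Eb perm_cons.
have usa : uniq (rem a s) by apply: rem_uniq.
move: (sb); rewrite mem_rem_uniq // inE => /andP [nba sb'].
exists a, b; split=> //; first by rewrite eq_sym.
move=> y sy Ey; have [->|nya] := eqVneq y a; first by left.
have [->|nyb] := eqVneq y b; first by right.
case/negP: nz; rewrite -(perm_mem ps2) -Ey map_f //.
by rewrite mem_rem_uniq // inE nyb mem_rem_uniq // inE nya.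
Qed.

Lemma double_root_deriv (A : idomainType) (r : seq A) z (H : (1 < count_mem z r)%N) (P : {poly A}) :
  \prod_(x <- r) ('X - x%:P) = P -> P^`().[z] = 0.
Proof.
move=> <-; have zr : z \in r by rewrite -has_pred1 has_count ltnW.
have zr' : z \in rem z r.
  by move: (H); rewrite (seq.permP (perm_to_rem zr)) /= eqxx ltnS -has_count has_pred1.
rewrite (perm_big _ (perm_to_rem zr)) big_cons (perm_big _ (perm_to_rem zr')) big_cons.
by rewrite !derivM derivXsubC !(hornerXsubC, hornerD, hornerM) subrr !(mul0r, mulr0, addr0).
Qed.

Lemma double_root (A : idomainType) (r : seq A) (P : {poly A}) z :
  \prod_(x <- r) ('X - x%:P) = P -> P.[z] = 0 -> P^`().[z] = 0 -> P^`()^`().[z] != 0 ->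
  exists2 r', perm_eq r [:: z, z & r'] & z \notin r'.
Proof.
move=> EP E0 E1 E2; have zr : z \in r by rewrite -root_prod_XsubC EP; apply/rootP.
have EP1 : P = ('X - z%:P) * \prod_(x <- rem z r) ('X - x%:P).
  by rewrite -EP (perm_big _ (perm_to_rem zr)) big_cons.
have zr' : z \in rem z r.
  rewrite -root_prod_XsubC; apply/rootP; move: E1.
  by rewrite EP1 derivM derivXsubC mul1r hornerD hornerM hornerXsubC subrr mul0r addr0.
have EP2 : P = ('X - z%:P) * (('X - z%:P) * \prod_(x <- rem z (rem z r)) ('X - x%:P)).
  by rewrite EP1; congr (_ * _); rewrite (perm_big _ (perm_to_rem zr')) big_cons.
exists (rem z (rem z r)).
  by rewrite (perm_trans (perm_to_rem zr)) // perm_cons perm_to_rem.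
apply: contra E2; rewrite -root_prod_XsubC => /rootP E2; apply/eqP.
rewrite EP2 !(derivXsubC, derivM, derivD) !mul1r !(hornerXsubC, hornerD, hornerM) E2.
by rewrite subrr !(mul0r, mulr0, addr0).
Qed.

Section Transpositions.

Variables (K : fieldExtType rat) (d : nat).
Hypothesis d_gt1 : (1 < d)%N.
Variables (F O : closedFieldType) (theta : {rmorphism Kst K d -> F}).
Variable (iota : {rmorphism {poly F} -> O}).
Hypothesis iota_inj : injective iota.
Local Notation f := (generic_poly K d).
Variables (L : splittingFieldType (Kst K d)) (E : {subfield L}) (n : nat) (rs : seq L).
Hypothesis rsP : map_poly (in_alg L) (f^`() \Po iter_poly f n) %= \prod_(x <- rs) ('X - x%:P).
Hypothesis rsE : <<1 & rs>>%VS = E.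

Local Notation T := (level n rs).
Local Notation f_ := (@f_ K d L).
Local Notation tree := (tree n rs).
Local Notation fiber := (fiber n rs).
Local Notation G := ('Gal(E / 1)%g).
Local Notation sib := (@siblings K d L).
Let Tgal := @gal_level K d d_gt1 F O theta iota iota_inj L E n rs rsP.
Let TI := level_iter d_gt1 theta iota_inj rsP.
Let Tf := level_f_ d_gt1 theta iota_inj rsP.

Definition transposes k a b := [/\ a \in T k, b \in T k, a != b, sib k a b &
  exists2 s : gal_of E, s \in G &
    [/\ s a = b, s b = a & {in T k, forall x, x != a -> x != b -> s x = x}]].

(** [f'] is made to specialize, up to the factor [d], to a polynomial with one double root [0] and
    all other roots simple. An inertia element moving one node of value [0] to the other fixes every
    remaining node, its value being taken only once. *)
Lemma transposes0 : (2 < d)%N -> exists a b, transposes 0 a b.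
Proof.
move=> d3; have d_gt0 := ltnW d_gt1.
(* The values [1, ..., d - 3]; with the double [0] this makes [d - 1]. *)
pose r : seq F := mkseq (fun i => i.+1%:R) (d - 3).
have ninj := natr_inj_char0 (F_char0 theta).
have nr : 0 \notin r.
  by apply/mapP => -[i _ /esym/eqP]; rewrite (pcharf0P _).1 //; exact: (F_char0 theta).
have ur : uniq r by apply: mkseq_uniq => i j /ninj [].
have szr : (size [:: 0, 0 & r]).+1 = d by rewrite /= size_mkseq; lia.
pose gb : {poly F} := \prod_(z <- [:: 0, 0 & r]) ('X - z%:P).
have [||| phi [Ephi H]] := @flat_specialization K d d_gt1 F O theta iota iota_inj L E n rs
    rsP rsE gb.
- exact: monic_prod_XsubC.
- by rewrite /gb (size_prod_XsubC _ id) szr.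
- by apply/rootP; rewrite root_prod_XsubC mem_head.
have pT := phi_fiber Ephi; have uT : uniq (T 0) by apply: undup_uniq.
have [a [b [Ta Tb nab [pa pb] Hab]]] := perm_pair uT pT nr.
have [s sG [sa Hs]] := H a b Ta Tb pa pb.
exists a, b; split=> //; exists s => //.
have inj x : x \in T 0 -> s x != x -> phi x = 0.
  move=> Tx nx; have Tsx := Tgal s (leq0n n) Tx.
  have := count_gt1 uT Tsx Tx nx (Hs _ Tx); rewrite (seq.permP pT) /=.
  rewrite Hs //; have [-> //|ne] := eqVneq (phi x) 0.
  by rewrite !add0n count_uniq_mem //; case: (_ \in _).
split=> //.
  have Tsb := Tgal s (leq0n n) Tb.
  case: (Hab _ Tsb); [by rewrite Hs | by [] |].
  by move=> sbb; case/eqP: nab; apply: (fmorph_inj s); rewrite /= sa sbb.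
move=> x Tx nxa nxb; apply/eqP/negPn/negP => /(inj x Tx) /(Hab _ Tx) [] E1.
  by rewrite E1 eqxx in nxa.
by rewrite E1 eqxx in nxb.
Qed.

(** If a nonzero [p] vanished at a parameter, substituting an integer for the variables would make
    [p] vanish at that integer, and the integer can be chosen off the roots of [p]. *)
Lemma param_transcendental (i : 'I_d) : injective
  (horner_eval (theta (param K i)) \o map_poly (theta \o rat_Kst K d) : {poly rat} -> F).
Proof.
pose ev : {rmorphism {poly rat} -> F} :=
  horner_eval (theta (param K i)) \o map_poly (theta \o rat_Kst K d).
suff ev0 p : ev p = 0 -> p = 0.
  move=> p q E1; apply/eqP; rewrite -subr_eq0; apply/eqP/ev0.
  by rewrite rmorphB; apply/eqP; rewrite subr_eq0; apply/eqP.
pose q := (map_poly (@mpolyC d K \o in_alg K) p).['X_i].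
have -> : ev p = theta (FracField.tofrac q).
  rewrite /q -[RHS]/((theta \o @FracField.tofrac {mpoly K[d]}) _) -horner_map.
  by rewrite -map_poly_comp.
move/eqP; rewrite fmorph_eq0 tofrac_eq0 => /eqP q0.
apply/eqP/negPn/negP => np; have [m] := @avoid_roots rat [:: p] (Num.Theory.pchar_num _)
  (fun r => ltac:(by rewrite inE => /eqP ->)).
move=> /(_ p (mem_head _ _)) /eqP; apply.
have := congr1 (meval (fun _ : 'I_d => m%:R : K)) q0; rewrite meval0 /q.
rewrite -horner_map /= mevalXU -map_poly_comp.
have -> : map_poly (meval (fun _ : 'I_d => m%:R) \o (@mpolyC d K \o in_alg K)) p =
  map_poly (in_alg K) p by apply: eq_map_poly => c; rewrite /= mevalC.
rewrite -(rmorph_nat (in_alg K)) horner_map => /eqP; rewrite fmorph_eq0 => /eqP.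
by [].
Qed.

Lemma transposesS k : (k < n)%N -> exists a b, transposes k.+1 a b.
Proof.
move=> kn; have d_gt0 := ltnW d_gt1; have dp : (0 < d.-1)%N by lia.
have i0 : 'I_d by exists 0%N.
have Fd : (d%:R : F) != 0 by exact: (dF_neq0 d_gt1 theta).
(* The image of [s_1]; any element transcendental over the rationals would serve. *)
set e := theta (param K i0).
have [t] := @superattracting d d_gt1 F (theta \o rat_Kst K d) e k (@param_transcendental i0).
set A := (theta \o _) _ * e => -[[A0 kA] jA jA0 j0 od].
pose fb : {poly F} := 'X^d - e *: 'X^(d.-1) + t%:P.
have fbE x : fb.[x] = fam d e t x.
  by rewrite /fb /fam hornerD hornerD hornerN hornerZ !hornerXn hornerC.
have fbi j x : iter j (horner fb) x = iter j (fam d e t) x by apply: eq_iter.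
have dA : d%:R * A = d.-1%:R * e.
  by rewrite /A fmorph_div !rmorph_nat mulrA mulrCA divff // mulr1.
have dfb : fb^`() = d%:R *: \prod_(c <- A :: nseq d.-2 0) ('X - c%:P).
  rewrite big_cons prod_nseq0 /fb derivD derivC addr0 derivB derivZ !derivXn.
  rewrite mulrBl -exprS [d.-2.+1]prednK // mul_polyC scalerBr scaler_nat scalerA dA.
  by rewrite mulr_natl -scalerMnl scalerMnr.
have dfbx x : fb^`().[x] = d%:R * ((x - A) * x ^+ d.-2).
  by rewrite dfb big_cons prod_nseq0 hornerZ hornerM hornerXsubC hornerXn.
have ddfb : fb^`()^`().[A] != 0.
  rewrite dfb big_cons prod_nseq0 derivZ derivM derivXsubC mul1r hornerZ hornerD hornerM.
  by rewrite hornerXsubC subrr mul0r addr0 hornerXn mulf_neq0 // expf_neq0.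
have oo : orbit_order fb A k.+1 != 0.
  suff -> : orbit_order fb A k.+1 = orbit_deriv d A e t k.+1 by [].
  elim: k.+1 => //= j ->; rewrite fbi; congr (1 + _ * _).
  rewrite /fb derivD derivC addr0 derivB derivZ !derivXn /fam'.
  by rewrite hornerD hornerN hornerZ !hornerMn !hornerXn !mulr_natl.
have [||phi [pT0 phif phib H]] := @crit_specialization K d d_gt1 F O theta iota iota_inj L E n rs
  rsP rsE (A :: nseq d.-2 0) fb; [by rewrite /= size_nseq; lia | exact: dfb |].
have phic c : c \in T 0 -> phi c = A \/ phi c = 0.
  move=> Tc; have := perm_mem pT0 (phi c); rewrite map_f // inE => /esym/orP [/eqP|/nseqP []].
    by left.
  by right.
(* Two nodes with the same parent and the same value have a critical value of [phi], that is [A] or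
   [0], and their ancestor in level 0 has value [A] or [0] as well. The orbit of [0] avoids both;
   that of [A] avoids [0] and first returns to [A] after [k.+1] steps. *)
have inj j x x' : (j <= k.+1)%N -> x \in T j -> x' \in T j -> phi x = phi x' ->
    iter j f_ x = iter j f_ x' -> x = x' \/ [/\ j = k.+1, phi x = A & phi (iter j f_ x) = A].
  elim: j x x' => [|j IH] x x' jk Tx Tx' px Ei; first by left.
  have jn : (j < n)%N by apply: leq_trans kn.
  have pf : phi (f_ x) = phi (f_ x') by rewrite !(phif j) // px.
  have [|Ef|[]] := IH (f_ x) (f_ x') (ltnW jk) (Tf jn Tx) (Tf jn Tx') pf.
  - by rewrite -!iterSr.
  - have [->|nx] := eqVneq x x'; [by left | right].
    have r0 : fb^`().[phi x] = 0.
      have c1 : (1 < count_mem (phi x) [seq phi y | y <- fiber j (f_ x)])%N.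
        by apply: (count_gt1 (x' := x')) => //; rewrite ?filter_uniq ?undup_uniq // mem_filter
          ?Tx ?Tx' ?Ef eqxx.
      rewrite -[fb^`()]subr0 -(derivC (phi (f_ x))) -derivB; apply: (double_root_deriv c1).
      by rewrite big_map; apply: phib => //; apply: Tf.
    have pi : phi (iter j.+1 f_ x) = iter j.+1 (fam d e t) (phi x).
      by rewrite -fbi; apply: (phi_iter d_gt1 theta iota_inj rsP (leq_trans jk kn) phif Tx).
    have Ti := phic _ (TI (leq_trans jk kn) Tx).
    move: r0; rewrite dfbx => /eqP; rewrite !mulf_eq0 (negPf Fd) subr_eq0 expf_eq0 /=.
    case/orP => [/eqP pA|/andP [_ /eqP p0]]; last first.
      by move: Ti; rewrite pi p0; have [/eqP ? /eqP ?] := j0 j.+1 jk; case.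
    have pj : phi (iter j.+1 f_ x) = A.
      by case: Ti => //; rewrite pi pA => /eqP; rewrite (negPf (jA0 j.+1 jk)).
    split=> //; apply/eqP; rewrite eqn_leq jk /= ltnNge; apply/negP => jk'.
    by have := jA j.+1 jk'; rewrite -pA -pi pj pA eqxx.
  - by move=> jE; move: jk; rewrite jE ltnn.
(* Backward orbits of [fb] lift to the tree, because the values on a fibre are all the roots of [fb]
   minus the value of the parent. *)
have ex j c w : (j <= n)%N -> c \in T 0 -> iter j (horner fb) w = phi c ->
    exists2 x, x \in tree j c & phi x = w.
  elim: j w => [|j IH] w jn Tc; first by exists c; rewrite // mem_filter eqxx.
  rewrite iterSr => /(IH _ (ltnW jn) Tc) [y]; rewrite mem_filter => /andP [/eqP iy Ty] py.
  have := congr1 (horner^~ w) (phib _ _ jn Ty); rewrite horner_prod hornerD hornerN hornerC py subrr => /eqP.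
  rewrite prodf_seq_eq0 => /hasP [x]; rewrite mem_filter => /andP [/eqP fx Tx] /=.
  rewrite hornerXsubC subr_eq0 => /eqP Ew; exists x => //.
  by rewrite mem_filter Tx iterSr fx iy eqxx.
have [c0 Tc0 pc0] : exists2 c, c \in T 0 & phi c = A.
  by have : A \in [seq phi c | c <- T 0]; [rewrite (perm_mem pT0) mem_head | case/mapP => c; exists c].
have uc c : c \in T 0 -> phi c = A -> c = c0.
  move=> Tc pc; apply/eqP/negPn/negP => nc; have := count_gt1 (undup_uniq _) Tc Tc0 nc (etrans pc (esym pc0)).
  rewrite pc (seq.permP pT0) /= eqxx ltnS -has_count has_pred1.
  by move/nseqP => [/eqP]; rewrite (negPf A0).
(* In the fibre of such a node the value [A] is taken exactly twice: [A] is a root of [fb - fb(A)]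
   and of its derivative, but not of the second derivative. *)
have [al tal pal] : exists2 al, al \in tree k c0 & phi al = fb.[A].
  by apply: ex => //; [exact: ltnW | rewrite -iterSr fbi pc0].
move: (tal); rewrite mem_filter => /andP [/eqP ial Tal].
have [r pr nr] : exists2 r, perm_eq [seq phi x | x <- fiber k al] [:: A, A & r] & A \notin r.
  apply: (@double_root _ _ (fb - (phi al)%:P)).
  - by rewrite big_map; apply: phib.
  - by rewrite hornerD hornerN hornerC pal subrr.
  - by rewrite derivB derivC subr0 dfbx subrr mul0r mulr0.
  - by rewrite derivB derivC subr0.
have [a [b [fa fb' nab [pa pb] Hab]]] := perm_pair (filter_uniq _ (undup_uniq _)) pr nr.
move: (fa) (fb'); rewrite !mem_filter => /andP [/eqP fae Ta] /andP [/eqP fbe Tb].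
have iA : iter k.+1 (horner fb) A = A by rewrite fbi.
have [||||||s sG [sab Hs]] := H k.+1 c0 c0 kn Tc0 Tc0 _ _ a b; rewrite ?pc0 //.
- by rewrite mem_filter Ta andbT iterSr fae ial.
- by rewrite mem_filter Tb andbT iterSr fbe ial.
have [sG' fixs] := fix_level0 rsE sG.
have si x : x \in T k.+1 -> iter k.+1 f_ (s x) = iter k.+1 f_ x.
  by move=> Tx; rewrite -gal_iter fixs // TI.
have inab x : x \in T k.+1 -> phi x = A -> phi (iter k.+1 f_ x) = A -> x = a \/ x = b.
  move=> Tx px pix; apply: Hab => //; rewrite mem_filter Tx andbT; apply/eqP.
  have [||//|[kk _ _]] := @inj k (f_ x) al (leqnSn k) (Tf kn Tx) Tal.
  - by rewrite (phif k) // px.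
  - by rewrite -iterSr ial; apply: uc pix; apply: TI kn Tx.
  by case: (n_Sn k).
exists a, b; split=> //; first by rewrite /siblings /= fae fbe eqxx.
(* A node moved by [s] collides with its image, so by [inj] it has value [A] and lies above [c0],
   which leaves only [a] and [b]. *)
exists s => //; have moved x : x \in T k.+1 -> s x != x -> x = a \/ x = b.
  move=> Tx nx; have Tsx := Tgal s kn Tx.
  have [E1|[_ psx pix]] := @inj k.+1 (s x) x (leqnn _) Tsx Tx (Hs _ Tx) (si _ Tx).
    by rewrite E1 eqxx in nx.
  by apply: inab => //; [rewrite -Hs | rewrite -si].
have iab z : z \in fiber k al -> phi (iter k.+1 f_ z) = A.
  by rewrite mem_filter => /andP [/eqP fz _]; rewrite iterSr fz ial.
split=> //.
  have [|||//|sbb] := inab (s b); first exact: Tgal.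
  - by rewrite Hs.
  - by rewrite si // iab.
  - by case/eqP: nab; apply: (fmorph_inj s); rewrite /= sab sbb.
move=> x Tx nxa nxb; apply/eqP/negPn/negP => /(moved x Tx) [] E1.
  by rewrite E1 eqxx in nxa.
by rewrite E1 eqxx in nxb.
Qed.

End Transpositions.

(** * Realizing permutations of siblings *)

Section Realization.

Variables (K : fieldExtType rat) (d : nat).
Hypothesis d_gt1 : (1 < d)%N.
Variables (F O : closedFieldType) (theta : {rmorphism Kst K d -> F}).
Variable (iota : {rmorphism {poly F} -> O}).
Hypothesis iota_inj : injective iota.
Local Notation f := (generic_poly K d).
Variables (L : splittingFieldType (Kst K d)) (E : {subfield L}) (n : nat) (rs : seq L).
Hypothesis rsP : map_poly (in_alg L) (f^`() \Po iter_poly f n) %= \prod_(x <- rs) ('X - x%:P).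
Hypothesis rsE : <<1 & rs>>%VS = E.

Local Notation T := (level n rs).
Local Notation f_ := (@f_ K d L).
Local Notation fiber := (fiber n rs).
Local Notation G := ('Gal(E / 1)%g).
Local Notation sib := (@siblings K d L).
Local Notation transposes := (@transposes K d L E n rs).
Let Tgal := @gal_level K d d_gt1 F O theta iota iota_inj L E n rs rsP.

Lemma gal_levelM (s t : gal_of E) k x : x \in T k -> (s * t)%g x = t (s x).
Proof. by move=> Tx; rewrite galM ?(level_sub rsE Tx). Qed.

Lemma transposes_gal k a b (g : gal_of E) : (k <= n)%N -> g \in G ->
  transposes k a b -> transposes k (g a) (g b).
Proof.
move=> kn gG [Ta Tb nab sab [s sG [sa sb sx]]].
have gK x : x \in T k -> g^-1%g (g x) = x.
  by move=> Tx; rewrite -(gal_levelM _ _ Tx) mulgV gal_id.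
have gVK x : x \in T k -> g (g^-1%g x) = x.
  by move=> Tx; rewrite -(gal_levelM _ _ Tx) mulVg gal_id.
split; rewrite ?Tgal ?sib_gal //; first by rewrite (inj_eq (fmorph_inj g)).
exists (g^-1 * s * g)%g; first by rewrite !groupM ?groupV.
have E1 x : x \in T k -> (g^-1 * s * g)%g x = g (s (g^-1%g x)).
  by move=> Tx; rewrite (gal_levelM _ _ Tx) (gal_levelM _ _ Tx).
split=> [||x Tx nxa nxb].
- by rewrite E1 ?Tgal // gK // sa.
- by rewrite E1 ?Tgal // gK // sb.
rewrite E1 // sx ?Tgal ?gVK //.
  by apply: contra nxa => /eqP <-; rewrite gVK.
by apply: contra nxb => /eqP <-; rewrite gVK.
Qed.

(** One transposition [(a0 b0)] is conjugated: [g] and [g'] bring [a0] and [a] to the node [x0] of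
    [stabilizer_transitive], and [h] fixes [x0] and moves [g b0] to [g' b]. *)
Lemma sib_transposition k a b : (k <= n)%N -> a \in T k -> b \in T k -> a != b -> sib k a b ->
  transposes k a b.
Proof.
move=> kn Ta Tb nab sab.
have [a0 [b0 t0]] : exists a0 b0, transposes k a0 b0.
  case: k kn Ta Tb sab => [|k] kn Ta Tb sab; last exact: (transposesS d_gt1 theta iota_inj rsP rsE kn).
  (* For [d = 2] level 0 is a single node, against [a != b]. *)
  have [d2|d3] : d = 2%N \/ (2 < d)%N by lia.
    have := etrans (size_level0 d_gt1 theta iota_inj rsP) (congr1 predn d2).
    by move: Ta Tb nab; case: (T 0) => [|x [|]] //; rewrite !inE => /eqP -> /eqP ->; rewrite eqxx.
  exact: (transposes0 d_gt1 theta iota_inj rsP rsE d3).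
have [Ta0 Tb0 nab0 sab0 _] := t0.
have [x0 Tx0 tr] := stabilizer_transitive d_gt1 theta iota_inj rsP rsE kn.
have TT := level_transitive d_gt1 theta iota_inj rsP rsE kn.
have [g gG ga] := TT _ _ Ta0 Tx0; have [g' gG' ga'] := TT _ _ Ta Tx0.
have [||||||h hG [hx hb]] := tr (g b0) (g' b); rewrite ?Tgal //.
- by rewrite -ga sib_gal.
- by rewrite -ga' sib_gal.
- by rewrite -ga (inj_eq (fmorph_inj g)) eq_sym.
- by rewrite -ga' (inj_eq (fmorph_inj g')) eq_sym.
have := transposes_gal kn hG (transposes_gal kn gG t0); rewrite ga hx hb => t1.
have := transposes_gal kn (groupVr gG') t1.
by rewrite -ga' -!(gal_levelM _ _ Ta) -!(gal_levelM _ _ Tb) mulgV !gal_id.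
Qed.

(** By induction on [r]: the transposition of [g (s i)] and [t i] corrects index [i], and
    injectivity of [s] and [t] keeps it away from the indices already settled. *)
Lemma sib_realize k (I : eqType) (r : seq I) (s t : I -> L) : (k <= n)%N -> uniq r ->
  {in r &, injective s} -> {in r &, injective t} ->
  {in r, forall i, [/\ s i \in T k, t i \in T k & sib k (s i) (t i)]} ->
  exists2 g : gal_of E, g \in G & {in r, forall i, g (s i) = t i} /\
    {in T k, forall x, sib k x (g x)}.
Proof.
move=> kn; elim: r => [|i r IH] /=.
  move=> _ _ _ _; exists 1%g; first exact: group1.
  by split=> // x _; rewrite gal_id /sib eqxx orbT.
move=> /andP [ir ur] si ti H.
have sub j : j \in r -> j \in i :: r by move=> jr; rewrite inE jr orbT.
have [x y xr yr|x y xr yr|j jr|g gG [gr gs]] := IH ur.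
- by apply: si; apply: sub.
- by apply: ti; apply: sub.
- by apply: H; apply: sub.
have [Tsi Tti sti] := H i (mem_head _ _).
have sib_sym x y : sib k x y = sib k y x by rewrite /siblings [f_ x == _]eq_sym.
have sib_tr x y z : sib k x y -> sib k y z -> sib k x z.
  by rewrite /siblings; case: (k == 0)%N => //= /eqP ->.
have [Eg|nE] := eqVneq (g (s i)) (t i).
  by exists g => //; split=> // j; rewrite inE => /orP [/eqP -> //|/gr].
have sab : sib k (g (s i)) (t i) by apply: sib_tr sti; rewrite sib_sym gs.
have [_ _ _ _ [q qG [qa qb qx]]] := sib_transposition kn (Tgal g kn Tsi) Tti nE sab.
have qs x : x \in T k -> sib k x (q x).
  move=> Tx; have [->|nxa] := eqVneq x (g (s i)); first by rewrite qa.
  have [->|nxb] := eqVneq x (t i); first by rewrite qb sib_sym.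
  by rewrite qx // /sib eqxx orbT.
exists (g * q)%g; first exact: groupM.
split=> [j|x Tx]; last by rewrite (gal_levelM _ _ Tx); apply: sib_tr (gs _ Tx) (qs _ (Tgal _ kn Tx)).
rewrite inE => /orP [/eqP ->|jr]; first by rewrite (gal_levelM _ _ Tsi) qa.
have [Tsj Ttj _] := H j (sub j jr).
have nij : j != i by apply: contraNneq ir => <-.
rewrite (gal_levelM _ _ Tsj) qx ?Tgal //; first exact: gr.
  rewrite (inj_eq (fmorph_inj g)); apply: contra nij => /eqP E1.
  by apply/eqP/si; rewrite ?mem_head ?sub.
rewrite gr //; apply: contra nij => /eqP E1.
by apply/eqP/ti; rewrite ?mem_head ?sub.
Qed.

End Realization.

(** * Wreath products as groups of tree automorphisms *)

Section WreathElements.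

Variables (k : nat) (gT : finGroupType).

Definition wr_top (u : sym_wreath k gT) : 'S_k := (pair_of_sd u).1.
Definition wr_base (u : sym_wreath k gT) (i : 'I_k) : gT := (pair_of_sd u).2 i.

Lemma wr_exists (s : 'S_k) (x : 'I_k -> gT) :
  exists u : sym_wreath k gT, wr_top u = s /\ wr_base u =1 x.
Proof.
have sxP : (s, [ffun i => x i] : base_group k gT) \in setX [set: 'S_k] [set: base_group k gT].
  by rewrite !inE.
exists (SdPair (coord_groupAction k gT) sxP); split=> // i.
by rewrite /wr_base /= ffunE.
Qed.

Lemma wr_topM (u v : sym_wreath k gT) : wr_top (u * v)%g = (wr_top u * wr_top v)%g.
Proof. by []. Qed.

(* The product of the wreath product being that of right actions, [u] acts on [(i, y)] by
   moving [i] to [wr_top u i] and then [y] by the base coordinate at the new index. *)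
Lemma wr_baseM (u v : sym_wreath k gT) i :
  wr_base (u * v)%g (wr_top v i) = (wr_base u i * wr_base v (wr_top v i))%g.
Proof. by rewrite /wr_base /= !ffunE -/(wr_top v) permK. Qed.

Lemma wr_inj (u v : sym_wreath k gT) : wr_top u = wr_top v -> wr_base u =1 wr_base v -> u = v.
Proof.
move=> Et Eb; apply: val_inj; move: Et Eb; rewrite /wr_top /wr_base /=.
case: (pair_of_sd u) (pair_of_sd v) => [s x] [t y] /= -> Eb.
by congr pair; apply/ffunP.
Qed.

End WreathElements.

Section TreeWords.

Variable d : nat.

Definition root_perm n (u : iter_sym_wreath d n.+1) : 'S_d :=
  @wr_top d (iter_sym_wreath d n) u.
Definition subtree_elt n (u : iter_sym_wreath d n.+1) (i : 'I_d) : iter_sym_wreath d n :=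
  @wr_base d (iter_sym_wreath d n) u i.

(** A word lists a path from the root, so words of length at most [n] are the vertices of the tree;
    letters beyond depth [n] are left alone. *)
Fixpoint word_act n : iter_sym_wreath d n -> seq 'I_d -> seq 'I_d :=
  if n is m.+1 return iter_sym_wreath d n -> seq 'I_d -> seq 'I_d then
    fun u w => if w is i :: w' then
      root_perm u i :: word_act (subtree_elt u (root_perm u i)) w' else [::]
  else fun _ w => w.

Lemma word_act_nil n (u : iter_sym_wreath d n) : word_act u [::] = [::].
Proof. by case: n u. Qed.

Lemma word_act_cons n (u : iter_sym_wreath d n.+1) i w : word_act u (i :: w) =
  root_perm u i :: word_act (subtree_elt u (root_perm u i)) w.
Proof. by []. Qed.

Lemma size_word_act n (u : iter_sym_wreath d n) w : size (word_act u w) = size w.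
Proof.
elim: n u w => [//|n IH] u [|i w]; first by rewrite word_act_nil.
by rewrite word_act_cons /= IH.
Qed.

Lemma word_act_rcons n (u : iter_sym_wreath d n) w a :
  exists b, word_act u (rcons w a) = rcons (word_act u w) b.
Proof.
elim: n u w => [|n IH] u w; first by exists a.
case: w => [|i w]; rewrite ?rcons_cons word_act_cons.
  by rewrite !word_act_nil; exists (root_perm u a).
have [b ->] := IH (subtree_elt u (root_perm u i)) w.
by exists b; rewrite word_act_cons.
Qed.

Lemma word_actM n (u v : iter_sym_wreath d n) w :
  word_act (u * v)%g w = word_act v (word_act u w).
Proof.
elim: n u v w => [//|n IH] u v [|i w]; first by rewrite !word_act_nil.
rewrite !word_act_cons -IH; congr (_ :: _); first exact: permM.
congr (word_act _ w); rewrite [root_perm _ i]permM; exact: wr_baseM.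
Qed.

Lemma word_act_faithful (d_gt0 : (0 < d)%N) n (u v : iter_sym_wreath d n) :
  (forall w, size w = n -> word_act u w = word_act v w) -> u = v.
Proof.
elim: n u v => [|n IH] u v H; first by apply/permP; case.
have i0 : 'I_d by exists 0%N.
have Et : root_perm u = root_perm v.
  apply/permP => i; have := H (i :: nseq n i0); rewrite !word_act_cons /= size_nseq.
  by case/(_ erefl).
apply: (@wr_inj d (iter_sym_wreath d n) u v Et) => i; apply: IH => w sw.
have := H ((root_perm u)^-1%g i :: w); rewrite !word_act_cons /= sw -Et permKV.
by case/(_ erefl).
Qed.

Lemma word_act_inj n (u : iter_sym_wreath d n) : injective (word_act u).
Proof.
elim: n u => [|n IH] u; first by [].
by case=> [|i w] [|j w'] //; rewrite !word_act_cons => -[/perm_inj -> /IH ->].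
Qed.

(** The hypotheses make [p] a tree automorphism: it keeps depth, parents and distinctness. It splits
    into a permutation [s0] of the children of the root and maps [q i] between subtrees. *)
Lemma word_act_exists n (p : seq 'I_d -> seq 'I_d) :
  (forall w, (size w <= n)%N -> size (p w) = size w) ->
  (forall w a, (size w < n)%N -> exists b, p (rcons w a) = rcons (p w) b) ->
  (forall w w', (size w <= n)%N -> size w = size w' -> p w = p w' -> w = w') ->
  exists u : iter_sym_wreath d n, forall w, (size w <= n)%N -> word_act u w = p w.
Proof.
elim: n p => [|n IH] p sp pp ip.
  exists 1%g => w; rewrite leqn0 size_eq0 => /eqP -> /=.
  by apply/esym/eqP; rewrite -size_eq0 sp.
pose s0 i := head i (p [:: i]).
have s0E i : p [:: i] = [:: s0 i].
  by have := sp [:: i] isT; rewrite /s0; case: (p _) => [|j [|]].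
have s0_inj : injective s0.
  by move=> i j E1; have [] : [:: i] = [:: j] by apply: ip; rewrite ?s0E ?E1.
pose q i w := behead (p (i :: w)).
have qE i w : (size w <= n)%N -> p (i :: w) = s0 i :: q i w.
  rewrite /q; elim/last_ind: w => [|w a IHw]; first by rewrite s0E.
  rewrite size_rcons => sw; have [b] := pp (i :: w) a sw.
  by rewrite -rcons_cons => ->; rewrite (IHw (ltnW sw)).
have /choice [x xP] : forall i, exists u : iter_sym_wreath d n,
    forall w, (size w <= n)%N -> word_act u w = q i w.
  move=> i; apply: IH => [w sw|w a sw|w w' sw sw' E1].
  - by have := sp (i :: w) sw => /(etrans (congr1 size (esym (qE i w sw)))) [].
  - have [b] := pp (i :: w) a sw; have sr : (size (rcons w a) <= n)%N by rewrite size_rcons.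
    by rewrite rcons_cons (qE _ _ sr) (qE i w (ltnW sw)) => -[->]; exists b.
  - suff [] : i :: w = i :: w' by [].
    apply: ip; [exact: sw | by rewrite /= sw' | rewrite (qE _ _ sw) E1].
    by apply/esym/qE; rewrite -sw'.
(* Base coordinates are indexed by the target subtree, hence the inverse. *)
have [u [ut ub]] := @wr_exists d (iter_sym_wreath d n) (perm s0_inj) (fun i => x ((perm s0_inj)^-1%g i)).
exists u => -[|i w] sw; first by apply/esym/eqP; rewrite -size_eq0 sp.
by rewrite word_act_cons qE // /root_perm /subtree_elt ut ub permK permE xP.
Qed.

End TreeWords.

(** * The isomorphism with the Galois group *)

Section Realization.

Variables (K : fieldExtType rat) (d : nat).
Hypothesis d_gt1 : (1 < d)%N.
Variables (F O : closedFieldType) (theta : {rmorphism Kst K d -> F}).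
Variable (iota : {rmorphism {poly F} -> O}).
Hypothesis iota_inj : injective iota.
Local Notation f := (generic_poly K d).
Variables (L : splittingFieldType (Kst K d)) (E : {subfield L}) (n : nat) (rs : seq L).
Hypothesis rsP : map_poly (in_alg L) (f^`() \Po iter_poly f n) %= \prod_(x <- rs) ('X - x%:P).
Hypothesis rsE : <<1 & rs>>%VS = E.

Local Notation T := (level n rs).
Local Notation f_ := (@f_ K d L).
Local Notation fiber := (fiber n rs).
Local Notation G := ('Gal(E / 1)%g).
Local Notation sib := (@siblings K d L).
Local Notation transposes := (@transposes K d L E n rs).
Let Tgal := @gal_level K d d_gt1 F O theta iota iota_inj L E n rs rsP.

(* Nodes are named by words with the last letter first, so that the parent is the tail;
   [label] below reads words from the root. *)
Fixpoint node (i : 'I_d.-1) (w : seq 'I_d) : L :=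
  if w is a :: w' then nth 0 (fiber (size w') (node i w')) a else nth 0 (T 0) i.

Let sT0 := size_level0 d_gt1 theta iota_inj rsP.
Let sfib := @size_fiber K d d_gt1 F O theta iota iota_inj L n rs rsP.

Lemma node_level i w : (size w <= n)%N -> node i w \in T (size w).
Proof.
elim: w => [|a w IH] /= sw; first by rewrite mem_nth // sT0.
suff : nth 0 (fiber (size w) (node i w)) a \in fiber (size w) (node i w).
  by rewrite mem_filter => /andP [].
by rewrite mem_nth // sfib ?IH // ltnW.
Qed.

Lemma node_f i a w : (size w < n)%N -> f_ (node i (a :: w)) = node i w.
Proof.
move=> sw /=; suff : nth 0 (fiber (size w) (node i w)) a \in fiber (size w) (node i w).
  by rewrite mem_filter => /andP [/eqP].
by rewrite mem_nth // sfib ?node_level // ltnW.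
Qed.

Lemma node_inj i i' w w' : (size w <= n)%N -> size w = size w' ->
  node i w = node i' w' -> i = i' /\ w = w'.
Proof.
elim: w w' => [|a w IH] [|a' w'] //=.
  move=> _ _ E1; split=> //; apply/val_inj/eqP.
  by move/eqP: E1; rewrite nth_uniq ?undup_uniq ?sT0.
move=> sw [sw'] E1; have Ef : node i w = node i' w'.
  by rewrite -(node_f i a sw) -(node_f i' a') -?sw' //= E1.
have [Ei Ew] := IH w' (ltnW sw) sw' Ef; split; rewrite // Ew; congr (_ :: _).
apply/val_inj/eqP; move/eqP: E1.
by rewrite /= -sw' -Ef nth_uniq ?filter_uniq ?undup_uniq // sfib // node_level // ltnW.
Qed.

Lemma node_surj k x : (k <= n)%N -> x \in T k -> exists i w, size w = k /\ node i w = x.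
Proof.
elim: k x => [|k IH] x kn Tx.
  have ix : (index x (T 0) < d.-1)%N by rewrite -sT0 index_mem.
  by exists (Ordinal ix), [::]; rewrite /= nth_index.
have [i [w [sw Ew]]] := IH (f_ x) (ltnW kn) (level_f_ d_gt1 theta iota_inj rsP kn Tx).
have fx : x \in fiber k (f_ x) by rewrite mem_filter Tx eqxx.
have ix : (index x (fiber k (f_ x)) < d)%N.
  have := sfib kn (level_f_ d_gt1 theta iota_inj rsP kn Tx) => sf.
  by move: fx; rewrite -index_mem sf.
by exists i, (Ordinal ix :: w); rewrite /= sw Ew nth_index.
Qed.

Definition label (p : 'I_d.-1 * seq 'I_d) := node p.1 (rev p.2).

Lemma label_level p : (size p.2 <= n)%N -> label p \in T (size p.2).
Proof. by move=> sp; rewrite -(size_rev p.2) node_level // size_rev. Qed.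

Lemma label_f i w a : (size w < n)%N -> f_ (label (i, rcons w a)) = label (i, w).
Proof. by move=> sw; rewrite /label /= rev_rcons node_f // size_rev. Qed.

Lemma label_inj p q : (size p.2 <= n)%N -> size p.2 = size q.2 -> label p = label q -> p = q.
Proof.
case: p q => [i w] [j v] /= sw swv /node_inj []; rewrite ?size_rev //.
by move=> /= -> /(can_inj revK) ->.
Qed.

Lemma label_surj k x : (k <= n)%N -> x \in T k -> exists p, size p.2 = k /\ label p = x.
Proof.
move=> kn /(node_surj kn) [i [w [sw Ew]]]; exists (i, rev w).
by rewrite /label /= size_rev revK.
Qed.

Definition wr_act (u : sym_wreath d.-1 (iter_sym_wreath d n)) (p : 'I_d.-1 * seq 'I_d) :=
  (wr_top u p.1, word_act (wr_base u (wr_top u p.1)) p.2).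

Lemma size_wr_act u p : size (wr_act u p).2 = size p.2.
Proof. exact: size_word_act. Qed.

Lemma wr_actM u v p : wr_act (u * v)%g p = wr_act v (wr_act u p).
Proof. by rewrite /wr_act /= wr_topM permM wr_baseM word_actM. Qed.

Lemma wr_act_inj u : injective (wr_act u).
Proof. by move=> [i w] [j v] [/= /perm_inj -> /word_act_inj ->]. Qed.

Definition labels k : seq ('I_d.-1 * seq 'I_d) :=
  [seq (p.1, tval p.2) | p : 'I_d.-1 * k.-tuple 'I_d].

Lemma labels_uniq k : uniq (labels k).
Proof.
by rewrite map_inj_uniq ?enum_uniq // => -[i w] [j v] [/= -> /val_inj ->].
Qed.

Lemma mem_labels k p : (p \in labels k) = (size p.2 == k).
Proof.
case: p => i w; apply/imageP/eqP => [[q _ [-> ->]]|sw]; first exact: size_tuple.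
by exists (i, Tuple (introT eqP sw)).
Qed.

(** If [g] is right on level [k], then on level [k.+1] the nodes [g (label p)] and
    [label (wr_act u p)] have the same parent, and [sib_realize] corrects the difference. *)
Lemma wr_realize u : exists2 g : gal_of E, g \in G &
  forall p, size p.2 = n -> g (label p) = label (wr_act u p).
Proof.
suff H k : (k <= n)%N -> exists2 g : gal_of E, g \in G &
  forall p, size p.2 = k -> g (label p) = label (wr_act u p) by exact: H (leqnn n).
elim: k => [_|k IH kn].
  have [||p|g gG [gP _]] := sib_realize d_gt1 theta iota_inj rsP rsE
      (s := label) (t := label \o wr_act u) (leq0n n) (labels_uniq 0).
  - move=> p q; rewrite !mem_labels => /eqP sp /eqP sq.
    by apply: label_inj; rewrite sp ?sq.
  - move=> p q; rewrite !mem_labels => /eqP sp /eqP sq /= /label_inj H.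
    by apply: (@wr_act_inj u); apply: H; rewrite !size_wr_act sp ?sq.
  - rewrite mem_labels => /eqP sp; have T1 := @label_level p; have T2 := @label_level (wr_act u p).
    by rewrite size_wr_act sp in T1 T2; split=> //=; [apply: T1 | apply: T2].
  by exists g => // p sp; apply: gP; rewrite mem_labels sp.
have [g gG gP] := IH (ltnW kn).
have [||p|h hG [hP _]] := sib_realize d_gt1 theta iota_inj rsP rsE
    (s := fun p => g (label p)) (t := label \o wr_act u) kn (labels_uniq k.+1).
- move=> p q; rewrite !mem_labels => /eqP sp /eqP sq /fmorph_inj.
  by apply: label_inj; rewrite sp ?sq.
- move=> p q; rewrite !mem_labels => /eqP sp /eqP sq /= /label_inj H.
  by apply: (@wr_act_inj u); apply: H; rewrite !size_wr_act sp ?sq.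
- rewrite mem_labels => /eqP sp; have T1 := @label_level p; have T2 := @label_level (wr_act u p).
  rewrite size_wr_act sp in T1 T2; split; rewrite ?Tgal ?T1 ?T2 //.
  apply/orP; right; apply/eqP; rewrite -gal_f_; case: p sp {T1 T2} => i w /=.
  case/lastP: w => // w a; rewrite size_rcons => -[sw].
  rewrite label_f ?sw // gP // /wr_act /=.
  have [b ->] := word_act_rcons (wr_base u (wr_top u i)) w a.
  by rewrite label_f ?size_word_act ?sw.
exists (g * h)%g; first exact: groupM.
move=> p sp; have T1 : label p \in T k.+1 by rewrite -sp label_level // sp.
by rewrite (gal_levelM rsE _ _ T1); apply: hP; rewrite mem_labels sp.
Qed.

(** As [g] commutes with [f_], the map [q] it induces on words respects prefixes; its first
    components give the top permutation, and [word_act_exists] gives the elements on the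
    subtrees. *)
Lemma wr_realize_surj (g : gal_of E) : g \in G ->
  exists u, forall p, size p.2 = n -> g (label p) = label (wr_act u p).
Proof.
move=> gG; have /choice [q qP] : forall p, exists q, (size p.2 <= n)%N ->
    size q.2 = size p.2 /\ label q = g (label p).
  move=> p; have [sp|nsp] := boolP (size p.2 <= n)%N; last by exists p => sp; case/negP: nsp.
  by have [q Hq] := label_surj sp (Tgal g sp (label_level sp)); exists q.
have qr i w a : (size w < n)%N ->
    exists b, q (i, rcons w a) = ((q (i, w)).1, rcons (q (i, w)).2 b).
  move=> sw; have sw' : (size (rcons w a) <= n)%N by rewrite size_rcons.
  have [/= s1 l1] := qP (i, rcons w a) sw'; have [/= s2 l2] := qP (i, w) (ltnW sw).
  case: (q (i, rcons w a)) s1 l1 => j v /=; case/lastP: v => [|v b]; first by rewrite size_rcons.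
  rewrite !size_rcons => -[sv] l1; exists b.
  suff -> : q (i, w) = (j, v) by [].
  apply: label_inj; [by rewrite s2 ltnW | by rewrite s2 | ].
  by rewrite l2 -(label_f i a sw) gal_f_ -l1 label_f // sv.
have q1 i w : (size w <= n)%N -> (q (i, w)).1 = (q (i, [::])).1.
  elim/last_ind: w => [//|w a IH]; rewrite size_rcons => sw.
  by have [b ->] := qr i w a sw; rewrite IH // ltnW.
have q_inj p p' : (size p.2 <= n)%N -> size p.2 = size p'.2 -> q p = q p' -> p = p'.
  move=> sp sp' Eq; apply: label_inj => //; suff: g (label p) = g (label p') by apply: fmorph_inj.
  by rewrite -(qP p sp).2 Eq (qP p' _).2 // -sp'.
have s_inj : injective (fun i => (q (i, [::])).1).
  move=> i j /= E1; suff [] : (i, [::] : seq 'I_d) = (j, [::]) by [].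
  apply: q_inj => //; have [/= s1 _] := qP (i, [::]) (leq0n n).
  have [/= s2 _] := qP (j, [::]) (leq0n n).
  by case: (q (i, _)) (q (j, _)) E1 s1 s2 => [k [|? ?]] [k' [|? ?]] //= ->.
have /choice [x xP] : forall i, exists u : iter_sym_wreath d n,
    forall w, (size w <= n)%N -> word_act u w = (q (i, w)).2.
  move=> i; apply: word_act_exists => [w sw|w a sw|w w' sw sw' E1].
  - by have [] := qP (i, w) sw.
  - by have [b ->] := qr i w a sw; exists b.
  - suff [] : (i, w) = (i, w') by [].
    apply: q_inj => //; move: (q1 i w sw) (q1 i w'); rewrite -sw' => E2 /(_ sw) E3.
    by case: (q (i, w)) (q (i, w')) E1 E2 E3 => [? ?] [? ?] /= -> -> ->.
have [u [ut ub]] := wr_exists (perm s_inj) (fun i => x ((perm s_inj)^-1%g i)).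
exists u => -[i w] /= sw; have sw' : (size w <= n)%N by rewrite sw.
rewrite -(qP (i, w) sw').2; congr label; rewrite /wr_act /= ut ub permK permE xP //.
by rewrite -(q1 i w sw'); case: (q _).
Qed.

Lemma gal_level_eq (g h : gal_of E) : {in T n, g =1 h} -> g = h.
Proof.
move=> gh; have gh' x : x \in rs -> g x = h x.
  by move=> rx; apply: gh; rewrite mem_undup subnn map_id.
suff : (g * h^-1)%g = 1%g by move/(congr1 (mulg^~ h)); rewrite mulgKV mul1g.
apply/eqP/gal_eqP => x Ex; rewrite gal_id.
suff : (E <= fixedField [set (g * h^-1)%g])%VS.
  move/subvP/(_ x Ex)/fixedFieldP => /(_ Ex (g * h^-1)%g); apply.
  by rewrite inE.
rewrite -{1}rsE; apply/Fadjoin_seqP; split=> [|y ry].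
  by apply/subvP => y /vlineP [c ->]; rewrite rpredZ // rpred1.
have Ey : y \in E by rewrite -rsE; apply: seqv_sub_adjoin.
apply/fixedFieldP => // s; rewrite inE => /eqP ->.
by rewrite galM // gh' // -galM // mulgV gal_id.
Qed.

(** Both groups act faithfully on level [n], by the same permutations of labels. *)
Lemma gal_isog : G \isog [set: sym_wreath d.-1 (iter_sym_wreath d n)].
Proof.
have /choice [phi phiP] : forall u, exists g : gal_of E, g \in G /\
    forall p, size p.2 = n -> g (label p) = label (wr_act u p).
  by move=> u; have [g gG gP] := wr_realize u; exists g.
have phiE (g h : gal_of E) :
    (forall p, size p.2 = n -> g (label p) = h (label p)) -> g = h.
  move=> gh; apply: gal_level_eq => x Tx; have [p [sp <-]] := label_surj (leqnn n) Tx.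
  exact: gh.
have phiM : {in [set: sym_wreath d.-1 (iter_sym_wreath d n)] &, {morph phi : u v / (u * v)%g}}.
  move=> u v _ _; apply: phiE => p sp.
  have T1 : label p \in T n by move: (@label_level p); rewrite sp; apply.
  rewrite (gal_levelM rsE _ _ T1) (phiP _).2 // (phiP u).2 // (phiP v).2 ?size_wr_act //.
  by rewrite wr_actM.
rewrite isog_sym; apply/isogP; exists (Morphism phiM).
  apply/injmP => u v _ _ /= Euv.
  have act_eq p : size p.2 = n -> wr_act u p = wr_act v p.
    move=> sp; apply: label_inj; rewrite ?size_wr_act ?sp //.
    by rewrite -(phiP u).2 // Euv (phiP v).2.
  have d_gt0 := ltnW d_gt1; have i0 : 'I_d by exists 0%N.
  have Et : wr_top u = wr_top v.
    by apply/permP => i; have [] := act_eq (i, nseq n i0) (size_nseq _ _).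
  apply: wr_inj => // i; apply: (word_act_faithful d_gt0) => w sw.
  by have [_] := act_eq ((wr_top u)^-1%g i, w) sw; rewrite /= -Et permKV.
apply/setP => g; apply/morphimP/idP => [[u _ _ ->]|gG]; first exact: (phiP u).1.
have [u uP] := wr_realize_surj gG; exists u => //; apply: phiE => p sp.
by rewrite uP // (phiP u).2.
Qed.

End Realization.

Lemma Kst_pcancel (K : fieldExtType rat) (d : nat) :
  {f : Kst K d -> nat & {g : nat -> option (Kst K d) | pcancel f g}}.
Proof.
have [f [g fK]] := fieldExt_pcancel K.
pose cK : countFieldType := HB.pack_for countFieldType K (PCanIsCountable fK).
exact: (fraction_pcancel (mpoly_pcancel cK d)).
Qed.

Theorem theorem1p1 (K : fieldExtType rat) (d : nat) (hd : (2 <= d)%N) (n : nat)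
    (L : splittingFieldType (Kst K d)) (E : {subfield L})
    (hE : splittingFieldFor 1%VS
            (map_poly (in_alg L)
               ((generic_poly K d)^`() \Po iter_poly (generic_poly K d) n)) E) :
  'Gal(E / 1%VS)%g
    \isog [set: sym_wreath d.-1 (iter_sym_wreath d n)].
Proof.
have [rs rsP rsE] := hE.
(* [F] is a closed field containing [K(s, t)], and [O] below one containing [F(u)]. *)
have [F theta] := closure_exists (Kst_pcancel K d).
have polyF_pcancel : {f : {poly F} -> nat & {g : nat -> option {poly F} | pcancel f g}}.
  by exists pickle, unpickle; apply: pickleK.
have [O j] := closure_exists (fraction_pcancel polyF_pcancel).
have iota_inj : injective (j \o @FracField.tofrac {poly F}).
  by move=> p q /= /fmorph_inj /eqP; rewrite tofrac_eq => /eqP.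
exact: (gal_isog hd (theta : {rmorphism Kst K d -> F}) iota_inj rsP rsE).
Qed.
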